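(* Let $\tau=\frac12(1+\sqrt5)$, $f(x)=\tau x$, and let $\boldsymbol{\nu}=(\boldsymbol{\nu}_{aa},\boldsymbol{\nu}_{ab},\boldsymbol{\nu}_{ba},\boldsymbol{\nu}_{bb})$ be the unique solution of $$\begin{aligned} \boldsymbol{\nu}_{aa}&=\tfrac1\tau\bigl(f.\boldsymbol{\nu}_{aa}+f.\boldsymbol{\nu}_{ab}+f.\boldsymbol{\nu}_{ba}+f.\boldsymbol{\nu}_{bb}\bigr),\\ \boldsymbol{\nu}_{ab}&=\tfrac1\tau\,\delta_\tau*\bigl(f.\boldsymbol{\nu}_{aa}+f.\boldsymbol{\nu}_{ba}\bigr),\\ \boldsymbol{\nu}_{ba}&=\tfrac1\tau\,\delta_{-\tau}*\bigl(f.\boldsymbol{\nu}_{aa}+f.\boldsymbol{\nu}_{ab}\bigr),\\ \boldsymbol{\nu}_{bb}&=\tfrac1\tau\,f.\boldsymbol{\nu}_{aa} \end{aligned}$$ among pure point measures on $\mathbb{R}$ with support in $\{z\in\mathbb{Z}[\tau]: z^\star\in[-\tau,\tau]\}$ that satisfy $\widetilde{\boldsymbol{\nu}_{\alpha\beta}}=\boldsymbol{\nu}_{\beta\alpha}$ for $\alpha,\beta\in\{a,b\}$, with initial condition $\boldsymbol{\nu}_{aa}(\{0\})=\frac1\tau$. If $\boldsymbol{\nu}=(\boldsymbol{\nu})_{\mathsf{s}}+(\boldsymbol{\nu})_0$ is the (componentwise) decomposition of $\boldsymbol{\nu}$ into its strongly almost periodic part $(\boldsymbol{\nu})_{\mathsf{s}}$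 and its null-weakly almost periodic part $(\boldsymbol{\nu})_0$, then $(\boldsymbol{\nu})_0=0$, which means that all Fourier transforms $\widehat{\boldsymbol{\nu}_{\alpha\beta}}$ are pure point measures.
   Context: Here $x\mapsto x^\star$ is algebraic conjugation $\sqrt5\mapsto-\sqrt5$ in $\mathbb{Q}(\sqrt5)$; $f.\mu$ is the push-forward $(f.\mu)(g)=\mu(g\circ f)$; $\delta_x$ is the Dirac measure at $x$; $\widetilde\mu(g)=\overline{\mu(\widetilde g)}$ with $\widetilde g(x)=\overline{g(-x)}$. The stated system with its constraints does have a unique solution for given $\boldsymbol{\nu}_{aa}(\{0\})$, and for the value $\frac1\tau$ it is given by the pair correlation measures of the Fibonacci chain: $$\boldsymbol{\nu}_{\alpha\beta}=\sum_{z\in\varLambda-\varLambda}\nu_{\alpha\beta}(z)\,\delta_z,\qquad \nu_{\alpha\beta}(z)=\lim_{R\to\infty}\frac{\mathrm{card}\{x\in\varLambda_\alpha\cap(-R,R): x+z\in\varLambda_\beta\}}{\mathrm{card}(\varLambda\cap(-R,R))},$$ where $\varLambda_a=\{x\in\mathbb{Z}[\tau]:x^\star\in(\tau-2,\tau-1]\}$, $\varLambda_b=\{x\in\mathbb{Z}[\tau]:x^\star\in(-1,\tau-2]\}$ are the sets of left endpoints of the tiles of type $a$ (length $\tau$) and $b$ (length $1$) in the fixed point of the square of the inflation $a\mapsto ab$, $b\mapsto a$ with seed $a|a$, and $\varLambda=\varLambda_a\cup\varLambda_b$. These measures are translation bounded and Fourier transformable (their Fourier transforms, with kernel $e^{-2\pi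 ikx}$, are measures). For such a measure $\mu$, the pure point part and the continuous part of $\widehat\mu$ are themselves transformable, and the decomposition $\mu=\mu_{\mathsf{s}}+\mu_0$ into strongly almost periodic and null-weakly almost periodic part is the unique one for which $\widehat{\mu_{\mathsf{s}}}=(\widehat\mu)_{\mathsf{pp}}$ is the pure point part and $\widehat{\mu_0}=(\widehat\mu)_{\mathsf{cont}}$ is the continuous part of $\widehat\mu$. *)

(* Defs.v *)
From Stdlib Require Import Reals List ZArith QArith Qreals.
From Coquelicot Require Import Coquelicot.

Open Scope R_scope.

Definition Cc (g : R -> C) : Prop :=
  (forall x, continuous g x) /\
  exists A : R, forall x, A < Rabs x -> g x = RtoC 0.

(* A (complex, possibly unbounded) measure is a linear functional on Cc, bounded
   on the test functions supported in any given compact set.  The carrier is the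
   raw function type: values outside Cc are junk and are never inspected. *)
Definition functional : Type := (R -> C) -> C.

Record is_measure (mu : functional) : Prop := {
  measure_linear : forall (c : C) (g h : R -> C), Cc g -> Cc h ->
    mu (fun x => Cplus (Cmult c (g x)) (h x)) = Cplus (Cmult c (mu g)) (mu h);
  measure_bounded : forall K : R, exists M : R, forall (g : R -> C) (B : R),
    Cc g -> (forall x, K < Rabs x -> g x = RtoC 0) ->
    (forall x, Cmod (g x) <= B) -> Cmod (mu g) <= M * B }.

Definition meas_eq (mu nu : functional) : Prop := forall g, Cc g -> mu g = nu g.

Definition mzero : functional := fun _ => RtoC 0.
Definition madd (mu nu : functional) : functional := fun g => Cplus (mu g) (nu g).
Definition mscale (c : R) (mu : functional) : functional :=
  fun g => Cmult (RtoC c) (mu g).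
Definition dirac (x : R) : functional := fun g => g x.
Definition push (f : R -> R) (mu : functional) : functional :=
  fun g => mu (fun x => g (f x)).
(* Meaningful when mu or nu has compact support. *)
Definition mconv (mu nu : functional) : functional :=
  fun g => mu (fun x => nu (fun y => g (x + y))).
Definition mtilde (mu : functional) : functional :=
  fun g => Cconj (mu (fun x => Cconj (g (- x)))).

Declare Scope measure_scope.
Delimit Scope measure_scope with M.
Notation "mu == nu" := (meas_eq mu nu) (at level 70) : measure_scope.
Notation "mu + nu" := (madd mu nu) : measure_scope.
Notation "c *: mu" := (mscale c mu) (at level 40) : measure_scope.
Notation "mu ** nu" := (mconv mu nu) (at level 40, left associativity) : measure_scope.

(** mu({x}) = c, computed by dominated convergence along tent functions
    decreasing to the indicator function of {x}. *)
Definition tent (x : R) (n : nat) : R -> C :=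
  fun y => RtoC (Rmax 0 (1 - INR (S n) * Rabs (y - x))).
Definition point_mass (mu : functional) (x : R) (c : C) : Prop :=
  filterlim (fun n => mu (tent x n)) eventually (locally c).

(** mu = sum over x in P of mu({x}) delta_x for a countable set P, enumerated
    by u (padded with points of mass zero if P is finite).  For a measure, local
    absolute convergence of this sum is automatic. *)
Definition pure_point (mu : functional) : Prop :=
  exists (u : nat -> R) (c : nat -> C),
    (forall m n, u m = u n -> m = n) /\
    (forall n, point_mass mu (u n) (c n)) /\
    forall g, Cc g -> is_series (fun n => Cmult (c n) (g (u n))) (mu g).

Definition in_support (mu : functional) (x : R) : Prop :=
  forall eps : R, 0 < eps ->
    exists g, Cc g /\ (forall y, eps <= Rabs (y - x) -> g y = RtoC 0) /\
              mu g <> RtoC 0.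

Definition translation_bounded (mu : functional) : Prop :=
  exists M : R, forall (t : R) (g : R -> C), Cc g ->
    (forall x, ~ (t <= x <= t + 1) -> g x = RtoC 0) ->
    (forall x, Cmod (g x) <= 1) -> Cmod (mu g) <= M.

(* The function g * mu. *)
Definition fconv (g : R -> C) (mu : functional) : R -> C :=
  fun x => mu (fun y => g (x - y)).

Definition bohr_ap (F : R -> C) : Prop :=
  (forall x, continuous F x) /\
  forall eps : R, 0 < eps ->
    exists L : R, 0 < L /\
      forall x, exists t, x <= t <= x + L /\
        forall y, Cmod (Cminus (F (y + t)) (F y)) < eps.

Definition strongly_ap (mu : functional) : Prop :=
  is_measure mu /\ translation_bounded mu /\ forall g, Cc g -> bohr_ap (fconv g mu).

(* Elements of the continuous dual of the Banach space Cu are again raw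
   functionals, whose values outside Cu are junk. *)
Definition Cu (F : R -> C) : Prop :=
  (exists B : R, forall x, Cmod (F x) <= B) /\
  forall eps : R, 0 < eps -> exists delta : R, 0 < delta /\
    forall x y, Rabs (x - y) < delta -> Cmod (Cminus (F x) (F y)) < eps.

Record in_dual (l : functional) : Prop := {
  dual_linear : forall (c : C) (F G : R -> C), Cu F -> Cu G ->
    l (fun x => Cplus (Cmult c (F x)) (G x)) = Cplus (Cmult c (l F)) (l G);
  dual_bounded : exists M : R, forall (F : R -> C) (B : R),
    Cu F -> (forall x, Cmod (F x) <= B) -> Cmod (l F) <= M * B }.

Definition weak_nbhd (ls : list functional) (eps : R) (F : R -> C) (H : R -> C) : Prop :=
  Cu H /\ List.Forall (fun l => Cmod (Cminus (l H) (l F)) < eps) ls.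

Definition weak_closure (A : (R -> C) -> Prop) (F : R -> C) : Prop :=
  Cu F /\
  forall (ls : list functional) (eps : R), List.Forall in_dual ls -> 0 < eps ->
    exists H, A H /\ weak_nbhd ls eps F H.

(* Compactness of K in the weak topology of Cu, in terms of cluster points of filters. *)
Definition weakly_compact (K : (R -> C) -> Prop) : Prop :=
  forall Phi : ((R -> C) -> Prop) -> Prop, ProperFilter Phi -> Phi K ->
    exists F, K F /\
      forall (A : (R -> C) -> Prop) (ls : list functional) (eps : R),
        Phi A -> List.Forall in_dual ls -> 0 < eps ->
        exists H, A H /\ weak_nbhd ls eps F H.

Definition orbit (F : R -> C) (H : R -> C) : Prop :=
  exists t : R, forall x, H x = F (x + t).

Definition wap (F : R -> C) : Prop :=
  Cu F /\ weakly_compact (weak_closure (orbit F)).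

Definition null_wap (F : R -> C) : Prop :=
  wap F /\
  is_lim (fun T => / (2 * T) * RInt (fun x => Cmod (F x)) (- T) T) p_infty 0.

Definition null_weakly_ap (mu : functional) : Prop :=
  is_measure mu /\ translation_bounded mu /\ forall g, Cc g -> null_wap (fconv g mu).

Definition eberlein_decomposition (mu mu_s mu_0 : functional) : Prop :=
  strongly_ap mu_s /\ null_weakly_ap mu_0 /\ (mu == mu_s + mu_0)%M.

Definition smooth (phi : R -> C) : Prop :=
  forall (n : nat) (x : R),
    ex_derive_n (fun y => Re (phi y)) n x /\ ex_derive_n (fun y => Im (phi y)) n x.

Definition fourier (phi : R -> C) : R -> C := fun x =>
  RInt_gen (V := C_R_CompleteNormedModule)
    (fun k => Cmult (phi k) (cos (2 * PI * k * x), - sin (2 * PI * k * x)))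
    (Rbar_locally m_infty) (Rbar_locally p_infty).

Definition cutoff (n : nat) : R -> C :=
  fun x => RtoC (Rmax 0 (Rmin 1 (INR n + 1 - Rabs x))).

(** The continuous function h is integrable with respect to |mu|, where
    |mu|(|h|) is the supremum of |mu(g)| over g in Cc with |g| <= |h|, and its
    integral with respect to mu is l. *)
Definition is_integral (mu : functional) (h : R -> C) (l : C) : Prop :=
  (exists M : R, forall g, Cc g -> (forall x, Cmod (g x) <= Cmod (h x)) ->
     Cmod (mu g) <= M) /\
  filterlim (fun n => mu (fun x => Cmult (h x) (cutoff n x))) eventually (locally l).

(** The Fourier transform of mu as a tempered distribution,
    phi |-> mu (fourier phi), is the measure rho.  Since smooth compactly
    supported functions are dense in Cc and in the Schwartz space, it is enough
    to test on them, and they determine rho. *)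
Definition is_fourier_transform (mu rho : functional) : Prop :=
  is_measure rho /\
  forall phi, Cc phi -> smooth phi -> is_integral mu (fourier phi) (rho phi).

Definition tau : R := (1 + sqrt 5) / 2.

Definition in_Ztau (z : R) : Prop := exists m n : Z, z = IZR m + IZR n * tau.

(* The graph of the conjugation of Q(sqrt 5). *)
Definition conj5 (z w : R) : Prop :=
  exists p q : Q, z = Q2R p + Q2R q * sqrt 5 /\ w = Q2R p - Q2R q * sqrt 5.

Definition admissible_point (z : R) : Prop :=
  in_Ztau z /\ exists w, conj5 z w /\ - tau <= w <= tau.

Inductive letter : Type := ta | tb.

Definition inflate (x : R) : R := tau * x.

Record renormalisation (nu : letter -> letter -> functional) : Prop := {
  ren_aa : (nu ta ta == (1 / tau) *:
              (push inflate (nu ta ta) + push inflate (nu ta tb)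
               + push inflate (nu tb ta) + push inflate (nu tb tb)))%M;
  ren_ab : (nu ta tb == (1 / tau) *:
              (dirac tau ** (push inflate (nu ta ta) + push inflate (nu tb ta))))%M;
  ren_ba : (nu tb ta == (1 / tau) *:
              (dirac (- tau) ** (push inflate (nu ta ta) + push inflate (nu ta tb))))%M;
  ren_bb : (nu tb tb == (1 / tau) *: push inflate (nu ta ta))%M }.

Record is_solution (nu : letter -> letter -> functional) : Prop := {
  sol_measure : forall i j, is_measure (nu i j);
  sol_pure_point : forall i j, pure_point (nu i j);
  sol_support : forall i j x, in_support (nu i j) x -> admissible_point x;
  sol_tilde : forall i j, (mtilde (nu i j) == nu j i)%M;
  sol_initial : point_mass (nu ta ta) 0 (RtoC (1 / tau));
  sol_renormalisation : renormalisation nu }.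

(* Main.v *)
Require Import Defs.
From Stdlib Require Import Reals List ZArith Qreals Lra Lia Psatz.
From Stdlib Require Import ClassicalEpsilon FunctionalExtensionality FinFun Cantor.
From Coquelicot Require Import Coquelicot.
Import ListNotations.

(** Let [h_ij y] be the length of the intersection of the windows [W_i] and [W_j - y],
    divided by [tau]. The solution has mass [h_ij] of the conjugate at each point of
    Z[tau]: since [W_a] and [W_b] tile an interval on which the inflation acts as
    scaling by [-1/tau], the renormalisation relations hold. Conversely they express
    the masses at [z] by masses at [z/tau], [z/tau - 1] and [z/tau + 1], which contracts
    towards [|z| <= tau^2]; only nine points there are admissible, and on them the
    relations and the mass of [nu_aa] at 0 determine everything.

    [h_ij] is Lipschitz, so each [t] in Z[tau] with small conjugate is a uniform almost
    period of [g * nu_ij]; hence the convolution of [g] with the null part is a difference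
    of Bohr almost periodic functions. Its absolute value has mean zero, so it vanishes.

    The Fourier transform is [(1/sqrt 5) sum hhat(k + p) delta_k] over the points
    [k = (q + p (1 - tau))/sqrt 5] of the dual module: as [h_ij] is piecewise linear, [hhat]
    decays quadratically and the masses are locally summable. The required summation
    formula is two one-dimensional Poisson summations, both obtained from the Fejer
    kernel as an approximate identity. *)

(** * Unordered sums *)

(** Each Poisson formula comes from one limit computed twice. Expanded into characters, the integral
    of [psi] against a Fejer kernel is a finite sum of Fourier coefficients with weights in [[0, 1]]
    that tend to 1, so it tends to the full sum once the coefficients are summable. As an
    approximate identity, the kernel picks the values of [psi] at the integers. Continuity and
    summability suffice, which suits [h_ij] with its corners. The factor [1/sqrt 5] is the inverse
    covolume of the lattice of pairs of a number and its conjugate.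

    Z[tau] is dense, so nothing can be summed by position: sums are unordered, which also lets
    inflation and translation act by reindexing and lets the lattice be cut into rows. The masses of
    an unknown solution are reached through test functions that are 1 at one admissible point and 0
    at all others; these exist because admissible points, unlike Z[tau], are locally finite.

    The null part is handled without the theory of weakly almost periodic functions: only the zero
    measure has to be shown null weakly almost periodic. *)

Lemma Rinv_nonneg x : 0 < x -> 0 <= / x.
Proof. intros H; now apply Rlt_le, Rinv_0_lt_compat. Qed.

(** Classical, so that [nodup] and [remove] apply to every index type. *)
Definition dec {I : Type} (x y : I) : {x = y} + {x <> y} :=
  excluded_middle_informative (x = y).

Definition rsum {I : Type} (b : I -> R) (l : list I) : R :=
  fold_right (fun i s => b i + s) 0 l.

Definition csum {I : Type} (f : I -> C) (l : list I) : C :=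
  fold_right (fun i s => Cplus (f i) s) (RtoC 0) l.

(** Convergence along the directed family of finite sets, which for complex terms amounts to
    absolute convergence. No enumeration is fixed, so every bijection of the index set preserves
    sums. *)
Definition has_sum {I : Type} (f : I -> C) (s : C) : Prop :=
  forall eps, 0 < eps -> exists A, forall B, NoDup B -> incl A B ->
    Cmod (Cminus (csum f B) s) < eps.

Definition bounded_sums {I : Type} (b : I -> R) (M : R) : Prop :=
  (forall i, 0 <= b i) /\ forall B, NoDup B -> rsum b B <= M.

Lemma rsum_app {I} (b : I -> R) l m : rsum b (l ++ m) = rsum b l + rsum b m.
Proof. induction l; simpl; [|rewrite IHl]; lra. Qed.

Lemma csum_app {I} (f : I -> C) l m : csum f (l ++ m) = Cplus (csum f l) (csum f m).
Proof. induction l; simpl; [|rewrite IHl]; ring. Qed.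

Lemma rsum_nonneg {I} (b : I -> R) l : (forall i, 0 <= b i) -> 0 <= rsum b l.
Proof. intros H; induction l; simpl; [|specialize (H a)]; lra. Qed.

Lemma rsum_le {I} (b c : I -> R) l :
  (forall i, In i l -> b i <= c i) -> rsum b l <= rsum c l.
Proof.
  induction l; simpl; intros H; [lra|].
  generalize (H a (or_introl eq_refl)) (IHl (fun i h => H i (or_intror h))); lra.
Qed.

Lemma rsum_scal {I} (b : I -> R) k l : rsum (fun i => k * b i) l = k * rsum b l.
Proof. induction l; simpl; [|rewrite IHl]; lra. Qed.

Lemma csum_ext {I} (f g : I -> C) l :
  (forall i, In i l -> f i = g i) -> csum f l = csum g l.
Proof.
  induction l; simpl; intros H; [easy|].
  now rewrite (H a), IHl; auto.
Qed.

Lemma csum_zero {I} (f : I -> C) l :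
  (forall i, In i l -> f i = RtoC 0) -> csum f l = RtoC 0.
Proof.
  induction l; simpl; intros H; [easy|].
  rewrite (H a), IHl; auto; ring.
Qed.

Lemma csum_linear {I} (c : C) (f g : I -> C) l :
  csum (fun i => Cplus (Cmult c (f i)) (g i)) l = Cplus (Cmult c (csum f l)) (csum g l).
Proof. induction l; simpl; [|rewrite IHl]; ring. Qed.

Lemma csum_scal {I} (c : C) (f : I -> C) l :
  csum (fun i => Cmult c (f i)) l = Cmult c (csum f l).
Proof. induction l; simpl; [|rewrite IHl]; ring. Qed.

Lemma csum_map {I J} (f : I -> C) (p : J -> I) l :
  csum f (map p l) = csum (fun j => f (p j)) l.
Proof. induction l; simpl; congruence. Qed.

Lemma Cmod_csum {I} (f : I -> C) l : Cmod (csum f l) <= rsum (fun i => Cmod (f i)) l.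
Proof.
  induction l; simpl; [rewrite Cmod_0; lra|].
  generalize (Cmod_triangle (f a) (csum f l)); lra.
Qed.

Lemma RtoC_m1 : RtoC (-1) = Copp (RtoC 1).
Proof. rewrite <- RtoC_opp; f_equal; ring. Qed.

Lemma Cmod_minus_sym a b : Cmod (Cminus a b) = Cmod (Cminus b a).
Proof. rewrite <- Cmod_opp; f_equal; ring. Qed.

Lemma Cmod_minus_triangle a b c :
  Cmod (Cminus a c) <= Cmod (Cminus a b) + Cmod (Cminus b c).
Proof.
  replace (Cminus a c) with (Cplus (Cminus a b) (Cminus b c)) by ring.
  apply Cmod_triangle.
Qed.

Lemma Cmod_minus_diag a : Cmod (Cminus a a) = 0.
Proof. replace (Cminus a a) with (RtoC 0) by ring; apply Cmod_0. Qed.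

Lemma Cmod_le_minus a b : Cmod a <= Cmod b + Cmod (Cminus b a).
Proof.
  rewrite Cmod_minus_sym.
  replace a with (Cplus b (Cminus a b)) at 1 by ring; apply Cmod_triangle.
Qed.

Lemma Cmod_minus_eq a b : (forall eps, 0 < eps -> Cmod (Cminus a b) < eps) -> a = b.
Proof.
  intros H.
  assert (E : Cmod (Cminus a b) = 0).
  { apply Rle_antisym; [|apply Cmod_ge_0].
    apply Rnot_lt_le; intros K; specialize (H _ K); lra. }
  apply Cmod_eq_0 in E.
  replace a with (Cplus (Cminus a b) b) by ring; rewrite E; ring.
Qed.

Lemma incl_nodup {I} (A B : list I) : incl A B -> incl A (nodup dec B).
Proof. intros H i Hi; apply nodup_In; auto. Qed.

Lemma has_sum_unique {I} (f : I -> C) s t : has_sum f s -> has_sum f t -> s = t.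
Proof.
  intros Hs Ht; apply Cmod_minus_eq; intros eps He.
  destruct (Hs (eps / 2)) as [A HA]; [lra|].
  destruct (Ht (eps / 2)) as [B HB]; [lra|].
  specialize (HA (nodup dec (A ++ B)) (NoDup_nodup _ _)
    (incl_nodup _ _ (incl_appl _ (incl_refl _)))).
  specialize (HB (nodup dec (A ++ B)) (NoDup_nodup _ _)
    (incl_nodup _ _ (incl_appr _ (incl_refl _)))).
  generalize (Cmod_minus_triangle s (csum f (nodup dec (A ++ B))) t).
  rewrite (Cmod_minus_sym s (csum _ _)); lra.
Qed.

Lemma has_sum_ext {I} (f g : I -> C) s :
  (forall i, f i = g i) -> has_sum f s -> has_sum g s.
Proof. intros H; now replace g with f by now apply functional_extensionality. Qed.

Lemma has_sum_linear {I} (c : C) (f g : I -> C) s t :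
  has_sum f s -> has_sum g t ->
  has_sum (fun i => Cplus (Cmult c (f i)) (g i)) (Cplus (Cmult c s) t).
Proof.
  intros Hs Ht eps He.
  assert (Hc : 0 < Cmod c + 1) by (generalize (Cmod_ge_0 c); lra).
  destruct (Hs (eps / 2 / (Cmod c + 1))) as [A HA].
  { apply Rdiv_lt_0_compat; lra. }
  destruct (Ht (eps / 2)) as [B HB]; [lra|].
  exists (A ++ B); intros L HL Hincl.
  specialize (HA L HL (fun i h => Hincl i (in_or_app _ _ _ (or_introl h)))).
  specialize (HB L HL (fun i h => Hincl i (in_or_app _ _ _ (or_intror h)))).
  rewrite csum_linear.
  replace (Cminus (Cplus (Cmult c (csum f L)) (csum g L)) (Cplus (Cmult c s) t))
    with (Cplus (Cmult c (Cminus (csum f L) s)) (Cminus (csum g L) t)) by ring.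
  eapply Rle_lt_trans; [apply Cmod_triangle|].
  rewrite Cmod_mult.
  assert (Cmod c * Cmod (Cminus (csum f L) s) <= eps / 2); [|lra].
  apply Rle_trans with ((Cmod c + 1) * (eps / 2 / (Cmod c + 1))).
  - apply Rmult_le_compat; try apply Cmod_ge_0; lra.
  - right; field; lra.
Qed.

Lemma csum_remove {I} (f : I -> C) a B :
  NoDup B -> In a B -> csum f B = Cplus (f a) (csum f (remove dec a B)).
Proof.
  induction B as [|b B IH]; simpl; [easy|]; intros HB Ha.
  inversion HB; subst.
  destruct (dec a b) as [->|Hab].
  - now rewrite notin_remove.
  - destruct Ha as [Ha|Ha]; [congruence|]; simpl; rewrite IH by assumption; ring.
Qed.

Lemma NoDup_remove_dec {I} (a : I) B : NoDup B -> NoDup (remove dec a B).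
Proof.
  induction B as [|b B IH]; simpl; [easy|]; intros HB; inversion HB; subst.
  destruct (dec a b); auto; constructor; auto.
  intros Hin; apply in_remove in Hin; tauto.
Qed.

Lemma csum_incl {I} (f : I -> C) A B :
  NoDup A -> NoDup B -> incl A B -> (forall i, In i B -> ~ In i A -> f i = RtoC 0) ->
  csum f B = csum f A.
Proof.
  revert B; induction A as [|a A IH]; simpl; intros B HA HB Hincl Hf.
  - apply csum_zero; auto.
  - inversion HA; subst.
    rewrite (csum_remove f a B); auto; [|apply Hincl; now left].
    rewrite (IH (remove dec a B)); auto.
    + now apply NoDup_remove_dec.
    + intros i Hi; apply in_in_remove; [congruence|apply Hincl; now right].
    + intros i Hi Hn; apply in_remove in Hi; apply Hf; [tauto|].
      intros [|]; [symmetry in H; tauto|tauto].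
Qed.

Lemma rsum_incl {I} (b : I -> R) A B :
  (forall i, 0 <= b i) -> NoDup A -> incl A B -> rsum b A <= rsum b B.
Proof.
  intros Hb; revert B; induction A as [|a A IH]; simpl; intros B HA Hincl.
  - now apply rsum_nonneg.
  - inversion HA; subst.
    destruct (in_split a B) as (B1 & B2 & ->); [apply Hincl; now left|].
    rewrite rsum_app; simpl.
    assert (rsum b A <= rsum b (B1 ++ B2)); [|rewrite rsum_app in *; lra].
    apply IH; auto; intros i Hi.
    assert (K := Hincl i (or_intror Hi)); apply in_app_or in K; apply in_or_app.
    destruct K as [K|[K|K]]; auto; congruence.
Qed.

Lemma has_sum_finite {I} (f : I -> C) A :
  NoDup A -> (forall i, ~ In i A -> f i = RtoC 0) -> has_sum f (csum f A).
Proof.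
  intros HA Hf eps He; exists A; intros B HB Hincl.
  rewrite (csum_incl f A B); auto.
  now rewrite Cmod_minus_diag.
Qed.

Lemma has_sum_zero {I} : has_sum (fun _ : I => RtoC 0) (RtoC 0).
Proof. apply (has_sum_finite (fun _ : I => RtoC 0) []); [constructor|easy]. Qed.

Lemma has_sum_scal {I} (c : C) (f : I -> C) s :
  has_sum f s -> has_sum (fun i => Cmult c (f i)) (Cmult c s).
Proof.
  intros H; assert (K := has_sum_linear c f _ _ _ H has_sum_zero).
  replace (Cmult c s) with (Cplus (Cmult c s) (RtoC 0)) by ring.
  revert K; apply has_sum_ext; intros; ring.
Qed.

Lemma has_sum_plus {I} (f g : I -> C) s t :
  has_sum f s -> has_sum g t -> has_sum (fun i => Cplus (f i) (g i)) (Cplus s t).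
Proof.
  intros H1 H2; assert (K := has_sum_linear (RtoC 1) f g _ _ H1 H2).
  replace (Cplus s t) with (Cplus (Cmult (RtoC 1) s) t) by ring.
  revert K; apply has_sum_ext; intros; ring.
Qed.

Lemma has_sum_minus {I} (f g : I -> C) s t :
  has_sum f s -> has_sum g t -> has_sum (fun i => Cminus (f i) (g i)) (Cminus s t).
Proof.
  intros H1 H2; assert (K := has_sum_linear (RtoC (-1)) g f _ _ H2 H1).
  replace (Cminus s t) with (Cplus (Cmult (RtoC (-1)) t) s) by (rewrite RtoC_m1; ring).
  revert K; apply has_sum_ext; intros; rewrite RtoC_m1; ring.
Qed.

Lemma has_sum_csum {I J} (f : J -> I -> C) (s : J -> C) l :
  (forall j, has_sum (f j) (s j)) ->
  has_sum (fun i => csum (fun j => f j i) l) (csum s l).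
Proof.
  intros H; induction l; simpl; [apply has_sum_zero|now apply has_sum_plus].
Qed.

Lemma has_sum_conj {I} (f : I -> C) s :
  has_sum f s -> has_sum (fun i => Cconj (f i)) (Cconj s).
Proof.
  intros H eps He; destruct (H eps He) as [A HA]; exists A; intros B HB Hi.
  replace (Cminus _ _) with (Cconj (Cminus (csum f B) s)).
  - rewrite Cmod_conj; auto.
  - clear. assert (E : csum (fun i => Cconj (f i)) B = Cconj (csum f B)).
    { induction B; simpl; [unfold Cconj, RtoC; simpl; f_equal; ring|].
      rewrite IHB; unfold Cconj, Cplus; simpl; f_equal; ring. }
    rewrite E; unfold Cconj, Cminus, Cplus, Copp; simpl; f_equal; ring.
Qed.

Lemma has_sum_reindex {I J} (f : I -> C) (p : J -> I) (q : I -> J) s :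
  (forall i, p (q i) = i) -> (forall j, q (p j) = j) ->
  has_sum f s -> has_sum (fun j => f (p j)) s.
Proof.
  intros Hpq Hqp H eps He; destruct (H eps He) as [A HA].
  exists (map q A); intros B HB Hincl.
  rewrite <- csum_map; apply HA.
  - apply FinFun.Injective_map_NoDup; [|easy].
    intros x y E; rewrite <- (Hqp x), E; auto.
  - intros i Hi; apply in_map_iff; exists (q i); split; [auto|].
    apply Hincl, in_map; easy.
Qed.

Lemma bounded_sums_le {I} (b c : I -> R) M :
  (forall i, 0 <= b i <= c i) -> bounded_sums c M -> bounded_sums b M.
Proof.
  intros H [Hc HM]; split; [apply H|]; intros B HB.
  apply Rle_trans with (rsum c B); [apply rsum_le; intros; apply H|auto].
Qed.

Lemma bounded_sums_scal {I} (b : I -> R) M k :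
  0 <= k -> bounded_sums b M -> bounded_sums (fun i => k * b i) (k * M).
Proof.
  intros Hk [Hb HM]; split.
  - intros i; specialize (Hb i); nra.
  - intros B HB; rewrite rsum_scal; specialize (HM B HB); nra.
Qed.

Lemma bounded_sums_sup {I} (b : I -> R) M : bounded_sums b M -> exists l,
  (forall B, NoDup B -> rsum b B <= l) /\
  forall eps, 0 < eps -> exists A, NoDup A /\ l - eps < rsum b A.
Proof.
  intros [Hb HM].
  destruct (completeness (fun r => exists B, NoDup B /\ r = rsum b B)) as [l [Hl1 Hl2]].
  - exists M; intros r (B & HB & ->); auto.
  - exists 0; exists []; split; [constructor|reflexivity].
  - exists l; split; [intros B HB; apply Hl1; eauto|]; intros eps He.
    apply NNPP; intros Hn; assert (l <= l - eps); [|lra].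
    apply Hl2; intros r (B & HB & ->); apply Rnot_lt_le; intros K; apply Hn; eauto.
Qed.

(** A finite set whose sum comes within [eps] of the supremum leaves less than [eps] to any disjoint
    set. *)
Lemma bounded_sums_tail {I} (b : I -> R) M :
  bounded_sums b M -> forall eps, 0 < eps ->
  exists A, NoDup A /\ forall B, NoDup B -> (forall i, In i B -> ~ In i A) -> rsum b B < eps.
Proof.
  intros H eps He; destruct (bounded_sums_sup b M H) as (l & Hl & Ha).
  destruct (Ha eps He) as (A & HA & HAl).
  exists A; split; [easy|]; intros B HB Hd.
  assert (K : rsum b (A ++ B) <= l).
  { apply Hl, NoDup_app; auto; intros i Hi Hi'; exact (Hd i Hi' Hi). }
  rewrite rsum_app in K; lra.
Qed.

Lemma has_sum_nonneg {I} (b : I -> R) M :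
  bounded_sums b M -> exists s, has_sum (fun i => RtoC (b i)) (RtoC s).
Proof.
  intros H; destruct (bounded_sums_sup b M H) as (l & Hl & Ha).
  exists l; intros eps He; destruct (Ha eps He) as (A & HA & HAl).
  exists A; intros B HB Hincl.
  assert (E : csum (fun i => RtoC (b i)) B = RtoC (rsum b B)).
  { clear; induction B; simpl; [easy|]; rewrite IHB, RtoC_plus; easy. }
  rewrite E, <- RtoC_minus, Cmod_R.
  specialize (Hl B HB); assert (rsum b A <= rsum b B) by (apply rsum_incl; [apply H|easy|easy]).
  apply Rabs_def1; lra.
Qed.

(** Real and imaginary parts are split into positive and negative parts; for each of these four
    families the supremum of the finite sums is the sum. *)
Lemma has_sum_dominated {I} (f : I -> C) (b : I -> R) M :
  (forall i, Cmod (f i) <= b i) -> bounded_sums b M -> exists s, has_sum f s.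
Proof.
  intros Hf Hb.
  assert (Hpart : forall r : I -> R, (forall i, Rabs (r i) <= b i) ->
            exists s, has_sum (fun i => RtoC (r i)) s).
  { intros r Hr.
    destruct (has_sum_nonneg (fun i => Rmax 0 (r i)) M) as [s Hs].
    { revert Hb; apply bounded_sums_le; intros i; specialize (Hr i).
      split; [apply Rmax_l|]; apply Rmax_lub; [generalize (Rabs_pos (r i))|generalize (Rle_abs (r i))]; lra. }
    destruct (has_sum_nonneg (fun i => Rmax 0 (- r i)) M) as [t Ht].
    { revert Hb; apply bounded_sums_le; intros i; specialize (Hr i).
      split; [apply Rmax_l|]; apply Rmax_lub; [generalize (Rabs_pos (r i))|generalize (Rle_abs (- r i)); rewrite Rabs_Ropp]; lra. }
    eexists; eapply has_sum_ext; [|apply (has_sum_linear (RtoC (-1)) _ _ _ _ Ht Hs)].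
    intros i; cbv beta; rewrite <- RtoC_mult, <- RtoC_plus; f_equal.
    unfold Rmax; destruct (Rle_dec 0 (r i)), (Rle_dec 0 (- r i)); lra. }
  destruct (Hpart (fun i => Re (f i))) as [s Hs].
  { intros i; eapply Rle_trans; [apply re_le_Cmod|apply Hf]. }
  destruct (Hpart (fun i => Im (f i))) as [t Ht].
  { intros i; eapply Rle_trans; [|apply Hf].
    eapply Rle_trans; [apply Rmax_r|apply Rmax_Cmod]. }
  eexists; eapply has_sum_ext; [|apply (has_sum_linear Ci _ _ _ _ Ht Hs)].
  intros i; cbv beta; unfold Cmult, Cplus, Ci, RtoC, Re, Im; simpl.
  destruct (f i); simpl; f_equal; ring.
Qed.

Lemma has_sum_norm {I} (f : I -> C) (b : I -> R) M s :
  (forall i, Cmod (f i) <= b i) -> bounded_sums b M -> has_sum f s -> Cmod s <= M.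
Proof.
  intros Hf [_ HM] Hs; apply Rnot_lt_le; intros K.
  destruct (Hs (Cmod s - M)) as [A HA]; [lra|].
  specialize (HA (nodup dec A) (NoDup_nodup _ _) (incl_nodup _ _ (incl_refl _))).
  assert (H1 := Cmod_csum f (nodup dec A)).
  assert (H2 : rsum (fun i => Cmod (f i)) (nodup dec A) <= M).
  { eapply Rle_trans; [apply rsum_le; intros i _; apply Hf|apply HM, NoDup_nodup]. }
  assert (H3 := Cmod_le_minus s (csum f (nodup dec A))).
  lra.
Qed.

(** * Limits of sums, double sums and series *)

Definition cvg (u : nat -> C) (l : C) : Prop :=
  forall eps, 0 < eps -> exists N, forall n, (N <= n)%nat -> Cmod (Cminus (u n) l) < eps.

Lemma cvg_scal c u l : cvg u l -> cvg (fun n => Cmult c (u n)) (Cmult c l).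
Proof.
  intros Hu eps He; assert (Hc := Cmod_ge_0 c).
  destruct (Hu (eps / (Cmod c + 1))) as [N HN]; [apply Rdiv_lt_0_compat; lra|].
  exists N; intros n Hn; specialize (HN n Hn).
  replace (Cminus _ _) with (Cmult c (Cminus (u n) l)) by ring; rewrite Cmod_mult.
  apply (Rmult_lt_compat_l (Cmod c + 1)) in HN; [|lra].
  replace ((Cmod c + 1) * (eps / (Cmod c + 1))) with eps in HN by (field; lra).
  generalize (Cmod_ge_0 (Cminus (u n) l)); lra.
Qed.

Lemma cvg_csum {I} (f : nat -> I -> C) (g : I -> C) A :
  (forall i, In i A -> cvg (fun n => f n i) (g i)) ->
  cvg (fun n => csum (f n) A) (csum g A).
Proof.
  induction A as [|a A IH]; simpl; intros H eps He.
  - exists 0%nat; intros n _.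
    now rewrite Cmod_minus_diag.
  - destruct (IH (fun i h => H i (or_intror h)) (eps / 2)) as [N HN]; [lra|].
    destruct (H a (or_introl eq_refl) (eps / 2)) as [N' HN']; [lra|].
    exists (N + N')%nat; intros n Hn.
    specialize (HN n ltac:(lia)); specialize (HN' n ltac:(lia)); cbv beta in *.
    replace (Cminus _ _) with
      (Cplus (Cminus (f n a) (g a)) (Cminus (csum (f n) A) (csum g A))) by ring.
    eapply Rle_lt_trans; [apply Cmod_triangle|lra].
Qed.

(** The set [A] depends on the majorant [b] alone, so one [A] serves a whole sequence of families
    and their limit. *)
Lemma has_sum_approx {I} (f : I -> C) (b : I -> R) s A eps :
  (forall i, Cmod (f i) <= b i) -> NoDup A ->
  (forall B, NoDup B -> (forall i, In i B -> ~ In i A) -> rsum b B < eps) ->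
  has_sum f s -> Cmod (Cminus s (csum f A)) <= eps.
Proof.
  intros Hf HA Htail Hs; apply Rnot_lt_le; intros K.
  destruct (Hs (Cmod (Cminus s (csum f A)) - eps)) as [B HB]; [lra|].
  set (D := filter (fun i => if in_dec dec i A then false else true) (nodup dec B)).
  assert (HD : forall i, In i D <-> In i B /\ ~ In i A).
  { intros i; unfold D; rewrite filter_In, nodup_In.
    destruct (in_dec dec i A); split; intros []; easy. }
  assert (ND : NoDup D) by apply NoDup_filter, NoDup_nodup.
  assert (HAD : NoDup (A ++ D)).
  { apply NoDup_app; auto; intros i Hi Hi'; apply HD in Hi'; tauto. }
  specialize (HB (A ++ D) HAD).
  assert (incl B (A ++ D)).
  { intros i Hi; apply in_or_app; destruct (in_dec dec i A); [tauto|]; right; now apply HD. }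
  specialize (HB H); rewrite csum_app in HB.
  assert (H1 : Cmod (csum f D) < eps).
  { eapply Rle_lt_trans; [apply Cmod_csum|].
    eapply Rle_lt_trans; [apply rsum_le; intros i _; apply Hf|].
    apply Htail; auto; intros i Hi; apply HD in Hi; tauto. }
  assert (H2 := Cmod_minus_triangle s (Cplus (csum f A) (csum f D)) (csum f A)).
  rewrite (Cmod_minus_sym s (Cplus _ _)) in H2.
  replace (Cminus (Cplus (csum f A) (csum f D)) (csum f A)) with (csum f D) in H2 by ring.
  lra.
Qed.

(** Dominated convergence for sums. The majorant passes to the limit [g], so outside one finite set
    the tails of all [f n] and of [g] are small together, and on that set convergence is
    termwise. *)
Lemma has_sum_tannery {I} (f : nat -> I -> C) (g : I -> C) (b : I -> R) M s t :
  (forall n i, Cmod (f n i) <= b i) -> bounded_sums b M ->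
  (forall i, cvg (fun n => f n i) (g i)) ->
  (forall n, has_sum (f n) (s n)) -> has_sum g t -> cvg s t.
Proof.
  intros Hf Hb Hlim Hs Ht eps He.
  assert (Hg : forall i, Cmod (g i) <= b i).
  { intros i; apply Rnot_lt_le; intros K.
    destruct (Hlim i (Cmod (g i) - b i)) as [N HN]; [lra|].
    specialize (HN N (le_n _)); specialize (Hf N i).
    assert (H := Cmod_le_minus (g i) (f N i)); lra. }
  destruct (bounded_sums_tail b M Hb (eps / 4)) as (A & HA & Htail); [lra|].
  destruct (cvg_csum f g A (fun i _ => Hlim i) (eps / 4)) as [N HN]; [lra|].
  exists N; intros n Hn; specialize (HN n Hn).
  assert (H1 := has_sum_approx (f n) b (s n) A (eps / 4) (Hf n) HA Htail (Hs n)).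
  assert (H2 := has_sum_approx g b t A (eps / 4) Hg HA Htail Ht).
  assert (H3 := Cmod_minus_triangle (s n) (csum (f n) A) t).
  assert (H4 := Cmod_minus_triangle (csum (f n) A) (csum g A) t).
  rewrite (Cmod_minus_sym (csum g A) t) in H4. lra.
Qed.

Lemma has_sum_fubini {I J} (f : I * J -> C) (g : I -> C) s :
  has_sum f s -> (forall i, has_sum (fun j => f (i, j)) (g i)) -> has_sum g s.
Proof.
  intros Hs Hg eps He.
  destruct (Hs (eps / 2)) as [A HA]; [lra|].
  exists (map fst A); intros B HB Hincl.
  (* Over each row in [B], [L] has a finite piece that contains the part of [A] in this row and
     approximates the row sum. The tolerance per row makes the total error at most [eps / 2]; the
     added 1 covers the empty [B]. *)
  assert (exists L, NoDup L /\ (forall p, In p L -> In (fst p) B) /\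
     (forall p, In p A -> In (fst p) B -> In p L) /\
     Cmod (Cminus (csum f L) (csum g B)) <= INR (length B) * (eps / 2 / (INR (length B) + 1)))
     as (L & HL1 & _ & HL2 & HL3).
  { set (d := eps / 2 / (INR (length B) + 1)).
    assert (Hd : 0 < d).
    { apply Rdiv_lt_0_compat; [lra|]; generalize (pos_INR (length B)); lra. }
    clearbody d; clear HA Hincl.
    induction B as [|i B IH].
    - exists []; repeat split; simpl; try easy; [constructor|].
      rewrite Cmod_minus_diag; lra.
    - inversion HB as [|? ? Hi HB']; subst.
      destruct (IH HB') as (L & HL1 & HL & HL2 & HL3).
      destruct (Hg i d Hd) as [E HE].
      set (E' := nodup dec (E ++ map snd A)).
      exists (map (fun j => (i, j)) E' ++ L); repeat split.
      + apply NoDup_app; auto.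
        * apply FinFun.Injective_map_NoDup; [intros x y K; congruence|apply NoDup_nodup].
        * intros p Hp Hp'; apply in_map_iff in Hp; destruct Hp as (j & <- & _).
          apply HL in Hp'; easy.
      + intros p Hp; apply in_app_or in Hp; destruct Hp as [Hp|Hp].
        * apply in_map_iff in Hp; destruct Hp as (j & <- & _); now left.
        * right; auto.
      + intros p Hp Hp'; apply in_or_app; destruct Hp' as [Hp'|Hp'].
        * left; apply in_map_iff; exists (snd p); split.
          { now destruct p; simpl in *; subst. }
          { unfold E'; apply nodup_In, in_or_app; right; now apply in_map. }
        * right; auto.
      + rewrite csum_app, csum_map; cbn [csum fold_right].
        fold (csum g B).
        specialize (HE E' (NoDup_nodup _ _) (incl_nodup _ _ (incl_appl _ (incl_refl _)))).
        replace (Cminus _ _) with (Cplus (Cminus (csum (fun j => f (i, j)) E') (g i))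
           (Cminus (csum f L) (csum g B))) by ring.
        eapply Rle_trans; [apply Cmod_triangle|].
        cbn [length]; rewrite S_INR; lra. }
  assert (HI : incl A L).
  { intros p Hp; apply HL2; [easy|]; apply Hincl, in_map; easy. }
  specialize (HA L HL1 HI).
  assert (H := Cmod_minus_triangle (csum g B) (csum f L) s).
  rewrite (Cmod_minus_sym (csum g B) (csum f L)) in H.
  assert (INR (length B) * (eps / 2 / (INR (length B) + 1)) <= eps / 2); [|lra].
  assert (Hp := pos_INR (length B)).
  apply Rmult_le_reg_r with (INR (length B) + 1); [lra|].
  field_simplify; [|lra]. nra.
Qed.

Lemma bounded_sums_prod {I J} (b : I * J -> R) (c : I -> R) M :
  (forall i, bounded_sums (fun j => b (i, j)) (c i)) -> bounded_sums c M ->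
  bounded_sums b M.
Proof.
  intros Hb [Hc HM]; split; [intros [i j]; apply (Hb i)|].
  (* Induction on the rows: the part of [B] in row [i] is bounded by [c i], the rest meets only the
     remaining rows. *)
  assert (K : forall l, NoDup l -> forall B, NoDup B ->
            (forall p, In p B -> In (fst p) l) -> rsum b B <= rsum c l).
  { induction l as [|i l IH]; intros Hl B HB Hin.
    - destruct B as [|p B]; simpl; [lra|]; destruct (Hin p (or_introl eq_refl)).
    - inversion Hl; subst; simpl.
      set (P := fun p : I * J => if dec (fst p) i then true else false).
      assert (E : rsum b B = rsum b (filter P B) + rsum b (filter (fun p => negb (P p)) B)).
      { clear; induction B; simpl; [lra|]; destruct (P a); simpl; lra. }
      rewrite E; apply Rplus_le_compat.
      + apply Rle_trans with (rsum (fun j => b (i, j)) (map snd (filter P B))).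
        * right. clear - P. induction B as [|p B IH]; simpl; [easy|].
          destruct (P p) eqn:Ep; simpl; [|easy].
          unfold P in Ep; destruct (dec (fst p) i); [|easy].
          rewrite IH; destruct p; simpl in *; subst; easy.
        * apply Hb. clear - HB P. induction HB as [|p B Hp HB IH]; simpl; [constructor|].
          destruct (P p) eqn:Ep; simpl; [|easy].
          unfold P in Ep; destruct (dec (fst p) i); [|easy].
          constructor; [|easy]; intros Hin; apply in_map_iff in Hin.
          destruct Hin as (q & Hq & Hq'); apply filter_In in Hq'; destruct Hq' as [Hq1 Hq2].
          unfold P in Hq2; destruct (dec (fst q) i); [|easy].
          apply Hp; destruct p, q; simpl in *; congruence.
      + apply IH; auto; [now apply NoDup_filter|].
        intros p Hp; apply filter_In in Hp; destruct Hp as [Hp1 Hp2].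
        unfold P in Hp2; destruct (dec (fst p) i); [easy|].
        destruct (Hin p Hp1); [congruence|easy]. }
  intros B HB; eapply Rle_trans; [apply (K (nodup dec (map fst B)))|].
  - apply NoDup_nodup.
  - easy.
  - intros p Hp; apply nodup_In, in_map; easy.
  - apply HM, NoDup_nodup.
Qed.

Lemma cvg_filterlim (u : nat -> C) (l : C) :
  cvg u l <-> filterlim u eventually (locally l).
Proof.
  split.
  - intros H P [eps HP]; destruct (H eps (cond_pos eps)) as [N HN].
    exists N; intros n Hn; apply HP; specialize (HN n Hn).
    now apply C_NormedModule_mixin_compat1.
  - intros H eps He.
    (* The balls of [C] are squares, so passing from a ball to the modulus costs a factor
       [sqrt 2]. *)
    assert (Hs : 0 < eps / sqrt 2).
    { apply Rdiv_lt_0_compat; [easy|]; apply sqrt_lt_R0; lra. }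
    destruct (H (ball l (mkposreal _ Hs))) as [N HN].
    { now exists (mkposreal _ Hs). }
    exists N; intros n Hn; specialize (HN n Hn).
    apply C_NormedModule_mixin_compat2 in HN; simpl in HN.
    replace (sqrt 2 * (eps / sqrt 2)) with eps in HN; [exact HN|].
    field; apply Rgt_not_eq, sqrt_lt_R0; lra.
Qed.

Lemma has_sum_series {I} (f : I -> C) (p : nat -> I) (q : I -> nat) s :
  (forall i, p (q i) = i) -> (forall n, q (p n) = n) ->
  has_sum f s -> is_series (fun n => f (p n) : C) s.
Proof.
  intros Hpq Hqp Hs; apply (has_sum_reindex f p q s Hpq Hqp) in Hs.
  set (g := fun n => f (p n)) in *; clearbody g.
  apply cvg_filterlim; intros eps He; destruct (Hs eps He) as [A HA].
  exists (list_max A); intros n Hn.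
  assert (E : sum_n (G := NormedModule.AbelianMonoid _ C_NormedModule) g n
              = csum g (rev (seq 0 (S n)))).
  { clear; induction n; [simpl; rewrite sum_O; symmetry; apply Cplus_0_r|].
    rewrite sum_Sn, IHn, (seq_S (S n) 0), rev_app_distr.
    apply Cplus_comm. }
  change (Cmod (Cminus (sum_n (G := NormedModule.AbelianMonoid _ C_NormedModule) g n) s) < eps).
  rewrite E; apply HA; [apply NoDup_rev, seq_NoDup|].
  intros i Hi; rewrite <- in_rev; apply in_seq.
  assert (K := proj1 (list_max_le A _) (le_n _)).
  rewrite Forall_forall in K; specialize (K i Hi); lia.
Qed.

(** * Atomic measures and the lattice Z[tau] *)

Definition indic (P : Prop) : R := if excluded_middle_informative P then 1 else 0.

Lemma indic_true (P : Prop) : P -> indic P = 1.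
Proof. unfold indic; destruct excluded_middle_informative; tauto. Qed.

Lemma indic_false (P : Prop) : ~ P -> indic P = 0.
Proof. unfold indic; destruct excluded_middle_informative; tauto. Qed.

Lemma indic_bounds (P : Prop) : 0 <= indic P <= 1.
Proof. unfold indic; destruct excluded_middle_informative; lra. Qed.

Lemma indic_le (P Q : Prop) : (P -> Q) -> indic P <= indic Q.
Proof. unfold indic; do 2 destruct excluded_middle_informative; try lra; tauto. Qed.

Lemma bounded_sums_interval (s K : R) : 0 <= K ->
  bounded_sums (fun m => indic (Rabs (IZR m + s) <= K)) (2 * K + 2).
Proof.
  intros HK; split; [intros; apply indic_bounds|]; intros B HB.
  set (D := filter (fun m => if excluded_middle_informative (Rabs (IZR m + s) <= K)
                             then true else false) B).
  assert (E : rsum (fun m => indic (Rabs (IZR m + s) <= K)) B = INR (length D)).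
  { unfold D; clear; induction B as [|m B IH]; simpl; [easy|].
    unfold indic at 1; destruct excluded_middle_informative; rewrite IH; [|ring].
    cbn [length]; rewrite S_INR; ring. }
  rewrite E.
  (* [up x - 1] is the floor of [x]. Rounding down at the lower end as well may admit one integer
     too many, whence [2 * K + 2]. *)
  set (lo := (up (- K - s) - 1)%Z); set (hi := (up (K - s) - 1)%Z).
  destruct (archimed (- K - s)) as [Ha1 Ha2], (archimed (K - s)) as [Hb1 Hb2].
  assert (HL : (lo <= hi + 1)%Z).
  { unfold lo, hi; apply le_IZR; rewrite plus_IZR, !minus_IZR; lra. }
  assert (Hle : (length D <= length (map (fun k => (lo + Z.of_nat k)%Z) (seq 0 (Z.to_nat (hi - lo + 1)))))%nat).
  { apply NoDup_incl_length; [now apply NoDup_filter|].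
    intros m Hm; apply filter_In in Hm; destruct Hm as [_ Hm].
    destruct excluded_middle_informative as [H|]; [|easy].
    apply Rabs_le_between in H.
    assert (lo <= m)%Z.
    { unfold lo; enough (up (- K - s) < m + 2)%Z by lia; apply lt_IZR; rewrite plus_IZR; lra. }
    assert (m <= hi)%Z.
    { unfold hi; enough (m < up (K - s))%Z by lia; apply lt_IZR; lra. }
    apply in_map_iff; exists (Z.to_nat (m - lo)); split; [lia|].
    apply in_seq; lia. }
  rewrite length_map, length_seq in Hle.
  apply le_INR in Hle; eapply Rle_trans; [exact Hle|].
  rewrite INR_IZR_INZ, Z2Nat.id by lia.
  unfold hi, lo; rewrite plus_IZR, !minus_IZR; lra.
Qed.

Lemma bounded_sums_inv_sqr : bounded_sums (fun n => / (1 + IZR n * IZR n)) 6.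
Proof.
  assert (Hp : forall n, 0 < / (1 + IZR n * IZR n)) by (intros; apply Rinv_0_lt_compat; nra).
  split; [intros; now apply Rlt_le|]; intros B HB.
  set (Zl := fix Zl n := match n with O => [0%Z] | S m => Z.of_nat n :: (- Z.of_nat n)%Z :: Zl m end).
  assert (HZ : forall n z, (Z.abs z <= Z.of_nat n)%Z -> In z (Zl n)).
  { induction n; intros z Hz; [left; lia|].
    destruct (Z.eq_dec z (Z.of_nat (S n))); [left; lia|].
    destruct (Z.eq_dec z (- Z.of_nat (S n))); [right; left; lia|].
    right; right; apply IHn; lia. }
  (* Telescoping: the terms at [n + 1] and [- (n + 1)] add up to at most
     [4 / (n + 1) - 4 / (n + 2)], and the term 1 at zero is [5 - 4]. *)
  assert (HS : forall n, rsum (fun n => / (1 + IZR n * IZR n)) (Zl n) <= 5 - 4 / (INR n + 1)).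
  { induction n; [simpl; lra|].
    cbn [Zl rsum fold_right]; fold (rsum (fun n => / (1 + IZR n * IZR n)) (Zl n)).
    rewrite opp_IZR, <- INR_IZR_INZ, S_INR; assert (Hn := pos_INR n).
    set (x := INR n) in *.
    replace (1 + - (x + 1) * - (x + 1)) with (1 + (x + 1) * (x + 1)) by ring.
    assert (/ (1 + (x + 1) * (x + 1)) <= 2 / (x + 1) - 2 / (x + 1 + 1)).
    { replace (2 / (x + 1) - 2 / (x + 1 + 1)) with (/ ((x + 1) * (x + 1 + 1) / 2)) by (field; lra).
      apply Rinv_le_contravar; nra. }
    lra. }
  set (N := list_max (map Z.abs_nat B)).
  apply Rle_trans with (rsum (fun n => / (1 + IZR n * IZR n)) (Zl N)).
  - apply rsum_incl; auto; [intros; now apply Rlt_le|].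
    intros z Hz; apply HZ.
    assert (K := proj1 (list_max_le (map Z.abs_nat B) _) (le_n _)).
    rewrite Forall_forall in K; specialize (K (Z.abs_nat z) (in_map _ _ _ Hz)).
    fold N in K; lia.
  - assert (0 < 4 / (INR N + 1)); [|specialize (HS N); lra].
    apply Rdiv_lt_0_compat; generalize (pos_INR N); lra.
Qed.

(** * The ring Z[tau], conjugation and admissible points *)

Lemma tau_sqr : tau * tau = tau + 1.
Proof. unfold tau; generalize (sqrt_sqrt 5 ltac:(lra)); lra. Qed.

Lemma tau_bounds : 1.6180 < tau < 1.6181.
Proof.
  assert (H := tau_sqr).
  assert (0 < tau).
  { unfold tau; generalize (sqrt_pos 5); lra. }
  split; nra.
Qed.

Lemma sqrt5_tau : sqrt 5 = 2 * tau - 1.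
Proof. unfold tau; lra. Qed.

Lemma inv_tau : / tau = tau - 1.
Proof.
  assert (H := tau_sqr); assert (K := tau_bounds).
  apply Rmult_eq_reg_l with tau; [|lra]; rewrite Rinv_r; lra.
Qed.

Lemma sqr_div5 (a k : Z) : (a * a = 5 * k)%Z -> exists b, a = (5 * b)%Z.
Proof.
  intros E; exists (a / 5)%Z.
  assert (Ha := Z.div_mod a 5 ltac:(lia)); assert (Hm := Z.mod_pos_bound a 5 ltac:(lia)).
  set (q := (a / 5)%Z) in *; set (r := (a mod 5)%Z) in *; clearbody q r; subst a.
  assert (r = 0 \/ r = 1 \/ r = 2 \/ r = 3 \/ r = 4)%Z as [|[|[|[|]]]] by lia; subst; lia.
Qed.

(** Infinite descent on [|b|]: 5 divides [a], hence also [b], and the quotients satisfy the same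
    equation. *)
Lemma sqr_5sqr (a b : Z) : (a * a = 5 * (b * b))%Z -> b = 0%Z.
Proof.
  remember (Z.abs_nat b) as n eqn:Hn; revert a b Hn.
  induction n as [n IH] using lt_wf_ind; intros a b Hn E.
  destruct (Z.eq_dec b 0) as [|Hb]; [easy|].
  destruct (sqr_div5 a _ E) as [a' ->].
  destruct (sqr_div5 b (a' * a')) as [b' ->]; [lia|].
  assert (b' = 0%Z); [|lia].
  apply (IH (Z.abs_nat b')) with (a := a'); lia.
Qed.

Lemma sqrt5_irrational (a b : Z) : IZR a + IZR b * sqrt 5 = 0 -> a = 0%Z /\ b = 0%Z.
Proof.
  intros E; assert (H5 := sqrt_sqrt 5 ltac:(lra)).
  assert (b = 0%Z) as ->.
  { apply (sqr_5sqr a); apply eq_IZR; rewrite !mult_IZR.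
    assert (IZR a = - IZR b * sqrt 5) as -> by lra.
    transitivity (IZR b * IZR b * (sqrt 5 * sqrt 5)); [ring|rewrite H5; ring]. }
  split; [|easy]; apply eq_IZR; lra.
Qed.

(** Makes the relation [conj5] single-valued, so that admissibility can be computed from integer
    coordinates. *)
Lemma sqrt5_independent (p q p' q' : Q) :
  Q2R p + Q2R q * sqrt 5 = Q2R p' + Q2R q' * sqrt 5 -> Q2R p = Q2R p' /\ Q2R q = Q2R q'.
Proof.
  intros E.
  assert (K : forall r s : Q, Q2R r + Q2R s * sqrt 5 = 0 -> Q2R s = 0).
  { intros [a b] [c d]; unfold Q2R; simpl; intros H.
    assert (Hb : IZR (Z.pos b) <> 0) by (apply not_0_IZR; easy).
    assert (Hd : IZR (Z.pos d) <> 0) by (apply not_0_IZR; easy).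
    assert (H' : IZR (a * Z.pos d) + IZR (c * Z.pos b) * sqrt 5 = 0).
    { rewrite !mult_IZR.
      replace (IZR a * IZR (Z.pos d) + IZR c * IZR (Z.pos b) * sqrt 5)
        with (IZR (Z.pos b) * IZR (Z.pos d) *
              (IZR a * / IZR (Z.pos b) + IZR c * / IZR (Z.pos d) * sqrt 5)) by (field; easy).
      rewrite H; ring. }
    apply sqrt5_irrational in H'; destruct H' as [_ H'].
    assert (c = 0%Z) as -> by lia; lra. }
  specialize (K (p - p')%Q (q - q')%Q).
  rewrite !Qreals.Q2R_minus in K.
  assert (Q2R q = Q2R q') by lra.
  rewrite H in E; lra.
Qed.

(* The lattice point [(n, m)] stands for [m + n * tau] in Z[tau]. *)
Definition val (i : Z * Z) : R := IZR (snd i) + IZR (fst i) * tau.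
Definition star (i : Z * Z) : R := IZR (snd i) + IZR (fst i) * (1 - tau).

(** The source of all counting estimates: where the conjugate is bounded, [val i] stays within a
    constant of [fst i * sqrt 5]. *)
Lemma val_star (i : Z * Z) : val i = star i + IZR (fst i) * sqrt 5.
Proof. unfold val, star; rewrite sqrt5_tau; ring. Qed.

Lemma tau_irrational (a b : Z) : IZR a + IZR b * tau = 0 -> a = 0%Z /\ b = 0%Z.
Proof.
  unfold tau; intros H.
  destruct (sqrt5_irrational (2 * a + b) b); [|lia].
  rewrite plus_IZR, mult_IZR; lra.
Qed.

Lemma val_inj (i j : Z * Z) : val i = val j -> i = j.
Proof.
  destruct i as [n m], j as [n' m']; unfold val; simpl; intros H.
  destruct (tau_irrational (m - m') (n - n')); [rewrite !minus_IZR; lra|].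
  f_equal; lia.
Qed.

(** By [val_star] the first coordinate [n] satisfies [|n * sqrt 5 - x| <= K + A], and for each [n]
    the second coordinate lies in an interval of length [2 * A]. The bound is uniform in [x], as
    translation boundedness demands. *)
Lemma bounded_sums_window (A K : R) : 0 <= A -> 0 <= K -> exists M, forall x,
  bounded_sums (fun i => indic (Rabs (val i - x) <= K /\ Rabs (star i) <= A)) M.
Proof.
  intros HA HK; exists ((2 * A + 2) * (2 * (K + A) + 2)); intros x.
  assert (H5 : 2 < sqrt 5) by (rewrite sqrt5_tau; generalize tau_bounds; lra).
  apply (bounded_sums_prod _ (fun n => (2 * A + 2) * indic (Rabs (IZR n + - x / sqrt 5) <= K + A))).
  - intros n.
    apply bounded_sums_le with
      (fun m => indic (Rabs (IZR n + - x / sqrt 5) <= K + A) * indic (Rabs (IZR m + IZR n * (1 - tau)) <= A)).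
    + intros m; split; [apply indic_bounds|].
      destruct (excluded_middle_informative (Rabs (val (n, m) - x) <= K /\ Rabs (star (n, m)) <= A)) as [[H1 H2]|H].
      * rewrite (indic_true _ (conj H1 H2)), (indic_true (Rabs (IZR m + IZR n * (1 - tau)) <= A) H2), indic_true; [lra|].
        rewrite val_star in H1; simpl fst in H1.
        replace (IZR n + - x / sqrt 5) with ((star (n, m) + IZR n * sqrt 5 - x - star (n, m)) * / sqrt 5)
          by (field; lra).
        rewrite Rabs_mult, (Rabs_pos_eq (/ sqrt 5)); [|apply Rinv_nonneg; lra].
        apply Rle_trans with ((K + A) * 1); [|lra].
        apply Rmult_le_compat; [apply Rabs_pos|apply Rinv_nonneg; lra| |].
        { eapply Rle_trans; [apply Rabs_triang|rewrite Rabs_Ropp; lra]. }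
        { rewrite <- Rinv_1; apply Rinv_le_contravar; lra. }
      * rewrite indic_false by easy.
        apply Rmult_le_pos; apply indic_bounds.
    + rewrite (Rmult_comm (2 * A + 2)); apply bounded_sums_scal; [apply indic_bounds|].
      now apply bounded_sums_interval.
  - apply bounded_sums_scal; [lra|]; apply bounded_sums_interval; lra.
Qed.

(** Outside a set with tails below 1 no indicator can be 1. *)
Lemma bounded_sums_finite {I} (P : I -> Prop) M :
  bounded_sums (fun i => indic (P i)) M -> exists A, NoDup A /\ forall i, P i -> In i A.
Proof.
  intros H; destruct (bounded_sums_tail _ _ H 1) as (A & HA & HT); [lra|].
  exists A; split; [easy|]; intros i Hi; apply NNPP; intros Hn.
  specialize (HT [i]); simpl in HT.
  rewrite indic_true in HT by easy.
  assert (1 + 0 < 1); [|lra]; apply HT.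
  - constructor; [easy|constructor].
  - intros j [<-|[]]; easy.
Qed.

Definition admissible (i : Z * Z) : Prop := - tau <= star i <= tau.

Lemma admissible_point_iff (z : R) :
  admissible_point z <-> exists i, z = val i /\ admissible i.
Proof.
  split.
  - intros [(m & n & ->) (w & (p & q & E & ->) & H)].
    exists (n, m); split; [reflexivity|].
    assert (E' : Q2R (inject_Z m + inject_Z n / 2) + Q2R (inject_Z n / 2) * sqrt 5 = Q2R p + Q2R q * sqrt 5).
    { rewrite <- E; unfold tau, Qdiv; rewrite Q2R_plus, Q2R_mult; unfold Q2R; simpl; field. }
    destruct (sqrt5_independent _ _ _ _ E') as [Ep Eq].
    rewrite <- Ep, <- Eq in H; unfold Qdiv in H; rewrite Q2R_plus, Q2R_mult in H.
    unfold admissible, star; simpl.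
    replace (IZR m + IZR n * (1 - tau)) with
      (Q2R (inject_Z m) + Q2R (inject_Z n) * Q2R (/ 2) - Q2R (inject_Z n) * Q2R (/ 2) * sqrt 5); [exact H|].
    unfold tau, Q2R; simpl; field.
  - intros ([n m] & -> & H); split; [now exists m, n|].
    exists (star (n, m)); split; [|exact H].
    exists (inject_Z m + inject_Z n / 2)%Q, (inject_Z n / 2)%Q.
    unfold Qdiv; rewrite Q2R_plus, Q2R_mult; unfold val, star, tau, Q2R; simpl; split; field.
Qed.

(** Only finitely many admissible points lie within distance 1 of [x]; [eps] is their least positive
    distance from [x], capped at 1. *)
Lemma window_discrete (x : R) : exists eps, 0 < eps /\
  forall i, admissible i -> val i <> x -> eps <= Rabs (val i - x).
Proof.
  destruct (bounded_sums_window 2 1) as [M HM]; [lra|lra|].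
  destruct (bounded_sums_finite _ _ (HM x)) as (A & _ & HA).
  assert (exists eps, 0 < eps /\ forall i, In i A -> val i <> x -> eps <= Rabs (val i - x)) as (eps & He & H).
  { clear HA; induction A as [|i A (eps & He & IH)].
    - exists 1; split; [lra|easy].
    - destruct (Req_dec (val i) x) as [E|E].
      + exists eps; split; [easy|]; intros j [<-|Hj] Hn; [easy|auto].
      + exists (Rmin eps (Rabs (val i - x))); split.
        { apply Rmin_glb_lt; [easy|]; apply Rabs_pos_lt; lra. }
        { intros j [<-|Hj] Hn; [apply Rmin_r|].
          eapply Rle_trans; [apply Rmin_l|auto]. } }
  exists (Rmin eps 1); split; [apply Rmin_glb_lt; lra|].
  intros i Hi Hn; destruct (Rle_dec (Rabs (val i - x)) 1) as [H1|H1].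
  - eapply Rle_trans; [apply Rmin_l|]; apply H; [|easy].
    apply HA; split; [easy|]; apply Rabs_le.
    unfold admissible in Hi; generalize tau_bounds; lra.
  - eapply Rle_trans; [apply Rmin_r|lra].
Qed.

(** * Continuous complex functions and test functions *)

Lemma continuous_C (f : R -> C) (x : R) :
  continuous f x <-> continuous (fun t => Re (f t)) x /\ continuous (fun t => Im (f t)) x.
Proof.
  split.
  - intros H; split.
    + apply (continuous_comp f (fun z : C => fst z)); [exact H|apply continuous_fst].
    + apply (continuous_comp f (fun z : C => snd z)); [exact H|apply continuous_snd].
  - intros [H1 H2] P [eps HP].
    assert (K1 : locally x (fun t => ball (Re (f x)) eps (Re (f t)))).
    { apply H1; now exists eps. }
    assert (K2 : locally x (fun t => ball (Im (f x)) eps (Im (f t)))).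
    { apply H2; now exists eps. }
    unfold filtermap; generalize (filter_and _ _ K1 K2); apply filter_imp; intros t [B1 B2].
    apply HP; split; assumption.
Qed.

Lemma ex_RInt_cont (f : R -> R) a b : (forall x, continuous f x) -> ex_RInt f a b.
Proof. intros H; apply (ex_RInt_continuous (V := R_CompleteNormedModule)); intros; apply H. Qed.

Lemma ex_derive_cont (f : R -> R) x : ex_derive f x -> continuous f x.
Proof. apply (ex_derive_continuous (V := R_NormedModule)). Qed.

Lemma continuous_RtoC (f : R -> R) (x : R) :
  continuous f x -> continuous (fun t => RtoC (f t)) x.
Proof. intros H; apply continuous_C; split; [exact H|apply continuous_const]. Qed.

Lemma continuous_Cplus (f g : R -> C) (x : R) :
  continuous f x -> continuous g x -> continuous (fun t => Cplus (f t) (g t)) x.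
Proof.
  intros Hf Hg; apply continuous_C in Hf; apply continuous_C in Hg; apply continuous_C.
  split; unfold Re, Im, Cplus; simpl.
  - now apply (continuous_plus (fun t => fst (f t)) (fun t => fst (g t))).
  - now apply (continuous_plus (fun t => snd (f t)) (fun t => snd (g t))).
Qed.

Lemma continuous_Cminus (f g : R -> C) (x : R) :
  continuous f x -> continuous g x -> continuous (fun t => Cminus (f t) (g t)) x.
Proof.
  intros Hf Hg; apply continuous_Cplus; [easy|].
  apply continuous_C in Hg; apply continuous_C; destruct Hg as [Hg1 Hg2]; split.
  - now apply (continuous_opp (fun t => fst (g t))).
  - now apply (continuous_opp (fun t => snd (g t))).
Qed.

Lemma continuous_Cmult (f g : R -> C) (x : R) :
  continuous f x -> continuous g x -> continuous (fun t => Cmult (f t) (g t)) x.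
Proof.
  intros Hf Hg; apply continuous_C in Hf; apply continuous_C in Hg; apply continuous_C.
  destruct Hf as [Hf1 Hf2], Hg as [Hg1 Hg2].
  split; unfold Re, Im, Cmult; simpl.
  - apply (continuous_minus (fun t => fst (f t) * fst (g t)) (fun t => snd (f t) * snd (g t)));
      now apply (continuous_mult (K := R_AbsRing)).
  - apply (continuous_plus (fun t => fst (f t) * snd (g t)) (fun t => snd (f t) * fst (g t)));
      now apply (continuous_mult (K := R_AbsRing)).
Qed.

Lemma continuous_Cconj (f : R -> C) (x : R) :
  continuous f x -> continuous (fun t => Cconj (f t)) x.
Proof.
  intros Hf; apply continuous_C in Hf; apply continuous_C; destruct Hf; split; [easy|].
  now apply (continuous_opp (fun t => snd (f t))).
Qed.

Lemma continuous_Cmod (f : R -> C) (x : R) :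
  continuous f x -> continuous (fun t => Cmod (f t)) x.
Proof.
  intros Hf; apply continuous_C in Hf; destruct Hf as [H1 H2].
  unfold Cmod; apply continuous_comp; [|apply continuous_sqrt].
  apply (continuous_plus (fun t => fst (f t) ^ 2) (fun t => snd (f t) ^ 2)).
  - apply (continuous_ext (fun t => fst (f t) * fst (f t))); [intros; simpl; ring|].
    now apply (continuous_mult (K := R_AbsRing)).
  - apply (continuous_ext (fun t => snd (f t) * snd (f t))); [intros; simpl; ring|].
    now apply (continuous_mult (K := R_AbsRing)).
Qed.

Lemma continuous_csum {I} (f : I -> R -> C) A (x : R) :
  (forall i, continuous (f i) x) -> continuous (fun t => csum (fun i => f i t) A) x.
Proof.
  intros H; induction A; simpl; [apply continuous_const|now apply continuous_Cplus].
Qed.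

Lemma continuous_eps (f : R -> C) (x : R) :
  (forall eps, 0 < eps -> exists d, 0 < d /\ forall y, Rabs (y - x) < d -> Cmod (Cminus (f y) (f x)) < eps) ->
  continuous f x.
Proof.
  intros H P [eps HP]; destruct (H eps (cond_pos eps)) as (d & Hd & K).
  exists (mkposreal d Hd); intros y Hy; apply HP.
  apply C_NormedModule_mixin_compat1, K, Hy.
Qed.

Lemma Cc_linear (c : C) (g h : R -> C) :
  Cc g -> Cc h -> Cc (fun x => Cplus (Cmult c (g x)) (h x)).
Proof.
  intros [Hg [A HA]] [Hh [B HB]]; split.
  - intros x; apply continuous_Cplus; [|easy].
    apply continuous_Cmult; [apply continuous_const|easy].
  - exists (Rmax A B); intros x Hx.
    generalize (Rmax_l A B) (Rmax_r A B); intros.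
    rewrite HA, HB by lra; ring.
Qed.

Lemma Cc_minus (g h : R -> C) : Cc g -> Cc h -> Cc (fun x => Cminus (g x) (h x)).
Proof.
  intros [Hg [A HA]] [Hh [B HB]]; split; [intros x; now apply continuous_Cminus|].
  exists (Rmax A B); intros x Hx; generalize (Rmax_l A B) (Rmax_r A B); intros.
  rewrite HA, HB by lra; ring.
Qed.

Lemma measure_minus mu g h : is_measure mu -> Cc g -> Cc h ->
  mu (fun x => Cminus (g x) (h x)) = Cminus (mu g) (mu h).
Proof.
  intros H Hg Hh.
  replace (fun x => Cminus (g x) (h x)) with (fun x => Cplus (Cmult (RtoC (-1)) (h x)) (g x)).
  - rewrite (measure_linear _ H) by easy; rewrite RtoC_m1; ring.
  - apply functional_extensionality; intros x; rewrite RtoC_m1; ring.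
Qed.

Lemma Cc_affine (g : R -> C) (a b : R) : a <> 0 -> Cc g -> Cc (fun x => g (a * x + b)).
Proof.
  intros Ha [Hg [A HA]]; split.
  - intros x; apply (continuous_comp (fun x => a * x + b) g); [|easy].
    apply (continuous_plus (fun x => a * x) (fun _ => b)); [|apply continuous_const].
    apply (continuous_scal_r a (fun x : R => x)); apply continuous_id.
  - exists ((Rabs A + Rabs b) / Rabs a); intros x Hx; apply HA.
    assert (Hp : 0 < Rabs a) by now apply Rabs_pos_lt.
    assert (Rabs A + Rabs b < Rabs (a * x)).
    { rewrite Rabs_mult; replace (Rabs A + Rabs b) with (Rabs a * ((Rabs A + Rabs b) / Rabs a)) by (field; lra).
      now apply Rmult_lt_compat_l. }
    assert (K := Rabs_triang (a * x + b) (- b)).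
    replace (a * x + b + - b) with (a * x) in K by ring.
    rewrite Rabs_Ropp in K; generalize (Rle_abs A); lra.
Qed.

Lemma Cc_reflect (g : R -> C) (x : R) : Cc g -> Cc (fun y => g (x - y)).
Proof.
  intros H; replace (fun y => g (x - y)) with (fun y => g (-1 * y + x)).
  - apply Cc_affine; [lra|easy].
  - apply functional_extensionality; intros; f_equal; ring.
Qed.

Lemma Cc_conj (g : R -> C) : Cc g -> Cc (fun y => Cconj (g y)).
Proof.
  intros [H [A HA]]; split; [intros; now apply continuous_Cconj|].
  exists A; intros x Hx; rewrite HA by easy; unfold Cconj, RtoC; simpl; f_equal; ring.
Qed.

Lemma Cc_mult (g h : R -> C) : (forall x, continuous g x) -> Cc h -> Cc (fun x => Cmult (g x) (h x)).
Proof.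
  intros Hg [Hh [A HA]]; split; [intros; now apply continuous_Cmult|].
  exists A; intros x Hx; rewrite HA by easy; ring.
Qed.

Lemma continuous_Rmax (f g : R -> R) x :
  continuous f x -> continuous g x -> continuous (fun t => Rmax (f t) (g t)) x.
Proof.
  intros Hf Hg.
  apply (continuous_ext (fun t => / 2 * (f t + g t + Rabs (f t - g t)))).
  - intros t; unfold Rmax, Rabs; destruct (Rle_dec _ _), (Rcase_abs _); lra.
  - apply (continuous_scal_r (/ 2) (fun t => f t + g t + Rabs (f t - g t))).
    apply (continuous_plus (fun t => f t + g t) (fun t => Rabs (f t - g t))).
    + now apply (continuous_plus f g).
    + apply (continuous_comp (fun t => f t - g t) Rabs); [|apply continuous_Rabs].
      now apply (continuous_minus f g).
Qed.

Lemma continuous_lin a b x : continuous (fun t => a * t + b) x.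
Proof.
  apply (continuous_plus (fun t => a * t) (fun _ => b)); [|apply continuous_const].
  apply (continuous_scal_r a (fun t : R => t)); apply continuous_id.
Qed.

Lemma Cc_tent (x : R) (n : nat) : Cc (tent x n).
Proof.
  split.
  - intros t; unfold tent; apply continuous_RtoC.
    apply continuous_Rmax; [apply continuous_const|].
    apply (continuous_minus (fun _ => 1) (fun t => INR (S n) * Rabs (t - x))); [apply continuous_const|].
    apply (continuous_scal_r (INR (S n)) (fun t : R => Rabs (t - x))).
    apply (continuous_comp (fun t => t - x) Rabs); [|apply continuous_Rabs].
    apply (continuous_minus (fun t => t) (fun _ => x)); [apply continuous_id|apply continuous_const].
  - exists (Rabs x + 1); intros y Hy; unfold tent; f_equal; apply Rmax_left.
    assert (K := Rabs_triang_inv y x).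
    assert (1 <= INR (S n)) by (rewrite S_INR; generalize (pos_INR n); lra). nra.
Qed.

Lemma tent_outside (x : R) (n : nat) (y : R) : / INR (S n) <= Rabs (y - x) -> tent x n y = RtoC 0.
Proof.
  intros H; unfold tent; f_equal; apply Rmax_left.
  assert (Hp : 0 < INR (S n)) by (apply lt_0_INR; lia).
  assert (INR (S n) * / INR (S n) = 1) by (apply Rinv_r; lra). nra.
Qed.

Lemma tent_center (x : R) (n : nat) : tent x n x = RtoC 1.
Proof. unfold tent; f_equal; rewrite Rminus_diag, Rabs_R0, Rmax_right; lra. Qed.

Lemma tent_bound (x : R) (n : nat) (y : R) : Cmod (tent x n y) <= indic (Rabs (y - x) <= 1).
Proof.
  unfold tent; rewrite Cmod_R, Rabs_pos_eq by apply Rmax_l.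
  assert (1 <= INR (S n)) by (rewrite S_INR; generalize (pos_INR n); lra).
  assert (Ha := Rabs_pos (y - x)).
  unfold indic; destruct excluded_middle_informative; apply Rmax_lub; nra.
Qed.

Lemma inv_INR_small (eps : R) : 0 < eps -> exists N, forall n, (N <= n)%nat -> / INR (S n) < eps.
Proof.
  intros He; destruct (archimed_cor1 eps He) as (N & H1 & H2).
  exists N; intros n Hn; eapply Rle_lt_trans; [|exact H1].
  apply Rinv_le_contravar; [now apply lt_0_INR|apply le_INR; lia].
Qed.

Lemma tent_cvg (x y : R) : cvg (fun n => tent x n y) (RtoC (indic (y = x))).
Proof.
  intros eps He; destruct (Req_dec y x) as [->|H].
  - exists 0%nat; intros n _; rewrite tent_center, indic_true by easy.
    rewrite Cmod_minus_diag; lra.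
  - destruct (inv_INR_small (Rabs (y - x))) as [N HN]; [apply Rabs_pos_lt; lra|].
    exists N; intros n Hn; rewrite tent_outside, indic_false by (try apply Rlt_le; auto).
    rewrite Cmod_minus_diag; lra.
Qed.

Lemma Cc_support (g : R -> C) : Cc g -> exists K, 0 < K /\ forall x, K < Rabs x -> g x = RtoC 0.
Proof.
  intros [_ [A HA]]; exists (Rmax 1 A); split.
  - generalize (Rmax_l 1 A); lra.
  - intros x Hx; apply HA; generalize (Rmax_r 1 A); lra.
Qed.

Lemma continuous_bounded (g : R -> C) a b :
  (forall x, continuous g x) -> exists B, 0 < B /\ forall x, a <= x <= b -> Cmod (g x) <= B.
Proof.
  intros Hg.
  destruct (bounded_continuity (V := R_NormedModule) (fun x => Cmod (g x)) a b) as [B HB].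
  { intros; apply continuous_Cmod, Hg. }
  exists (Rmax 1 B); split; [generalize (Rmax_l 1 B); lra|].
  intros x Hx; specialize (HB x Hx).
  change (Rabs (Cmod (g x)) < B) in HB; rewrite Rabs_pos_eq in HB by apply Cmod_ge_0.
  generalize (Rmax_r 1 B); lra.
Qed.

Lemma Cc_bounded (g : R -> C) : Cc g -> exists B, 0 < B /\ forall x, Cmod (g x) <= B.
Proof.
  intros Hg; destruct (Cc_support g Hg) as (K & HK & H).
  destruct (continuous_bounded g (- K) K (proj1 Hg)) as (B & HB & HB').
  exists B; split; [easy|]; intros x; destruct (Rle_dec (Rabs x) K) as [Hx|Hx].
  - now apply HB', Rabs_le_between.
  - rewrite H by lra; rewrite Cmod_0; lra.
Qed.

Lemma continuous_unif (g : R -> C) a b : (forall x, continuous g x) ->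
  forall eps, 0 < eps -> exists d, 0 < d /\ forall x y, a <= x <= b -> a <= y <= b ->
    Rabs (x - y) < d -> Cmod (Cminus (g x) (g y)) < eps.
Proof.
  intros Hg eps He.
  destruct (unifcont_normed_1d (K := R_AbsRing) (V := C_R_NormedModule) g a b (fun x _ => Hg x) (mkposreal eps He)) as [d Hd].
  exists d; split; [apply cond_pos|]; intros x y Hx Hy Hxy.
  assert (K := Hd y x Hy Hx Hxy); unfold ball_norm in K; simpl in K.
  rewrite Cmod_norm; exact K.
Qed.

Lemma Cc_unif (g : R -> C) : Cc g -> forall eps, 0 < eps ->
  exists d, 0 < d /\ forall x y, Rabs (x - y) < d -> Cmod (Cminus (g x) (g y)) < eps.
Proof.
  intros Hg eps He; destruct (Cc_support g Hg) as (K & HK & H).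
  destruct (continuous_unif g (- (K + 1)) (K + 1) (proj1 Hg) eps He) as (d & Hd & Hd').
  exists (Rmin d 1); split; [apply Rmin_glb_lt; lra|]; intros x y Hxy.
  assert (H1 := Rmin_l d 1); assert (H2 := Rmin_r d 1).
  destruct (Rle_dec (Rabs x) (K + 1)) as [Hx|Hx], (Rle_dec (Rabs y) (K + 1)) as [Hy|Hy].
  - apply Hd'; try apply Rabs_le_between; lra.
  - assert (K1 := Rabs_triang_inv y x); rewrite Rabs_minus_sym in K1.
    rewrite !H by lra; rewrite Cmod_minus_diag; lra.
  - assert (K1 := Rabs_triang_inv x y).
    rewrite !H by lra; rewrite Cmod_minus_diag; lra.
  - rewrite !H by lra; rewrite Cmod_minus_diag; lra.
Qed.

(** Both the solution, with positions [val i], and its Fourier transform, with positions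
    [dual_point i], have this form. The positions are dense in either case, so local summability of
    the masses has to be part of the definition. *)
Definition atomic (x : Z * Z -> R) (c : Z * Z -> C) (mu : functional) : Prop :=
  (forall K, exists M, bounded_sums (fun i => indic (Rabs (x i) <= K) * Cmod (c i)) M) /\
  forall g, Cc g -> has_sum (fun i => Cmult (c i) (g (x i))) (mu g).

(** [P] is a ball about the origin for the measure property and a ball about a moving centre for
    bounds that are uniform under translation. *)
Lemma atomic_bound x c mu (P : R -> Prop) M g k : atomic x c mu ->
  bounded_sums (fun i => indic (P (x i)) * Cmod (c i)) M -> Cc g ->
  (forall y, ~ P y -> g y = RtoC 0) -> (forall y, Cmod (g y) <= k) -> Cmod (mu g) <= M * k.
Proof.
  intros [_ H] HM Hg Hsup Hk.
  assert (H0 : 0 <= k) by (eapply Rle_trans; [apply Cmod_ge_0|apply (Hk 0)]).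
  rewrite Rmult_comm.
  apply (has_sum_norm _ (fun i => k * (indic (P (x i)) * Cmod (c i)))) with (3 := H g Hg).
  - intros i; rewrite Cmod_mult; destruct (excluded_middle_informative (P (x i))).
    + rewrite indic_true by easy; generalize (Hk (x i)) (Cmod_ge_0 (c i)); nra.
    + rewrite Hsup, Cmod_0, indic_false by easy; lra.
  - now apply bounded_sums_scal.
Qed.

Lemma atomic_measure x c mu : atomic x c mu -> is_measure mu.
Proof.
  intros H; split.
  - intros k g h Hg Hh; eapply has_sum_unique; [apply H, Cc_linear; easy|].
    eapply has_sum_ext; [|apply (has_sum_linear k _ _ _ _ (proj2 H g Hg) (proj2 H h Hh))].
    intros i; simpl; ring.
  - intros K; destruct (proj1 H K) as [M HM]; exists M; intros g k Hg Hsup Hk.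
    apply (atomic_bound x c mu (fun y => Rabs y <= K) M g k H); auto.
    intros y Hy; apply Hsup; lra.
Qed.

(** The tents at [x i] tend pointwise to the indicator of [x i] and live within distance 1 of it, so
    Tannery applies although the other positions may accumulate there. *)
Lemma atomic_point_mass x c mu i : (forall i j, x i = x j -> i = j) ->
  atomic x c mu -> point_mass mu (x i) (c i).
Proof.
  intros Hx [Hb Hs]; apply cvg_filterlim.
  destruct (Hb (Rabs (x i) + 1)) as [M HM].
  eapply (has_sum_tannery (fun n j => Cmult (c j) (tent (x i) n (x j)))
    (fun j => Cmult (c j) (RtoC (indic (x j = x i)))) _ M) with (2 := HM).
  - intros n j; rewrite Cmod_mult, Rmult_comm.
    apply Rmult_le_compat; try apply Cmod_ge_0; try apply Rle_refl.
    eapply Rle_trans; [apply tent_bound|]; apply indic_le; intros H.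
    assert (K := Rabs_triang_inv (x j) (x i)); lra.
  - intros j; apply cvg_scal, tent_cvg.
  - intros n; apply Hs, Cc_tent.
  - replace (c i) with (csum (fun j => Cmult (c j) (RtoC (indic (x j = x i)))) [i]).
    + apply has_sum_finite; [constructor; [easy|constructor]|].
      intros j Hj; rewrite indic_false; [ring|]; intros E; apply Hj; left; symmetry; auto.
    + simpl; rewrite indic_true by easy; ring.
Qed.

Definition Zenum (n : nat) : Z :=
  if Nat.even n then Z.of_nat (n / 2) else (- Z.of_nat (S n / 2))%Z.
Definition Zcode (z : Z) : nat :=
  if (0 <=? z)%Z then (2 * Z.to_nat z)%nat else (2 * Z.to_nat (- z) - 1)%nat.

Lemma Zenum_Zcode z : Zenum (Zcode z) = z.
Proof.
  unfold Zenum, Zcode; destruct (Z.leb_spec 0 z).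
  - rewrite Nat.even_mul; simpl orb; cbn [Nat.even orb].
    rewrite Nat.mul_comm, Nat.div_mul; lia.
  - replace (2 * Z.to_nat (- z) - 1)%nat with (1 + 2 * (Z.to_nat (- z) - 1))%nat by lia.
    rewrite Nat.even_add, Nat.even_mul; cbn [Nat.even orb Bool.eqb].
    replace (S (1 + 2 * (Z.to_nat (- z) - 1)))%nat with (Z.to_nat (- z) * 2)%nat by lia.
    rewrite Nat.div_mul; lia.
Qed.

Lemma Zcode_Zenum n : Zcode (Zenum n) = n.
Proof.
  unfold Zenum; destruct (Nat.even n) eqn:E.
  - apply Nat.even_spec in E; destruct E as [k ->].
    rewrite Nat.mul_comm, Nat.div_mul by lia; unfold Zcode.
    destruct (Z.leb_spec 0 (Z.of_nat k)); lia.
  - assert (O : Nat.odd n = true) by (rewrite <- Nat.negb_even, E; easy).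
    apply Nat.odd_spec in O; destruct O as [k ->].
    replace (S (2 * k + 1)) with ((k + 1) * 2)%nat by lia.
    rewrite Nat.div_mul by lia; unfold Zcode.
    destruct (Z.leb_spec 0 (- Z.of_nat (k + 1))); lia.
Qed.

Lemma atomic_pure_point x c mu : (forall i j, x i = x j -> i = j) ->
  atomic x c mu -> pure_point mu.
Proof.
  intros Hx H.
  (* All of [Z * Z] is enumerated, including points of mass zero, which [pure_point] allows. *)
  set (p := fun n => let (a, b) := Cantor.of_nat n in (Zenum a, Zenum b)).
  set (q := fun i : Z * Z => Cantor.to_nat (Zcode (fst i), Zcode (snd i))).
  assert (Hpq : forall i, p (q i) = i).
  { intros [a b]; unfold p, q; rewrite Cantor.cancel_of_to; simpl; now rewrite !Zenum_Zcode. }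
  assert (Hqp : forall n, q (p n) = n).
  { intros n; unfold p, q; destruct (Cantor.of_nat n) as [a b] eqn:E; cbn [fst snd].
    now rewrite !Zcode_Zenum, <- E, Cantor.cancel_to_of. }
  exists (fun n => x (p n)), (fun n => c (p n)); repeat split.
  - intros m n E; apply Hx in E; rewrite <- (Hqp m), E; auto.
  - intros n; now apply (atomic_point_mass x c).
  - intros g Hg; apply (has_sum_series (fun i => Cmult (c i) (g (x i))) p q _ Hpq Hqp), H, Hg.
Qed.

(** Arbitrary where [f] has no sum; for the families used here, test functions always give one. *)
Definition total_sum {I} (f : I -> C) : C := epsilon (inhabits (RtoC 0)) (has_sum f).

Lemma total_sum_spec {I} (f : I -> C) s : has_sum f s -> has_sum f (total_sum f).
Proof. intros H; unfold total_sum; apply epsilon_spec; now exists s. Qed.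

Lemma atomic_total_sum x c :
  (forall K, exists M, bounded_sums (fun i => indic (Rabs (x i) <= K) * Cmod (c i)) M) ->
  atomic x c (fun g => total_sum (fun i => Cmult (c i) (g (x i)))).
Proof.
  intros H; split; [easy|]; intros g Hg.
  destruct (Cc_support g Hg) as (K & HK & HK'); destruct (H K) as [M HM].
  destruct (Cc_bounded g Hg) as (B & HB & HB').
  destruct (has_sum_dominated (fun i => Cmult (c i) (g (x i)))
    (fun i => B * (indic (Rabs (x i) <= K) * Cmod (c i))) (B * M)) as [s Hs].
  - intros i; rewrite Cmod_mult; destruct (Rle_dec (Rabs (x i)) K).
    + rewrite indic_true by easy; generalize (HB' (x i)) (Cmod_ge_0 (c i)); nra.
    + rewrite HK', Cmod_0, indic_false by (try easy; lra); lra.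
  - apply bounded_sums_scal; [lra|easy].
  - now apply total_sum_spec with s.
Qed.

(** * The renormalisation equations *)

(** What summability and almost periodicity use of [overlap a b]. The constant 2 arises there as
    four slopes of size at most [1/2]. *)
Definition window (h : R -> R) : Prop :=
  (forall y, tau < Rabs y -> h y = 0) /\
  forall x y, Rabs (h x - h y) <= 2 * Rabs (x - y).

(** Comparison with the zero at 2, which is at distance at most 4, by the Lipschitz bound. *)
Lemma window_bound h y : window h -> Rabs (h y) <= 8.
Proof.
  intros [Hs Hl]; destruct (Rle_dec (Rabs y) 2) as [Hy|Hy].
  - assert (H := Hl y 2); rewrite (Hs 2) in H.
    + rewrite Rminus_0_r in H; apply Rabs_le_between in Hy.
      assert (Rabs (y - 2) <= 4) by (apply Rabs_le; lra); lra.
    + rewrite Rabs_pos_eq; generalize tau_bounds; lra.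
  - rewrite Hs, Rabs_R0; generalize tau_bounds; lra.
Qed.

Lemma window_weight_bound h (a : R) :
  window h -> Cmod (RtoC (h a)) <= 8 * indic (Rabs a <= 2).
Proof.
  intros Hw; rewrite Cmod_R; destruct (Rle_dec (Rabs a) 2) as [H|H].
  - rewrite indic_true by easy; generalize (window_bound h a Hw); lra.
  - rewrite (proj1 Hw), Rabs_R0 by (generalize tau_bounds; lra).
    generalize (indic_bounds (Rabs a <= 2)); lra.
Qed.

(** [M] is chosen before [x]; this uniformity carries both translation boundedness and the
    continuity of convolutions. *)
Lemma window_sums h (K : R) : window h -> 0 <= K -> exists M, 0 <= M /\ forall x,
  bounded_sums (fun i => indic (Rabs (val i - x) <= K) * Cmod (RtoC (h (star i)))) M.
Proof.
  intros Hw HK; destruct (bounded_sums_window 2 K) as [M HM]; [lra|easy|].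
  assert (HM8 : forall x, bounded_sums (fun i => indic (Rabs (val i - x) <= K) * Cmod (RtoC (h (star i)))) (8 * M)).
  { intros x.
    apply bounded_sums_le with (2 := bounded_sums_scal _ _ 8 ltac:(lra) (HM x)).
    intros i; split; [apply Rmult_le_pos; [apply indic_bounds|apply Cmod_ge_0]|].
    assert (H := window_weight_bound h (star i) Hw).
    destruct (excluded_middle_informative (Rabs (val i - x) <= K)) as [H1|H1].
    - rewrite (indic_true (Rabs (val i - x) <= K)) by easy.
      rewrite Rmult_1_l; eapply Rle_trans; [exact H|].
      apply Rmult_le_compat_l; [lra|]; apply indic_le; easy.
    - rewrite (indic_false (Rabs (val i - x) <= K)) by easy.
      generalize (indic_bounds (Rabs (val i - x) <= K /\ Rabs (star i) <= 2)); lra. }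
  exists (8 * M); split; [|easy].
  destruct (HM8 0) as [_ H]; apply (H []); constructor.
Qed.

(** A weighted model set: [val] is the physical and [star] the internal coordinate of the cut and
    project scheme. *)
Definition comb (h : R -> R) (mu : functional) : Prop :=
  atomic val (fun i => RtoC (h (star i))) mu.

Lemma window_local_sums h : window h -> forall K, exists M,
  bounded_sums (fun i => indic (Rabs (val i) <= K) * Cmod (RtoC (h (star i)))) M.
Proof.
  intros Hw K; destruct (window_sums h (Rmax 0 K) Hw (Rmax_l _ _)) as (M & _ & HM).
  exists M; apply bounded_sums_le with (2 := HM 0); intros i.
  split; [apply Rmult_le_pos; [apply indic_bounds|apply Cmod_ge_0]|].
  apply Rmult_le_compat_r; [apply Cmod_ge_0|]; apply indic_le.
  rewrite Rminus_0_r; generalize (Rmax_r 0 K); lra.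
Qed.

(** * The overlaps of the windows solve the equations *)

Definition wlo (a : letter) : R := match a with ta => tau - 2 | tb => -1 end.
Definition whi (a : letter) : R := match a with ta => tau - 1 | tb => tau - 2 end.

(* [overlap a b y] is the length of [W_a] intersected with [W_b - y], divided by
   the total window length [tau], for the windows [W_a = (wlo a, whi a]]. *)
Definition overlap (a b : letter) (y : R) : R :=
  / (2 * tau) * (Rabs (y - (wlo b - whi a)) - Rabs (y - (wlo b - wlo a))
                 - Rabs (y - (whi b - whi a)) + Rabs (y - (whi b - wlo a))).

Lemma overlap_window a b : window (overlap a b).
Proof.
  assert (Ht := tau_bounds); split.
  - intros y Hy; unfold overlap.
    rewrite <- (Rmult_0_r (/ (2 * tau))); f_equal.
    (* All breakpoints lie in [[-tau, tau]]; beyond it the four absolute values share one sign and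
       cancel. *)
    destruct a, b; simpl wlo; simpl whi;
      unfold Rabs in *; repeat destruct Rcase_abs; lra.
  - intros x y; unfold overlap.
    rewrite <- Rmult_minus_distr_l, Rabs_mult.
    assert (Hp : 0 < / (2 * tau) <= / 2).
    { split; [apply Rinv_0_lt_compat; lra|apply Rinv_le_contravar; lra]. }
    rewrite (Rabs_pos_eq (/ (2 * tau))) by lra.
    assert (Hd : forall e, Rabs (Rabs (x - e) - Rabs (y - e)) <= Rabs (x - y)).
    { intros e; replace (x - y) with (x - e - (y - e)) by ring; apply Rabs_triang_inv2. }
    assert (H1 := Hd (wlo b - whi a)); assert (H2 := Hd (wlo b - wlo a)).
    assert (H3 := Hd (whi b - whi a)); assert (H4 := Hd (whi b - wlo a)).
    apply Rabs_le_between in H1, H2, H3, H4.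
    match goal with |- _ * Rabs ?X <= _ =>
      assert (Hb : Rabs X <= 4 * Rabs (x - y)) by (apply Rabs_le; lra);
      generalize (Rabs_pos X)
    end; nra.
Qed.

Lemma overlap_opp a b y : overlap a b (- y) = overlap b a y.
Proof.
  unfold overlap; f_equal.
  rewrite <- (Rabs_Ropp (- y - (wlo b - whi a))), <- (Rabs_Ropp (- y - (wlo b - wlo a))),
    <- (Rabs_Ropp (- y - (whi b - whi a))), <- (Rabs_Ropp (- y - (whi b - wlo a))).
  replace (- (- y - (wlo b - whi a))) with (y - (whi a - wlo b)) by ring.
  replace (- (- y - (wlo b - wlo a))) with (y - (wlo a - wlo b)) by ring.
  replace (- (- y - (whi b - whi a))) with (y - (whi a - whi b)) by ring.
  replace (- (- y - (whi b - wlo a))) with (y - (wlo a - whi b)) by ring.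
  ring.
Qed.

(** Pulls a breakpoint [e] of an overlap function back through [y -> - tau * y - k], which is how
    [deflate k] acts on conjugates. *)
Lemma Rabs_scaled (y k e e' : R) : e = tau * e' - k ->
  Rabs (- tau * y - k - e) = tau * Rabs (y + e').
Proof.
  intros ->; replace (- tau * y - k - (tau * e' - k)) with (- (tau * (y + e'))) by ring.
  rewrite Rabs_Ropp, Rabs_mult, (Rabs_pos_eq tau); [easy|generalize tau_bounds; lra].
Qed.

Ltac unfold_overlap :=
  unfold overlap; simpl wlo; simpl whi; generalize tau_bounds tau_sqr; intros Ht Hq.

(** Up to end points [W_a] is [- 1/tau] times the union of both windows. Rescaling turns the overlap
    of [W_a] with its translate into [1/tau] times that of the union with its translate, which
    splits into four. *)
Lemma overlap_aa y : overlap ta ta y =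
  / tau * (overlap ta ta (- tau * y - 0) + overlap ta tb (- tau * y - 0)
           + overlap tb ta (- tau * y - 0) + overlap tb tb (- tau * y - 0)).
Proof.
  unfold_overlap.
  replace (tau - 1 - (tau - 1)) with 0 by ring; replace (tau - 2 - (tau - 2)) with 0 by ring.
  replace (-1 - -1) with 0 by ring.
  rewrite (Rabs_scaled y 0 (tau - 1 - -1) 1) by lra.
  rewrite (Rabs_scaled y 0 (-1 - (tau - 1)) (-1)) by lra.
  rewrite (Rabs_scaled y 0 0 0) by lra.
  rewrite Rplus_0_r.
  replace (tau - 1 - (tau - 2)) with 1 by ring; replace (tau - 2 - (tau - 1)) with (-1) by ring.
  replace (y - -1) with (y + 1) by ring; replace (y - 1) with (y + -1) by ring.
  rewrite Rminus_0_r; field; lra.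
Qed.

(** Up to end points [W_b] is [- 1/tau] times [W_a + 1]: the tile [b] in an inflated [a] starts at
    distance [tau], whose conjugate is [- 1/tau]. The other window is again [- 1/tau] times the
    union. *)
Lemma overlap_ab y : overlap ta tb y =
  / tau * (overlap ta ta (- tau * y - 1) + overlap tb ta (- tau * y - 1)).
Proof.
  unfold_overlap.
  rewrite (Rabs_scaled y 1 (tau - 2 - (tau - 1)) 0) by lra.
  rewrite (Rabs_scaled y 1 (tau - 2 - (tau - 2)) (tau - 1)) by lra.
  rewrite (Rabs_scaled y 1 (tau - 1 - (tau - 1)) (tau - 1)) by lra.
  rewrite (Rabs_scaled y 1 (tau - 1 - (tau - 2)) (2 * (tau - 1))) by lra.
  rewrite (Rabs_scaled y 1 (tau - 2 - -1) 1) by lra.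
  rewrite (Rabs_scaled y 1 (tau - 1 - -1) tau) by lra.
  replace (y - (-1 - (tau - 1))) with (y + tau) by ring.
  replace (y - (-1 - (tau - 2))) with (y + (tau - 1)) by ring.
  replace (y - (tau - 2 - (tau - 1))) with (y + 1) by ring.
  replace (y - (tau - 2 - (tau - 2))) with (y + 0) by ring.
  field; lra.
Qed.

Lemma overlap_ba y : overlap tb ta y =
  / tau * (overlap ta ta (- tau * y - -1) + overlap ta tb (- tau * y - -1)).
Proof.
  rewrite <- overlap_opp, overlap_ab, <- (overlap_opp ta ta), <- (overlap_opp ta tb).
  do 3 f_equal; ring.
Qed.

(** Both windows are [- 1/tau] times [W_a + 1], so the shifts by 1 cancel. *)
Lemma overlap_bb y : overlap tb tb y = / tau * overlap ta ta (- tau * y - 0).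
Proof.
  unfold_overlap.
  replace (tau - 1 - (tau - 1)) with 0 by ring; replace (tau - 2 - (tau - 2)) with 0 by ring.
  replace (-1 - -1) with 0 by ring.
  rewrite (Rabs_scaled y 0 (tau - 2 - (tau - 1)) (-(tau - 1))) by lra.
  rewrite (Rabs_scaled y 0 (tau - 1 - (tau - 2)) (tau - 1)) by lra.
  rewrite (Rabs_scaled y 0 0 0) by lra.
  replace (y - (-1 - (tau - 2))) with (y + (tau - 1)) by ring.
  replace (y - (tau - 2 - -1)) with (y + - (tau - 1)) by ring.
  rewrite Rplus_0_r, Rminus_0_r; field; lra.
Qed.

(* [z |-> z / tau - k] and its inverse [z |-> tau * z + k * tau] on Z[tau]. *)
Definition deflate (k : Z) (i : Z * Z) : Z * Z := (snd i, fst i - k - snd i)%Z.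
Definition reflate (k : Z) (i : Z * Z) : Z * Z := (snd i + fst i + k, fst i)%Z.

Lemma deflateK k i : reflate k (deflate k i) = i.
Proof. destruct i as [n m]; unfold reflate, deflate; simpl; f_equal; lia. Qed.

Lemma reflateK k i : deflate k (reflate k i) = i.
Proof. destruct i as [n m]; unfold reflate, deflate; simpl; f_equal; lia. Qed.

Lemma val_deflate k i : tau * val (deflate k i) + IZR k * tau = val i.
Proof.
  destruct i as [n m]; unfold val, deflate; simpl; rewrite !minus_IZR.
  generalize tau_sqr; intros H.
  transitivity (IZR m * (tau * tau) + (IZR n - IZR m) * tau); [ring|rewrite H; ring].
Qed.

Lemma star_deflate k i : star (deflate k i) = - tau * star i - IZR k.
Proof.
  destruct i as [n m]; unfold star, deflate; simpl; rewrite !minus_IZR.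
  generalize tau_sqr; intros H.
  transitivity (IZR n * (tau * tau - tau) - IZR m * tau - IZR k); [rewrite H|]; ring.
Qed.

Lemma val_reflate k i : val (reflate k i) = tau * val i + IZR k * tau.
Proof. now rewrite <- (val_deflate k (reflate k i)), reflateK. Qed.

(** Conjugates are shifted by at most 1 and divided by [- tau]; since [(tau + 1) / tau = tau], the
    interval [[-tau, tau]] is just preserved. *)
Lemma admissible_reflate k i :
  admissible i -> (-1 <= k <= 1)%Z -> admissible (reflate k i).
Proof.
  intros H [Hk1 Hk2]; apply IZR_le in Hk1, Hk2; unfold admissible in *.
  assert (E := star_deflate k (reflate k i)); rewrite reflateK in E.
  generalize tau_bounds tau_sqr; intros; nra.
Qed.

(** Reindexing along [deflate k] brings every term of a renormalisation equation to the same lattice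
    points, where the identities for [overlap] compare the masses. *)
Lemma comb_deflate h mu k g : comb h mu -> Cc g ->
  has_sum (fun i => Cmult (RtoC (h (- tau * star i - IZR k))) (g (val i)))
          (mu (fun x => g (tau * x + IZR k * tau))).
Proof.
  intros [_ H] Hg.
  assert (Hg' : Cc (fun x => g (tau * x + IZR k * tau))).
  { apply Cc_affine; [generalize tau_bounds; lra|easy]. }
  assert (K := has_sum_reindex _ (deflate k) (reflate k) _ (reflateK k) (deflateK k) (H _ Hg')).
  revert K; apply has_sum_ext; intros i; cbv beta.
  now rewrite val_deflate, star_deflate.
Qed.

Lemma push_dirac_eq (t : R) (k : Z) (mu : functional) (g : R -> C) : t = IZR k * tau ->
  mu (fun x => g (t + inflate x)) = mu (fun x => g (tau * x + IZR k * tau)).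
Proof.
  intros ->; f_equal; apply functional_extensionality; intros x; f_equal; unfold inflate; ring.
Qed.

Lemma push_inflate_eq (mu : functional) (g : R -> C) :
  mu (fun x => g (inflate x)) = mu (fun x => g (tau * x + IZR 0 * tau)).
Proof. f_equal; apply functional_extensionality; intros x; f_equal; unfold inflate; ring. Qed.

Lemma comb_renormalisation (nu : letter -> letter -> functional) :
  (forall a b, comb (overlap a b) (nu a b)) -> renormalisation nu.
Proof.
  intros H.
  assert (Hd := fun a b k g Hg => comb_deflate _ _ k g (H a b) Hg).
  split; intros g Hg; unfold mscale, mconv, dirac, madd, push;
    [rewrite !push_inflate_eq|rewrite !(push_dirac_eq tau 1) by ring|
     rewrite !(push_dirac_eq (- tau) (-1)) by ring|rewrite !push_inflate_eq];
    (eapply has_sum_unique; [apply (H _ _), Hg|]);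
    (eapply has_sum_ext; [|apply has_sum_scal; repeat apply has_sum_plus; apply Hd, Hg]);
    intros i; cbv beta;
    [rewrite (overlap_aa (star i))|rewrite (overlap_ab (star i))|
     rewrite (overlap_ba (star i))|rewrite (overlap_bb (star i))];
    unfold Rdiv; rewrite Rmult_1_l, RtoC_mult, ?RtoC_plus; ring.
Qed.

Lemma comb_support h mu x : window h -> comb h mu -> in_support mu x -> admissible_point x.
Proof.
  intros Hw [_ H] Hx; apply admissible_point_iff, NNPP; intros Hn.
  destruct (window_discrete x) as (eps & He & Hd).
  destruct (Hx eps He) as (g & Hg & Hg0 & Hne); apply Hne.
  apply (has_sum_unique _ _ _ (H g Hg)).
  eapply has_sum_ext; [|apply has_sum_zero]; intros i; cbv beta.
  destruct (Rle_dec (Rabs (star i)) tau) as [Hs|Hs].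
  - assert (Ha : admissible i) by now apply Rabs_le_between.
    rewrite Hg0; [ring|]; apply Hd; [easy|]; intros E; apply Hn; now exists i.
  - rewrite (proj1 Hw) by lra; ring.
Qed.

Lemma comb_tilde a b mu mu' :
  comb (overlap a b) mu -> comb (overlap b a) mu' -> meas_eq (mtilde mu) mu'.
Proof.
  intros [_ H] [_ H'] g Hg; apply (has_sum_unique (fun i => Cmult (RtoC (overlap b a (star i))) (g (val i)))).
  2: now apply H'.
  unfold mtilde.
  assert (Hg' : Cc (fun x => Cconj (g (- x)))).
  { apply Cc_conj; replace (fun x => g (- x)) with (fun x => g (0 - x)).
    - now apply Cc_reflect.
    - apply functional_extensionality; intros; f_equal; ring. }
  assert (K := has_sum_conj _ _ (H _ Hg')).
  apply (has_sum_reindex _ (fun i => (- fst i, - snd i)%Z) (fun i => (- fst i, - snd i)%Z)) in K.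
  2, 3: intros [n m]; simpl; f_equal; lia.
  revert K; apply has_sum_ext; intros [n m]; simpl.
  replace (star (- n, - m)%Z) with (- star (n, m)) by (unfold star; simpl; rewrite !opp_IZR; ring).
  replace (- val (- n, - m)%Z) with (val (n, m)) by (unfold val; simpl; rewrite !opp_IZR; ring).
  rewrite overlap_opp.
  unfold Cconj, Cmult, RtoC; simpl; f_equal; ring.
Qed.

Lemma comb_solution (nu : letter -> letter -> functional) :
  (forall a b, comb (overlap a b) (nu a b)) -> is_solution nu.
Proof.
  intros H; split.
  - intros a b; eapply atomic_measure, H.
  - intros a b; eapply atomic_pure_point, H; apply val_inj.
  - intros a b x; apply (comb_support (overlap a b)); [apply overlap_window|apply H].
  - intros a b; apply (comb_tilde a b); apply H.
  - assert (K := atomic_point_mass _ _ _ (0, 0)%Z val_inj (H ta ta)); cbv beta in K.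
    replace (val (0, 0)%Z) with 0 in K by (unfold val; simpl; ring).
    replace (overlap ta ta (star (0, 0)%Z)) with (1 / tau) in K; [exact K|].
    unfold star; simpl; unfold_overlap.
    unfold Rabs; repeat destruct Rcase_abs; try lra; field; lra.
  - now apply comb_renormalisation.
Qed.

(** * Uniqueness of the solution *)

Lemma pure_point_vanish mu g : pure_point mu ->
  (forall x, in_support mu x -> admissible_point x) -> Cc g ->
  (forall i, admissible i -> g (val i) = RtoC 0) -> mu g = RtoC 0.
Proof.
  intros (u & c & _ & Hc & Hs) Hsup Hg Hg0.
  (* The atoms [u n] are arbitrary reals at first. A nonzero mass is detected by narrow tents, so
     its atom belongs to the support and is admissible, where [g] vanishes. *)
  assert (Hz : forall n, Cmult (c n) (g (u n)) = RtoC 0).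
  { intros n; destruct (excluded_middle_informative (c n = RtoC 0)) as [->|Hn]; [ring|].
    assert (Ha : admissible_point (u n)).
    { apply Hsup; intros eps He.
      assert (K := proj2 (cvg_filterlim _ _) (Hc n)).
      destruct (K (Cmod (c n))) as [N HN]; [now apply Cmod_gt_0|].
      destruct (inv_INR_small eps He) as [N' HN'].
      exists (tent (u n) (N + N')); split; [apply Cc_tent|split].
      - intros y Hy; apply tent_outside; specialize (HN' (N + N')%nat ltac:(lia)); lra.
      - intros E; specialize (HN (N + N')%nat ltac:(lia)); rewrite E in HN.
        replace (Cminus (RtoC 0) (c n)) with (Copp (c n)) in HN by ring.
        rewrite Cmod_opp in HN; lra. }
    apply admissible_point_iff in Ha; destruct Ha as (i & -> & Hi).
    rewrite Hg0 by easy; ring. }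
  assert (K := proj2 (cvg_filterlim _ _) (Hs g Hg)).
  apply Cmod_minus_eq; intros eps He; destruct (K eps He) as [N HN].
  specialize (HN N (le_n _)).
  replace (sum_n _ N) with (RtoC 0) in HN; [now rewrite Cmod_minus_sym|].
  symmetry; clear - Hz; induction N.
  - rewrite sum_O; apply Hz.
  - rewrite sum_Sn, IHN, Hz; apply (plus_zero_l (G := C_AbelianMonoid)).
Qed.

(** Pairing such an [f] with a solution reads off the mass at [val i] without a limit along
    tents. *)
Definition isolates (f : R -> C) (i : Z * Z) : Prop :=
  Cc f /\ f (val i) = RtoC 1 /\ forall j, admissible j -> j <> i -> f (val j) = RtoC 0.

Lemma tent_isolates i : exists N, forall n, (N <= n)%nat -> isolates (tent (val i) n) i.
Proof.
  destruct (window_discrete (val i)) as (eps & He & Hd).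
  destruct (inv_INR_small eps He) as [N HN].
  exists N; intros n Hn; split; [apply Cc_tent|]; split; [apply tent_center|].
  intros j Hj Hne; apply tent_outside.
  specialize (HN n Hn); specialize (Hd j Hj).
  assert (eps <= Rabs (val j - val i)); [|lra].
  apply Hd; intros E; now apply val_inj in E.
Qed.

Definition isolator (i : Z * Z) : R -> C :=
  epsilon (inhabits (fun _ => RtoC 0)) (fun f => isolates f i).

Lemma isolator_spec i : isolates (isolator i) i.
Proof.
  unfold isolator; apply epsilon_spec; destruct (tent_isolates i) as [N HN].
  exists (tent (val i) N); auto.
Qed.

(** Inflation maps admissible points to admissible points, so the zeros of [f] there pull back to
    zeros at all admissible points other than [deflate k i]. *)
Lemma isolates_deflate f k i : (-1 <= k <= 1)%Z -> isolates f i ->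
  isolates (fun x => f (tau * x + IZR k * tau)) (deflate k i).
Proof.
  intros Hk (Hf & H1 & H0); split; [|split].
  - apply Cc_affine; [generalize tau_bounds; lra|easy].
  - now rewrite val_deflate.
  - intros j Hj Hn; rewrite <- val_reflate; apply H0; [now apply admissible_reflate|].
    intros <-; apply Hn; now rewrite reflateK.
Qed.

Lemma contraction_zero (x : C) :
  x = Cmult (RtoC (1 / tau)) (Cmult (RtoC (1 / tau)) x) -> x = RtoC 0.
Proof.
  intros H; generalize tau_bounds inv_tau; intros Ht Hi.
  assert (K := f_equal Cmod H).
  rewrite !Cmod_mult, Cmod_R, Rabs_pos_eq in K.
  2: { apply Rlt_le, Rdiv_lt_0_compat; lra. }
  unfold Rdiv in K; rewrite Rmult_1_l, Hi in K.
  assert (E : (tau - 1) * ((tau - 1) * Cmod x) = (2 - tau) * Cmod x).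
  { transitivity ((tau * tau - 2 * tau + 1) * Cmod x); [ring|rewrite tau_sqr; ring]. }
  apply Cmod_eq_0; apply Rmult_eq_reg_l with (tau - 1); lra.
Qed.

Ltac zero H :=
  rewrite H; unfold deflate; simpl;
  repeat match goal with
  | K : _ = RtoC 0 |- _ => rewrite K
  | K : forall a b, _ = RtoC 0 |- _ => rewrite K
  end; ring.

Ltac outside := unfold Rabs; destruct Rcase_abs; lra.

(** Settles the letter pairs whose recursion at [p] involves known zeros only. The others are
    skipped silently, so a point may be visited again once more zeros are available. *)
Ltac zero_at d Haa Hab Hba Hbb p :=
  try (assert (d ta ta p = RtoC 0) by zero Haa); try (assert (d ta tb p = RtoC 0) by zero Hab);
  try (assert (d tb ta p = RtoC 0) by zero Hba); try (assert (d tb tb p = RtoC 0) by zero Hbb).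

(** [d] stands for the difference of the masses of two solutions. Deflation sends [|val i|] to at
    most [|val i| / tau + 1], a contraction with fixed point [tau^2], so repeated use of the
    recursion ends at the nine base points. *)
Lemma recursion_zero (d : letter -> letter -> Z * Z -> C) (u := RtoC (1 / tau)) :
  (forall a b i, ~ admissible i -> d a b i = RtoC 0) ->
  (forall i, d ta ta i = Cmult u (Cplus (Cplus (Cplus (d ta ta (deflate 0 i)) (d ta tb (deflate 0 i)))
                                 (d tb ta (deflate 0 i))) (d tb tb (deflate 0 i)))) ->
  (forall i, d ta tb i = Cmult u (Cplus (d ta ta (deflate 1 i)) (d tb ta (deflate 1 i)))) ->
  (forall i, d tb ta i = Cmult u (Cplus (d ta ta (deflate (-1) i)) (d ta tb (deflate (-1) i)))) ->
  (forall i, d tb tb i = Cmult u (d ta ta (deflate 0 i))) ->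
  d ta ta (0, 0)%Z = RtoC 0 ->
  forall a b i, d a b i = RtoC 0.
Proof.
  intros Hadm Haa Hab Hba Hbb H00.
  generalize tau_bounds tau_sqr; intros Ht Hq.
  assert (Hout : forall n m, tau < Rabs (IZR m + IZR n * (1 - tau)) -> forall a b, d a b (n, m) = RtoC 0).
  { intros n m Hn a b; apply Hadm; unfold admissible; intros H; apply Rabs_le in H.
    unfold star in H; simpl in H; lra. }
  (* The inadmissible points that the recursion reaches from the nine base points. *)
  assert (Z20 := Hout (-1)%Z (2)%Z ltac:(outside)).
  assert (Z30 := Hout (-1)%Z (3)%Z ltac:(outside)).
  assert (Z12 := Hout (1)%Z (-2)%Z ltac:(outside)).
  assert (Z13 := Hout (1)%Z (-3)%Z ltac:(outside)).
  assert (Z02 := Hout (0)%Z (2)%Z ltac:(outside)).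
  assert (Z0m := Hout (0)%Z (-2)%Z ltac:(outside)).
  (* On the nine points of the base region, all masses are forced to be zero by zero masses
     elsewhere, except for three pairs that only depend on each other, with factor [1/tau^2]. *)
  assert (Hcycle : forall a b p a' b' q, d a b p = Cmult u (d a' b' q) ->
    d a' b' q = Cmult u (d a b p) -> d a b p = RtoC 0).
  { intros a b p a' b' q E1 E2; apply contraction_zero; fold u; now rewrite <- E2. }
  zero_at d Haa Hab Hba Hbb (1, -1)%Z; zero_at d Haa Hab Hba Hbb (-1, 1)%Z.
  assert (d ta tb (1, -1)%Z = RtoC 0).
  { apply (Hcycle ta tb (1, -1)%Z tb ta (-1, 1)%Z); [zero Hab|zero Hba]. }
  zero_at d Haa Hab Hba Hbb (-1, 1)%Z; zero_at d Haa Hab Hba Hbb (0, 1)%Z;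
  zero_at d Haa Hab Hba Hbb (0, 0)%Z; zero_at d Haa Hab Hba Hbb (1, 0)%Z.
  assert (d tb ta (0, 1)%Z = RtoC 0).
  { apply (Hcycle tb ta (0, 1)%Z ta ta (1, 0)%Z); [zero Hba|zero Haa]. }
  zero_at d Haa Hab Hba Hbb (1, 0)%Z; zero_at d Haa Hab Hba Hbb (0, -1)%Z;
  zero_at d Haa Hab Hba Hbb (0, 0)%Z; zero_at d Haa Hab Hba Hbb (-1, 0)%Z.
  assert (d ta tb (0, -1)%Z = RtoC 0).
  { apply (Hcycle ta tb (0, -1)%Z ta ta (-1, 0)%Z); [zero Hab|zero Haa]. }
  zero_at d Haa Hab Hba Hbb (-1, 0)%Z; zero_at d Haa Hab Hba Hbb (1, 1)%Z;
  do 2 zero_at d Haa Hab Hba Hbb (-1, -1)%Z.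
  assert (Hbase : forall n m a b, (-1 <= n <= 1)%Z -> (-1 <= m <= 1)%Z -> d a b (n, m) = RtoC 0).
  { intros n m a b Hn Hm.
    assert (n = -1 \/ n = 0 \/ n = 1)%Z as [|[|]] by lia;
    assert (m = -1 \/ m = 0 \/ m = 1)%Z as [|[|]] by lia; subst n m;
    destruct a, b; assumption. }
  (* The slack 1/5 keeps [|n| * sqrt 5 = |val i - star i| <= tau^2 + tau + 1/5] below [2 * sqrt 5]. *)
  assert (Hind : forall k i, Rabs (val i) <= tau * tau + / 5 * tau ^ k -> forall a b, d a b i = RtoC 0).
  { induction k as [|k IH]; intros i Hi a b.
    - destruct (excluded_middle_informative (admissible i)) as [Ha|Ha]; [|now apply Hadm].
      unfold admissible in Ha; rewrite pow_O in Hi; apply Rabs_le_between in Hi.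
      assert (E := val_star i); rewrite sqrt5_tau in E.
      destruct i as [n m]; simpl fst in E.
      assert (Hn : (-1 <= n <= 1)%Z).
      { assert (-2 < n < 2)%Z; [|lia]; split; apply lt_IZR; apply Rnot_le_lt; intros K; nra. }
      apply Hbase; [easy|].
      unfold val, star in *; simpl in *.
      assert (-2 < m < 2)%Z; [|lia].
      assert (n = -1 \/ n = 0 \/ n = 1)%Z as [|[|]] by lia; subst n; split; apply lt_IZR; lra.
    - assert (Hk : forall l, (-1 <= l <= 1)%Z -> forall a b, d a b (deflate l i) = RtoC 0).
      { intros l [Hl1 Hl2]; apply IH; apply IZR_le in Hl1, Hl2.
        assert (E := val_deflate l i).
        assert (K : tau * Rabs (val (deflate l i)) <= Rabs (val i) + tau).
        { rewrite <- (Rabs_pos_eq tau) at 1 by lra; rewrite <- Rabs_mult.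
          replace (tau * val (deflate l i)) with (val i - IZR l * tau) by lra.
          eapply Rle_trans; [apply Rabs_triang|]; rewrite Rabs_Ropp, Rabs_mult, (Rabs_pos_eq tau) by lra.
          assert (Rabs (IZR l) <= 1) by (apply Rabs_le; lra); nra. }
        apply Rmult_le_reg_l with tau; [lra|]; simpl pow in Hi; nra. }
      destruct a, b; [rewrite Haa|rewrite Hab|rewrite Hba|rewrite Hbb]; rewrite !Hk by lia; ring. }
  intros a b i.
  destruct (Pow_x_infinity tau ltac:(rewrite Rabs_pos_eq; lra) (5 * Rabs (val i))) as [k Hk].
  apply (Hind k); specialize (Hk k (le_n _)).
  rewrite Rabs_pos_eq in Hk by (apply pow_le; lra). lra.
Qed.

(** Holds for the components of a solution and for differences of such components; these functionals
    are determined by their values on isolators. *)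
Definition separating (D : functional) : Prop :=
  (forall c g h, Cc g -> Cc h ->
     D (fun x => Cplus (Cmult c (g x)) (h x)) = Cplus (Cmult c (D g)) (D h)) /\
  forall g, Cc g -> (forall i, admissible i -> g (val i) = RtoC 0) -> D g = RtoC 0.

Lemma separating_eq D f g : separating D -> Cc f -> Cc g ->
  (forall i, admissible i -> f (val i) = g (val i)) -> D f = D g.
Proof.
  intros [Hl Hv] Hf Hg E.
  assert (K := Hl (RtoC (-1)) f g Hf Hg).
  rewrite (Hv _ (Cc_linear _ _ _ Hf Hg)) in K.
  - replace (D g) with (Cplus (Cplus (Cmult (RtoC (-1)) (D f)) (D g)) (D f)).
    + rewrite <- K; ring.
    + transitivity (Cplus (D g) (Cmult (Cplus (RtoC (-1)) (RtoC 1)) (D f))); [ring|].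
      rewrite <- RtoC_plus; replace (-1 + 1) with 0 by ring; ring.
  - intros i Hi; rewrite E by easy.
    transitivity (Cmult (Cplus (RtoC (-1)) (RtoC 1)) (g (val i))); [ring|].
    rewrite <- RtoC_plus; replace (-1 + 1) with 0 by ring; ring.
Qed.

Lemma separating_isolates D f i : separating D -> isolates f i -> D f = D (isolator i).
Proof.
  intros HD Hf; destruct (isolator_spec i) as (H1 & H2 & H3), Hf as (K1 & K2 & K3).
  apply separating_eq; auto; intros j Hj; destruct (dec j i) as [->|Hn]; [congruence|].
  rewrite H3, K3; auto.
Qed.

(** The support of [g] meets finitely many admissible points, and there [g] agrees with a finite
    combination of isolators, which [D] cannot tell from [g]. *)
Lemma separating_zero D : separating D -> (forall i, D (isolator i) = RtoC 0) ->
  forall g, Cc g -> D g = RtoC 0.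
Proof.
  intros HD H0 g Hg.
  destruct (Cc_support g Hg) as (K & HK & HgK).
  destruct (bounded_sums_window 2 K) as [M HM]; [lra|lra|].
  destruct (bounded_sums_finite _ _ (HM 0)) as (A & ND & HA).
  set (s := fun L x => csum (fun i => Cmult (g (val i)) (isolator i x)) L).
  assert (Hs : forall L, Cc (s L) /\ D (s L) = RtoC 0).
  { induction L as [|i L [IH1 IH2]]; unfold s; simpl.
    - assert (Cc (fun _ => RtoC 0)).
      { split; [intros; apply continuous_const|exists 0; easy]. }
      split; [easy|]; apply HD; easy.
    - destruct (isolator_spec i) as (Hi & _).
      split; [now apply Cc_linear|].
      assert (E := proj1 HD (g (val i)) (isolator i) (s L) Hi IH1).
      rewrite H0, IH2 in E; etransitivity; [exact E|ring]. }
  rewrite (separating_eq D g (s A)); [apply Hs|easy|easy|apply Hs|].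
  intros j Hj; unfold s.
  assert (Ht := tau_bounds).
  destruct (in_dec dec j A) as [Hin|Hout].
  - rewrite (csum_remove _ j) by easy.
    rewrite csum_zero, (proj1 (proj2 (isolator_spec j))); [ring|].
    intros i Hi; apply in_remove in Hi; destruct (isolator_spec i) as (_ & _ & H).
    rewrite H; [ring|easy|intuition congruence].
  - rewrite HgK, csum_zero; [easy| |].
    + intros i Hi; destruct (isolator_spec i) as (_ & _ & H).
      rewrite H; [ring|easy|congruence].
    + apply Rnot_le_lt; intros HKj; apply Hout, HA; split.
      * now rewrite Rminus_0_r.
      * unfold admissible in Hj; apply Rabs_le; lra.
Qed.

(** The initial condition is a limit along tents at 0. Once they are narrow they isolate 0 and all
    have the same image, so the sequence is eventually constant. *)
Lemma solution_mass_zero nu f : is_solution nu -> isolates f (0, 0)%Z ->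
  nu ta ta f = RtoC (1 / tau).
Proof.
  intros H Hf.
  assert (HD : separating (nu ta ta)).
  { split; [apply (measure_linear _ (sol_measure _ H ta ta))|].
    intros g Hg H0; apply pure_point_vanish; [apply H|apply H|easy|easy]. }
  apply Cmod_minus_eq; intros eps He.
  destruct (proj2 (cvg_filterlim _ _) (sol_initial _ H) eps He) as [N HN].
  destruct (tent_isolates (0, 0)%Z) as [N' HN'].
  specialize (HN (N + N')%nat ltac:(lia)); specialize (HN' (N + N')%nat ltac:(lia)).
  replace (val (0, 0)%Z) with 0 in HN' by (unfold val; simpl; ring).
  now rewrite (separating_isolates _ _ _ HD Hf), <- (separating_isolates _ _ _ HD HN').
Qed.

Lemma solution_unique nu nu' : is_solution nu -> is_solution nu' ->
  forall a b, meas_eq (nu a b) (nu' a b).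
Proof.
  intros H H'.
  set (D := fun a b g => Cminus (nu a b g) (nu' a b g)).
  assert (HD : forall a b, separating (D a b)).
  { intros a b; split.
    - intros c g h Hg Hh; unfold D.
      rewrite (measure_linear _ (sol_measure _ H a b)), (measure_linear _ (sol_measure _ H' a b)) by easy.
      ring.
    - intros g Hg H0; unfold D.
      rewrite (pure_point_vanish (nu a b) g), (pure_point_vanish (nu' a b) g);
        try easy; try apply H; try apply H'; ring. }
  (* This turns the equations between measures into a recursion for numbers indexed by lattice
     points. *)
  assert (HI : forall a b k i, (-1 <= k <= 1)%Z ->
    D a b (fun x => isolator i (tau * x + IZR k * tau)) = D a b (isolator (deflate k i))).
  { intros a b k i Hk; apply separating_isolates; [easy|].
    apply isolates_deflate, isolator_spec; easy. }
  assert (Hc := fun i => proj1 (isolator_spec i)).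
  assert (HR := sol_renormalisation _ H); assert (HR' := sol_renormalisation _ H').
  assert (Hz : forall a b i, D a b (isolator i) = RtoC 0).
  { apply (recursion_zero (fun a b i => D a b (isolator i))).
    - intros a b i Hi; apply HD; [apply isolator_spec|].
      intros j Hj; apply isolator_spec; [easy|]; intros ->; easy.
    - intros i; rewrite <- !HI by lia; unfold D.
      rewrite (ren_aa _ HR _ (Hc i)), (ren_aa _ HR' _ (Hc i)).
      unfold mscale, mconv, dirac, madd, push; rewrite !push_inflate_eq; ring.
    - intros i; rewrite <- !HI by lia; unfold D.
      rewrite (ren_ab _ HR _ (Hc i)), (ren_ab _ HR' _ (Hc i)).
      unfold mscale, mconv, dirac, madd, push; rewrite !(push_dirac_eq tau 1) by ring; ring.
    - intros i; rewrite <- !HI by lia; unfold D.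
      rewrite (ren_ba _ HR _ (Hc i)), (ren_ba _ HR' _ (Hc i)).
      unfold mscale, mconv, dirac, madd, push; rewrite !(push_dirac_eq (- tau) (-1)) by ring; ring.
    - intros i; rewrite <- !HI by lia; unfold D.
      rewrite (ren_bb _ HR _ (Hc i)), (ren_bb _ HR' _ (Hc i)).
      unfold mscale, mconv, dirac, madd, push; rewrite !push_inflate_eq; ring.
    - unfold D; rewrite (solution_mass_zero nu), (solution_mass_zero nu'); try easy;
        try apply isolator_spec; ring. }
  intros a b g Hg.
  assert (K := separating_zero (D a b) (HD a b) (Hz a b) g Hg); unfold D in K.
  replace (nu a b g) with (Cplus (Cminus (nu a b g) (nu' a b g)) (nu' a b g)) by ring.
  rewrite K; ring.
Qed.

Lemma solution_exists : exists nu : letter -> letter -> functional,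
  forall a b, comb (overlap a b) (nu a b).
Proof.
  exists (fun a b g => total_sum (fun i => Cmult (RtoC (overlap a b (star i))) (g (val i)))).
  intros a b; apply (atomic_total_sum val), window_local_sums, overlap_window.
Qed.

(** By uniqueness the explicit weights pass to every solution; all later arguments concern combs
    only. *)
Lemma solution_comb nu : is_solution nu -> forall a b, comb (overlap a b) (nu a b).
Proof.
  intros H a b; destruct solution_exists as [nu' H'].
  destruct (H' a b) as [Hb Hs]; split; [easy|]; intros g Hg.
  rewrite (solution_unique nu nu' H (comb_solution _ H') a b g Hg); auto.
Qed.

(** * Almost periodicity *)

Lemma comb_bound h mu K : window h -> comb h mu -> 0 <= K -> exists M, 0 <= M /\
  forall x B g, Cc g -> (forall y, K < Rabs (y - x) -> g y = RtoC 0) ->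
    (forall y, Cmod (g y) <= B) -> Cmod (mu g) <= M * B.
Proof.
  intros Hw H HK; destruct (window_sums h K Hw HK) as (M & HM0 & HM).
  exists M; split; [easy|]; intros x B g Hg Hsup HB.
  apply (atomic_bound _ _ mu (fun y => Rabs (y - x) <= K) M g B H (HM x)); auto.
  intros y Hy; apply Hsup; lra.
Qed.

Lemma comb_translation_bounded h mu : window h -> comb h mu -> translation_bounded mu.
Proof.
  intros Hw H; destruct (comb_bound h mu 1 Hw H) as (M & HM0 & HM); [lra|].
  exists M; intros t g Hg Hsup HB; rewrite <- (Rmult_1_r M).
  apply (HM t 1 g Hg); [|easy]; intros y Hy; apply Hsup; intros Hty.
  rewrite Rabs_pos_eq in Hy; lra.
Qed.

Lemma comb_fconv_continuous h mu g : window h -> comb h mu -> Cc g ->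
  forall x, continuous (fconv g mu) x.
Proof.
  intros Hw H Hg x; apply continuous_eps; intros eps He.
  destruct (Cc_support g Hg) as (K & HK & HgK).
  destruct (comb_bound h mu (K + 1) Hw H) as (M & HM0 & HM); [lra|].
  destruct (Cc_unif g Hg (eps / (M + 1))) as (d & Hd & Hu).
  { apply Rdiv_lt_0_compat; lra. }
  exists (Rmin d 1); split; [apply Rmin_glb_lt; lra|]; intros y Hy.
  assert (Hd1 := Rmin_l d 1); assert (Hd2 := Rmin_r d 1).
  unfold fconv.
  rewrite <- (measure_minus mu (fun z => g (y - z)) (fun z => g (x - z)))
    by (try apply (atomic_measure _ _ _ H); now apply Cc_reflect).
  apply Rle_lt_trans with (M * (eps / (M + 1))).
  - apply (HM x).
    + apply Cc_minus; now apply Cc_reflect.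
    + intros z Hz.
      assert (K1 := Rabs_triang_inv (x - z) (x - y)).
      replace (x - z - (x - y)) with (y - z) in K1 by ring.
      rewrite (Rabs_minus_sym x z), (Rabs_minus_sym x y) in K1.
      rewrite !HgK by (rewrite ?(Rabs_minus_sym x z); lra); ring.
    + intros z; apply Rlt_le, Hu; replace (y - z - (x - z)) with (y - x) by ring; lra.
  - apply Rmult_lt_reg_r with (M + 1); [lra|]; field_simplify; [|lra]; nra.
Qed.

Lemma Rabs_up (x : R) : Rabs (IZR (up x) - x) <= 1.
Proof. destruct (archimed x); apply Rabs_le; lra. Qed.

(** For the bound 1 such points are found by rounding. Multiplication by the unit [tau] shrinks
    conjugates by [1/tau] and stretches gaps by [tau], so iteration reaches every [delta]. *)
Lemma small_star_dense (delta : R) : 0 < delta -> exists L, 0 < L /\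
  forall x, exists k, x <= val k <= x + L /\ Rabs (star k) <= delta.
Proof.
  intros Hd; generalize tau_bounds inv_tau; intros Ht Hi.
  assert (Hk : forall n : nat, exists L, 0 < L /\
    forall x, exists k, x <= val k <= x + L /\ Rabs (star k) <= (/ tau) ^ n).
  { induction n as [|n (L & HL & IH)].
    - exists 8; split; [lra|]; intros x.
      (* Rounding puts [val (n, m)] within [1 + sqrt 5 < 4] of [x + 4], hence into [[x, x + 8]]. *)
      set (n := up ((x + 4) / sqrt 5)); set (m := up (- (IZR n * (1 - tau)))).
      exists (n, m).
      assert (H5 := sqrt5_tau).
      assert (H1 := Rabs_up ((x + 4) / sqrt 5)); fold n in H1.
      assert (H2 := Rabs_up (- (IZR n * (1 - tau)))); fold m in H2.
      replace (IZR m - - (IZR n * (1 - tau))) with (star (n, m)) in H2 by (unfold star; simpl; ring).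
      split; [|rewrite pow_O; lra].
      rewrite val_star; simpl fst.
      assert (H3 : Rabs (IZR n * sqrt 5 - (x + 4)) <= sqrt 5).
      { replace (IZR n * sqrt 5 - (x + 4)) with (sqrt 5 * (IZR n - (x + 4) / sqrt 5)) by (field; lra).
        rewrite Rabs_mult, (Rabs_pos_eq (sqrt 5)) by lra; nra. }
      apply Rabs_le_between in H2; apply Rabs_le_between in H3; lra.
    - exists (tau * L); split; [nra|]; intros x.
      destruct (IH (x / tau)) as (k & Hk1 & Hk2); exists (reflate 0 k); split.
      + rewrite val_reflate.
        assert (E : x = tau * (x / tau)) by (field; lra).
        set (y := x / tau) in *; clearbody y; subst x; nra.
      + assert (E := star_deflate 0 (reflate 0 k)); rewrite reflateK in E.
        rewrite E in Hk2; simpl pow.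
        replace (- tau * star (reflate 0 k) - 0) with (- (tau * star (reflate 0 k))) in Hk2 by ring.
        rewrite Rabs_Ropp, Rabs_mult, (Rabs_pos_eq tau) in Hk2 by lra.
        apply Rmult_le_reg_l with tau; [lra|].
        rewrite <- Rmult_assoc, Rinv_r; lra. }
  destruct (pow_lt_1_zero (/ tau)) with (y := delta) as [N HN].
  - rewrite Rabs_pos_eq; lra.
  - lra.
  - destruct (Hk N) as (L & HL & H); exists L; split; [easy|]; intros x.
    destruct (H x) as (k & Hk1 & Hk2); exists k; split; [easy|].
    specialize (HN N (le_n _)); rewrite Rabs_pos_eq in HN; [lra|].
    apply pow_le; lra.
Qed.

Lemma comb_bohr_ap h mu g : window h -> comb h mu -> Cc g -> bohr_ap (fconv g mu).
Proof.
  intros Hw H Hg; split; [intros; now apply (comb_fconv_continuous h)|].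
  intros eps He.
  destruct (Cc_support g Hg) as (K & HK & HgK).
  destruct (Cc_bounded g Hg) as (B & HB & HgB).
  (* For [|star k| <= 1] both [h (star i)] and [h (star i + star k)] vanish unless
     [|star i| <= 3]. *)
  destruct (bounded_sums_window 3 K) as [M HM]; [lra|lra|].
  assert (HM0 : 0 <= M) by (apply (HM 0) with (B := []); constructor).
  set (d := Rmin 1 (eps / (2 * B * M + 1))).
  assert (Hp : 0 < 2 * B * M + 1) by nra.
  assert (Hd : 0 < d) by (apply Rmin_glb_lt; [lra|apply Rdiv_lt_0_compat; lra]).
  destruct (small_star_dense d Hd) as (L & HL & HLx).
  exists L; split; [easy|]; intros x; destruct (HLx x) as (k & Hk1 & Hk2).
  exists (val k); split; [easy|]; intros y.
  assert (Hd1 : d <= 1) by apply Rmin_l.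
  assert (H1 := proj2 H _ (Cc_reflect g (y + val k) Hg)).
  assert (H0 := proj2 H _ (Cc_reflect g y Hg)).
  (* After the shift of the index by [k] both sums evaluate [g] at the same points [y - val i]; only
     the arguments of [h] differ, by [star k]. *)
  apply (has_sum_reindex _ (fun i => (fst i + fst k, snd i + snd k)%Z)
                           (fun i => (fst i - fst k, snd i - snd k)%Z)) in H1.
  2, 3: intros [n m]; simpl; f_equal; lia.
  assert (HD := has_sum_minus _ _ _ _ H1 H0).
  apply Rle_lt_trans with (2 * Rabs (star k) * B * M).
  - apply (has_sum_norm _ (fun i => 2 * Rabs (star k) * B * indic (Rabs (val i - y) <= K /\ Rabs (star i) <= 3)))
      with (3 := HD).
    + intros i.
      replace (star ((fst i + fst k)%Z, (snd i + snd k)%Z)) with (star i + star k)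
        by (unfold star; simpl; rewrite !plus_IZR; ring).
      replace (y + val k - val ((fst i + fst k)%Z, (snd i + snd k)%Z)) with (y - val i)
        by (unfold val; simpl; rewrite !plus_IZR; ring).
      replace (Cminus _ _) with (Cmult (RtoC (h (star i + star k) - h (star i))) (g (y - val i)))
        by (rewrite RtoC_minus; ring).
      rewrite Cmod_mult, Cmod_R.
      assert (Hl := proj2 Hw (star i + star k) (star i)).
      replace (star i + star k - star i) with (star k) in Hl by ring.
      assert (Hpk := Rabs_pos (star k)).
      assert (Hpp : 0 <= 2 * Rabs (star k) * B) by (apply Rmult_le_pos; lra).
      assert (Hz : Rabs (h (star i + star k) - h (star i)) * Cmod (g (y - val i)) = 0 ->
        Rabs (h (star i + star k) - h (star i)) * Cmod (g (y - val i)) <=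
        2 * Rabs (star k) * B * indic (Rabs (val i - y) <= K /\ Rabs (star i) <= 3)).
      { intros ->; apply Rmult_le_pos; [easy|apply indic_bounds]. }
      destruct (Rle_dec (Rabs (val i - y)) K) as [HyK|HyK].
      2: { apply Hz; rewrite HgK, Cmod_0 by (rewrite Rabs_minus_sym; lra); ring. }
      destruct (Rle_dec (Rabs (star i)) 3) as [Hs|Hs].
      2: { apply Hz; generalize tau_bounds; intros.
           assert (K1 := Rabs_triang_inv (star i) (- star k)).
           rewrite Rabs_Ropp in K1; replace (star i - - star k) with (star i + star k) in K1 by ring.
           rewrite !(proj1 Hw) by lra; rewrite Rminus_0_r, Rabs_R0; ring. }
      rewrite indic_true by easy; rewrite Rmult_1_r.
      apply Rmult_le_compat; [apply Rabs_pos|apply Cmod_ge_0|lra|easy].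
    + apply bounded_sums_scal; [|apply HM].
      generalize (Rabs_pos (star k)); intros; apply Rmult_le_pos; lra.
  - assert (Hd2 : Rabs (star k) <= eps / (2 * B * M + 1)).
    { eapply Rle_trans; [exact Hk2|apply Rmin_r]. }
    assert (E : (2 * B * M + 1) * (eps / (2 * B * M + 1)) = eps) by (field; lra).
    set (q := eps / (2 * B * M + 1)) in *.
    assert (Hq : 0 < q) by (apply Rdiv_lt_0_compat; lra).
    assert (0 <= 2 * B * M) by nra.
    replace (2 * Rabs (star k) * B * M) with ((2 * B * M) * Rabs (star k)) by ring.
    nra.
Qed.

Lemma comb_strongly_ap h mu : window h -> comb h mu -> strongly_ap mu.
Proof.
  intros Hw H; split; [eapply atomic_measure, H|split].
  - now apply (comb_translation_bounded h).
  - intros g Hg; now apply (comb_bohr_ap h).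
Qed.

Lemma null_wap_zero : null_wap (fun _ => RtoC 0).
Proof.
  assert (HC : Cu (fun _ => RtoC 0)).
  { split.
    - exists 0; intros; rewrite Cmod_0; lra.
    - intros eps He; exists 1; split; [lra|]; intros.
      rewrite Cmod_minus_diag; lra. }
  assert (Hn : forall (ls : list functional) eps, 0 < eps -> weak_nbhd ls eps (fun _ => RtoC 0) (fun _ => RtoC 0)).
  { intros ls eps He; split; [easy|]; apply Forall_forall; intros l _.
    rewrite Cmod_minus_diag; lra. }
  split; [split; [easy|]|].
  - intros Phi HPhi HK; exists (fun _ => RtoC 0); split.
    + split; [easy|]; intros ls eps _ He.
      exists (fun _ => RtoC 0); split; [now exists 0|auto].
    + intros A ls eps HA _ He.
      destruct (filter_ex _ (filter_and _ _ HA HK)) as (H & HAH & HcH & HH).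
      exists H; split; [easy|].
      replace H with (fun _ : R => RtoC 0); [auto|].
      apply functional_extensionality; intros x; symmetry; apply Cmod_minus_eq; intros e He'.
      (* Point evaluations belong to the dual of [Cu], so weak limits of the zero orbit vanish
         pointwise. *)
      destruct (HH [fun F => F x] e) as (H' & (t & Ht) & _ & Hd); [|easy|].
      * constructor; [|constructor]; split; [easy|].
        exists 1; intros F B _ HB; rewrite Rmult_1_l; apply HB.
      * inversion Hd as [|? ? Hx]; rewrite Ht, Cmod_minus_sym in Hx; exact Hx.
  - apply (is_lim_ext (fun _ => 0)); [|apply is_lim_const].
    intros T; rewrite (RInt_ext _ (fun _ => 0)).
    + rewrite RInt_const; unfold scal; simpl; unfold mult; simpl; ring.
    + intros; apply Cmod_0.
Qed.

Lemma null_weakly_ap_zero : null_weakly_ap mzero.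
Proof.
  split; [|split].
  - split.
    + intros; unfold mzero; ring.
    + intros K; exists 0; intros; unfold mzero; rewrite Cmod_0; lra.
  - exists 0; intros; unfold mzero; rewrite Cmod_0; lra.
  - intros g _; apply null_wap_zero.
Qed.

Lemma comb_eberlein h mu : window h -> comb h mu -> eberlein_decomposition mu mu mzero.
Proof.
  intros Hw H; split; [now apply (comb_strongly_ap h)|split; [apply null_weakly_ap_zero|]].
  intros g _; unfold madd, mzero; ring.
Qed.

(** * Bohr almost periodic functions and vanishing means *)

Lemma bohr_ap_unif F : bohr_ap F -> forall eps, 0 < eps -> exists d, 0 < d /\
  forall x y, Rabs (x - y) < d -> Cmod (Cminus (F x) (F y)) < eps.
Proof.
  intros [Hc Hp] eps He.
  destruct (Hp (eps / 3)) as (L & HL & Hper); [lra|].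
  destruct (continuous_unif F (-1) (L + 1) Hc (eps / 3)) as (d & Hd & Hu); [lra|].
  exists (Rmin d 1); split; [apply Rmin_glb_lt; lra|]; intros x y Hxy.
  assert (H1 := Rmin_l d 1); assert (H2 := Rmin_r d 1).
  (* This almost period moves [x] into [[0, L]] and [y] into [[-1, L + 1]], where continuity is
     uniform. *)
  destruct (Hper (- x)) as (t & Ht & Htp).
  assert (Hxy' : Rabs (x - y) < 1) by lra; apply Rabs_def2 in Hxy'.
  specialize (Hu (x + t) (y + t) ltac:(lra) ltac:(lra)).
  replace (x + t - (y + t)) with (x - y) in Hu by ring; specialize (Hu ltac:(lra)).
  assert (T1 := Cmod_minus_triangle (F x) (F (x + t)) (F y)).
  assert (T2 := Cmod_minus_triangle (F (x + t)) (F (y + t)) (F y)).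
  rewrite (Cmod_minus_sym (F x) (F (x + t))) in T1.
  generalize (Htp x) (Htp y); lra.
Qed.

Lemma period_diff F e t s :
  (forall y, Cmod (Cminus (F (y + t)) (F y)) < e) ->
  (forall y, Cmod (Cminus (F (y + s)) (F y)) < e) ->
  forall y, Cmod (Cminus (F (y + (t - s))) (F y)) < 2 * e.
Proof.
  intros Ht Hs y.
  assert (T := Cmod_minus_triangle (F (y + (t - s))) (F (y - s)) (F y)).
  specialize (Ht (y - s)); specialize (Hs (y - s)).
  replace (y - s + t) with (y + (t - s)) in Ht by ring.
  replace (y - s + s) with y in Hs by ring.
  rewrite (Cmod_minus_sym (F y) (F (y - s))) in Hs; lra.
Qed.

(* Pigeonhole on the difference of an almost period of [F] and one of [G]. *)
Lemma bohr_ap_common F G : bohr_ap F -> bohr_ap G -> forall eps, 0 < eps ->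
  exists L, 0 < L /\ forall x, exists t, x <= t <= x + L /\
    forall y, Cmod (Cminus (F (y + t)) (F y)) < eps /\ Cmod (Cminus (G (y + t)) (G y)) < eps.
Proof.
  intros HF HG eps He.
  destruct (proj2 HF (eps / 4)) as (LF & HLF & HpF); [lra|].
  destruct (proj2 HG (eps / 4)) as (LG & HLG & HpG); [lra|].
  destruct (bohr_ap_unif G HG (eps / 4)) as (d & Hd & Hu); [lra|].
  set (L0 := Rmax LF LG).
  assert (HL1 := Rmax_l LF LG : LF <= L0); assert (HL2 := Rmax_r LF LG : LG <= L0).
  set (per := fun (H : R -> C) t => forall y, Cmod (Cminus (H (y + t)) (H y)) < eps / 4).
  set (bin := fun (b : Z) t s => per F t /\ per G s /\ IZR b * d <= t - s < (IZR b + 1) * d).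
  (* One pair is chosen from each occupied bin. Only finitely many bins allow [|t - s| <= L0], so
     the chosen first entries have a common bound [B]. *)
  assert (Hfin : exists B, 0 <= B /\ forall b, Rabs (IZR b + 0) <= L0 / d + 1 ->
            (exists t s, bin b t s) -> exists t s, bin b t s /\ Rabs t <= B).
  { assert (H0 : 0 <= L0 / d + 1).
    { assert (0 < L0 / d) by (apply Rdiv_lt_0_compat; lra); lra. }
    destruct (bounded_sums_finite _ _ (bounded_sums_interval 0 _ H0)) as (A & _ & HA).
    assert (exists B, 0 <= B /\ forall b, In b A ->
      (exists t s, bin b t s) -> exists t s, bin b t s /\ Rabs t <= B) as (B & HB & H).
    { clear; induction A as [|b A (B & HB & IH)].
      - exists 0; split; [lra|easy].
      - destruct (excluded_middle_informative (exists t s, bin b t s)) as [(t & s & Hts)|Hn].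
        + exists (Rmax B (Rabs t)); split.
          { eapply Rle_trans; [exact HB|apply Rmax_l]. }
          { intros b' [<-|Hb'] Hex.
            - exists t, s; split; [easy|apply Rmax_r].
            - destruct (IH b' Hb' Hex) as (t' & s' & H1 & H2); exists t', s'; split; [easy|].
              eapply Rle_trans; [exact H2|apply Rmax_l]. }
        + exists B; split; [easy|]; intros b' [<-|Hb'] Hex; [easy|auto]. }
    exists B; split; [easy|]; intros b Hb; apply H, HA, Hb. }
  destruct Hfin as (B & HB & Hfin).
  exists (L0 + 2 * B); split; [lra|]; intros x.
  (* Both periods come from an interval of length [L0], which bounds their difference. Subtracting a
     representative [t'] with [|t'| <= B] then lands in [[x, x + L0 + 2 * B]]. *)
  destruct (HpF (x + B)) as (t & Ht & Htp), (HpG (x + B)) as (s & Hs & Hsp).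
  set (b := (up ((t - s) / d) - 1)%Z).
  assert (Hb : bin b t s).
  { split; [easy|split; [easy|]].
    unfold b; rewrite minus_IZR; destruct (archimed ((t - s) / d)) as [K1 K2].
    assert (E : t - s = (t - s) / d * d) by (field; lra).
    set (r := (t - s) / d) in *; rewrite E; split; nra. }
  destruct (Hfin b) as (t' & s' & (Ht' & Hs' & Hb') & HtB).
  { destruct Hb as (_ & _ & Hb); rewrite Rplus_0_r.
    assert (E : L0 = L0 / d * d) by (field; lra).
    set (r := L0 / d) in *; apply Rabs_le.
    assert (- r < IZR b + 1) by (apply Rmult_lt_reg_r with d; lra).
    assert (IZR b <= r) by (apply Rmult_le_reg_r with d; lra). lra. }
  { eauto. }
  exists (t - t'); split; [apply Rabs_le_between in HtB; lra|].
  intros y; split.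
  - eapply Rlt_trans; [apply period_diff with (e := eps / 4); easy|lra].
  - assert (P := period_diff G (eps / 4) s s' Hsp Hs' y).
    destruct Hb as (_ & _ & Hb).
    (* Pairs in the same bin make [t - t'] and [s - s'] differ by less than [d], so uniform
       continuity of [G] replaces the latter by the former. *)
    specialize (Hu (y + (t - t')) (y + (s - s'))).
    replace (y + (t - t') - (y + (s - s'))) with (t - s - (t' - s')) in Hu by ring.
    specialize (Hu ltac:(apply Rabs_def1; lra)).
    assert (T := Cmod_minus_triangle (G (y + (t - t'))) (G (y + (s - s'))) (G y)); lra.
Qed.

Lemma RInt_lower (f : R -> R) a b c d e : (forall x, continuous f x) -> (forall x, 0 <= f x) ->
  a <= b -> b <= c -> c <= d -> (forall x, b <= x <= c -> e <= f x) -> (c - b) * e <= RInt f a d.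
Proof.
  intros Hc Hp Hab Hbc Hcd He.
  assert (Hi : forall u v, ex_RInt f u v).
  { intros; apply ex_RInt_cont, Hc. }
  rewrite <- (RInt_Chasles f a b d), <- (RInt_Chasles f b c d) by easy.
  unfold plus; simpl.
  assert (0 <= RInt f a b) by (apply RInt_ge_0; auto).
  assert (0 <= RInt f c d) by (apply RInt_ge_0; auto).
  assert ((c - b) * e <= RInt f b c); [|lra].
  replace ((c - b) * e) with (RInt (fun _ => e) b c).
  - apply RInt_le; auto; [apply ex_RInt_const|intros; apply He; lra].
  - rewrite RInt_const; reflexivity.
Qed.

(** A nonzero value of [D] creates a bump of positive height and width, which common almost periods
    of [F] and [G] repeat with bounded gaps; this keeps the mean of [|D|] away from zero. *)
Lemma bohr_ap_mean_zero F G D : bohr_ap F -> bohr_ap G ->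
  (forall x, D x = Cminus (F x) (G x)) ->
  is_lim (fun T => / (2 * T) * RInt (fun x => Cmod (D x)) (- T) T) p_infty 0 ->
  forall x, D x = RtoC 0.
Proof.
  intros HF HG HD Hlim x0; apply NNPP; intros Hn; apply Cmod_gt_0 in Hn.
  (* One third of [|D x0|] pays for the almost period, one for the width of the bump, and one is
     left as its height. *)
  set (e := Cmod (D x0) / 3) in *.
  assert (He : 0 < e) by (unfold e; lra).
  destruct (bohr_ap_common F G HF HG (e / 2)) as (L & HL & Hper); [lra|].
  destruct (bohr_ap_unif F HF (e / 2)) as (d1 & Hd1 & Hu1); [lra|].
  destruct (bohr_ap_unif G HG (e / 2)) as (d2 & Hd2 & Hu2); [lra|].
  set (d := Rmin d1 d2 / 2).
  assert (Hd : 0 < d) by (unfold d; assert (0 < Rmin d1 d2) by (apply Rmin_glb_lt; lra); lra).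
  assert (Hdd1 : d < d1) by (unfold d in *; generalize (Rmin_l d1 d2); lra).
  assert (Hdd2 : d < d2) by (unfold d in *; generalize (Rmin_r d1 d2); lra).
  assert (Hdiff : forall x y, Cmod (Cminus (F x) (F y)) < e / 2 -> Cmod (Cminus (G x) (G y)) < e / 2 ->
            Cmod (D y) <= Cmod (D x) + e).
  { intros x y H1 H2; assert (T := Cmod_le_minus (D y) (D x)).
    replace (Cminus (D x) (D y)) with (Cplus (Cminus (F x) (F y)) (Copp (Cminus (G x) (G y)))) in T
      by (rewrite !HD; ring).
    assert (T' := Cmod_triangle (Cminus (F x) (F y)) (Copp (Cminus (G x) (G y)))).
    rewrite Cmod_opp in T'; lra. }
  assert (Hc : forall x, continuous (fun x => Cmod (D x)) x).
  { intros x; apply continuous_Cmod.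
    apply (continuous_ext (fun x => Cminus (F x) (G x))); [easy|].
    apply continuous_Cminus; [apply HF|apply HG]. }
  set (W := L + 2 * d).
  assert (HW : forall y, 2 * d * e <= RInt (fun x => Cmod (D x)) y (y + W)).
  { intros y; destruct (Hper (y - x0 + d)) as (t & Ht & Htp).
    replace (2 * d * e) with ((x0 + t + d - (x0 + t - d)) * e) by ring.
    apply RInt_lower; auto; unfold W; try lra; [intros; apply Cmod_ge_0|].
    intros x Hx.
    assert (K1 : Cmod (D (x - t)) <= Cmod (D x) + e).
    { destruct (Htp (x - t)) as [P1 P2]; replace (x - t + t) with x in P1, P2 by ring.
      now apply Hdiff. }
    assert (K2 : Cmod (D x0) <= Cmod (D (x - t)) + e).
    { assert (Rabs (x - t - x0) <= d) by (apply Rabs_le; lra).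
      apply Hdiff; [apply Hu1|apply Hu2]; lra. }
    unfold e in *; lra. }
  assert (Hi : forall u v, ex_RInt (fun x => Cmod (D x)) u v).
  { intros; apply ex_RInt_cont, Hc. }
  assert (HWp : 0 < W) by (unfold W; lra).
  (* [[- n W, n W]] consists of [2 * n] intervals of length [W], each contributing at least
     [2 * d * e]; the mean is thus at least [2 * d * e / W]. *)
  assert (Hn' : forall n, INR n * (4 * d * e) <= RInt (fun x => Cmod (D x)) (- (INR n * W)) (INR n * W)).
  { induction n as [|n IH].
    - simpl INR; rewrite !Rmult_0_l, Ropp_0, RInt_point; apply Rle_refl.
    - rewrite S_INR.
      rewrite <- (RInt_Chasles _ _ (- (INR n * W))), <- (RInt_Chasles _ (- (INR n * W)) (INR n * W)) by easy.
      unfold plus; simpl.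
      assert (K1 := HW (- ((INR n + 1) * W))); assert (K2 := HW (INR n * W)).
      replace (- ((INR n + 1) * W) + W) with (- (INR n * W)) in K1 by ring.
      replace (INR n * W + W) with ((INR n + 1) * W) in K2 by ring.
      lra. }
  assert (Hpos : 0 < 2 * d * e / W) by (apply Rdiv_lt_0_compat; nra).
  apply is_lim_spec in Hlim; destruct (Hlim (mkposreal _ Hpos)) as [M HM]; simpl in HM.
  destruct (INR_unbounded (Rabs M / W + 1)) as [n Hn1].
  assert (HMp := Rabs_pos M).
  assert (Hq : 0 <= Rabs M / W) by (apply Rmult_le_pos; [easy|apply Rinv_nonneg; easy]).
  assert (HnW : M < INR n * W).
  { apply Rle_lt_trans with (Rabs M); [apply Rle_abs|].
    replace (Rabs M) with (Rabs M / W * W) by (field; lra); apply Rmult_lt_compat_r; lra. }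
  specialize (HM _ HnW); specialize (Hn' n).
  set (I := RInt _ _ _) in *; rewrite Rminus_0_r in HM.
  apply Rabs_def2 in HM; destruct HM as [HM _].
  assert (Hnp : 0 < INR n) by lra.
  assert (INR n * (4 * d * e) * / (2 * (INR n * W)) <= / (2 * (INR n * W)) * I).
  { rewrite (Rmult_comm _ I); apply Rmult_le_compat_r; [|easy].
    apply Rinv_nonneg; nra. }
  replace (INR n * (4 * d * e) * / (2 * (INR n * W))) with (2 * d * e / W) in H by (field; lra).
  lra.
Qed.

Lemma comb_null_part h mu mu_s mu_0 : window h -> comb h mu ->
  eberlein_decomposition mu mu_s mu_0 -> meas_eq mu_0 mzero.
Proof.
  intros Hw H (Hs & H0 & E) g Hg.
  set (g' := fun y => g (0 - y)).
  assert (Hg' : Cc g') by now apply Cc_reflect.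
  replace (mu_0 g) with (fconv g' mu_0 0).
  - apply (bohr_ap_mean_zero (fconv g' mu) (fconv g' mu_s)).
    + now apply (comb_bohr_ap h).
    + now apply Hs.
    + intros x; unfold fconv; rewrite (E _ (Cc_reflect g' x Hg')); unfold madd; ring.
    + now apply H0.
  - unfold fconv, g'; f_equal; apply functional_extensionality; intros y; f_equal; ring.
Qed.

(** * Complex integrals and the Fejer kernel *)

Definition cint (f : R -> C) (a b : R) : C := RInt (V := C_R_CompleteNormedModule) f a b.

Definition cont (f : R -> C) : Prop := forall x, continuous f x.

Lemma cint_ex f a b : cont f -> ex_RInt (V := C_R_NormedModule) f a b.
Proof. intros H; apply (ex_RInt_continuous (V := C_R_CompleteNormedModule)); intros; apply H. Qed.

Lemma cint_is f a b : cont f -> is_RInt (V := C_R_NormedModule) f a b (cint f a b).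
Proof. intros H; apply (RInt_correct (V := C_R_CompleteNormedModule)), cint_ex, H. Qed.

Lemma cint_unique f a b l : is_RInt (V := C_R_NormedModule) f a b l -> cint f a b = l.
Proof. apply (is_RInt_unique (V := C_R_CompleteNormedModule)). Qed.

Lemma cint_ext f g a b : (forall x, f x = g x) -> cint f a b = cint g a b.
Proof. intros H; f_equal; now apply functional_extensionality. Qed.

Lemma cint_plus f g a b : cont f -> cont g ->
  cint (fun t => Cplus (f t) (g t)) a b = Cplus (cint f a b) (cint g a b).
Proof.
  intros Hf Hg; apply cint_unique.
  apply (is_RInt_plus (V := C_R_NormedModule)); now apply cint_is.
Qed.

Lemma cint_minus f g a b : cont f -> cont g ->
  cint (fun t => Cminus (f t) (g t)) a b = Cminus (cint f a b) (cint g a b).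
Proof.
  intros Hf Hg; apply cint_unique.
  apply (is_RInt_minus (V := C_R_NormedModule)); now apply cint_is.
Qed.

(** [C] is integrated as a real normed module, so a complex factor is moved out by components. *)
Lemma cint_scal c f a b : cont f ->
  cint (fun t => Cmult c (f t)) a b = Cmult c (cint f a b).
Proof.
  intros Hf; apply cint_unique.
  assert (H := cint_is f a b Hf).
  assert (H1 := is_RInt_fct_extend_fst (U := R_NormedModule) (V := R_NormedModule) _ _ _ _ H).
  assert (H2 := is_RInt_fct_extend_snd (U := R_NormedModule) (V := R_NormedModule) _ _ _ _ H).
  apply (is_RInt_fct_extend_pair (U := R_NormedModule) (V := R_NormedModule)
          (fun t => Cmult c (f t)) a b (fst (Cmult c (cint f a b))) (snd (Cmult c (cint f a b)))).
  - apply (is_RInt_minus (V := R_NormedModule)).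
    + apply (is_RInt_scal (V := R_NormedModule) _ _ _ (fst c) _ H1).
    + apply (is_RInt_scal (V := R_NormedModule) _ _ _ (snd c) _ H2).
  - apply (is_RInt_plus (V := R_NormedModule)).
    + apply (is_RInt_scal (V := R_NormedModule) _ _ _ (fst c) _ H2).
    + apply (is_RInt_scal (V := R_NormedModule) _ _ _ (snd c) _ H1).
Qed.

Lemma is_RInt_zero a b : is_RInt (V := C_R_NormedModule) (fun _ => RtoC 0) a b (RtoC 0).
Proof.
  assert (H := is_RInt_const (V := C_R_NormedModule) a b (RtoC 0)).
  replace (scal (b - a) (RtoC 0 : C_R_NormedModule)) with (RtoC 0) in H; [exact H|].
  symmetry; apply (scal_zero_r (V := C_R_NormedModule)).
Qed.

Lemma is_RInt_const_eq (a b c l : R) : (b - a) * c = l -> is_RInt (fun _ => c) a b l.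
Proof. intros <-; apply (is_RInt_const (V := R_NormedModule)). Qed.

Lemma is_RInt_eq (f : R -> R) (a b l l' : R) : is_RInt f a b l -> l = l' -> is_RInt f a b l'.
Proof. now intros H <-. Qed.

Lemma cont_const c : cont (fun _ => c).
Proof. intros x; apply continuous_const. Qed.

Lemma cont_minus f g : cont f -> cont g -> cont (fun t => Cminus (f t) (g t)).
Proof. intros Hf Hg x; now apply continuous_Cminus. Qed.

Lemma cont_mult f g : cont f -> cont g -> cont (fun t => Cmult (f t) (g t)).
Proof. intros Hf Hg x; now apply continuous_Cmult. Qed.

Lemma cont_RtoC f : (forall x, continuous f x) -> cont (fun t => RtoC (f t)).
Proof. intros Hf x; now apply continuous_RtoC. Qed.

Lemma cont_lin f u v : cont f -> cont (fun t => f (u * t + v)).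
Proof. intros Hf x; apply (continuous_comp (fun t => u * t + v) f); [apply continuous_lin|apply Hf]. Qed.

Lemma cont_csum {I} (f : I -> R -> C) A : (forall i, cont (f i)) -> cont (fun t => csum (fun i => f i t) A).
Proof. intros H x; apply continuous_csum; intros; apply H. Qed.

Lemma cint_csum {I} (f : I -> R -> C) A a b : (forall i, cont (f i)) ->
  cint (fun t => csum (fun i => f i t) A) a b = csum (fun i => cint (f i) a b) A.
Proof.
  intros H; induction A as [|i A IH]; simpl.
  - apply cint_unique, is_RInt_zero.
  - rewrite cint_plus; [now rewrite IH|apply H|now apply (cont_csum f)].
Qed.

Lemma cint_le f (g : R -> R) a b : cont f -> (forall x, continuous g x) -> a <= b ->
  (forall x, a <= x <= b -> Cmod (f x) <= g x) -> Cmod (cint f a b) <= RInt g a b.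
Proof.
  intros Hf Hg Hab H; rewrite Cmod_norm.
  apply (norm_RInt_le (V := C_R_NormedModule) f g a b); auto.
  - intros x Hx; specialize (H x Hx); rewrite Cmod_norm in H; exact H.
  - now apply cint_is.
  - apply (RInt_correct (V := R_CompleteNormedModule)), ex_RInt_cont, Hg.
Qed.

Lemma cint_bound f a b M : cont f -> a <= b ->
  (forall x, a <= x <= b -> Cmod (f x) <= M) -> Cmod (cint f a b) <= (b - a) * M.
Proof.
  intros Hf Hab H.
  replace ((b - a) * M) with (RInt (fun _ => M) a b) by (rewrite RInt_const; reflexivity).
  apply cint_le; auto; intros; apply continuous_const.
Qed.

Lemma cint_Chasles f a b c : cont f -> Cplus (cint f a b) (cint f b c) = cint f a c.
Proof. intros H; apply (RInt_Chasles (V := C_R_CompleteNormedModule)); now apply cint_ex. Qed.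

Lemma cint_zero f a b : a <= b -> (forall x, a < x < b -> f x = RtoC 0) -> cint f a b = RtoC 0.
Proof.
  intros Hab H; apply cint_unique.
  apply (is_RInt_ext (V := C_R_NormedModule) (fun _ => RtoC 0)).
  - intros x Hx; rewrite Rmin_left, Rmax_right in Hx by easy; symmetry; auto.
  - apply is_RInt_zero.
Qed.

Lemma cint_support f a b a' b' : cont f -> a' <= a -> b <= b' ->
  (forall x, x < a \/ b < x -> f x = RtoC 0) -> cint f a' b' = cint f a b.
Proof.
  intros Hf Ha Hb H0.
  rewrite <- (cint_Chasles f a' a b'), <- (cint_Chasles f a b b') by easy.
  rewrite (cint_zero f a' a), (cint_zero f b b'); auto.
  - ring.
  - intros x Hx; apply H0; lra.
  - intros x Hx; apply H0; lra.
Qed.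

Lemma scal_C (r : R) (z : C) : scal r (z : C_R_NormedModule) = Cmult (RtoC r) z.
Proof.
  destruct z as [x y]; unfold scal; simpl; unfold prod_scal, Cmult, RtoC, scal; simpl.
  unfold mult; simpl; f_equal; ring.
Qed.

Lemma cint_comp_lin f u v a b : cont f ->
  Cmult (RtoC u) (cint (fun t => f (u * t + v)) a b) = cint f (u * a + v) (u * b + v).
Proof.
  intros Hf; rewrite <- cint_scal by now apply cont_lin.
  apply cint_unique.
  apply (is_RInt_ext (V := C_R_NormedModule) (fun t => scal u (f (u * t + v)))).
  - intros; apply scal_C.
  - apply (is_RInt_comp_lin (V := C_R_NormedModule)), cint_is, Hf.
Qed.

Lemma cint_RtoC f a b : (forall x, continuous f x) ->
  cint (fun t => RtoC (f t)) a b = RtoC (RInt f a b).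
Proof.
  intros Hf; apply cint_unique.
  apply (is_RInt_fct_extend_pair (U := R_NormedModule) (V := R_NormedModule)
          (fun t => RtoC (f t)) a b (RInt f a b) 0).
  - apply (RInt_correct (V := R_CompleteNormedModule)), ex_RInt_cont, Hf.
  - apply (is_RInt_const_eq a b 0 0); ring.
Qed.

(** The finite set that controls the tail of the majorant [c] works for all [x] at once, so the
    convergence under the integral is uniform. *)
Lemma has_sum_cint {I} (f : I -> R -> C) (F : R -> C) (c : I -> R) M a b :
  (forall i, cont (f i)) -> cont F -> a <= b ->
  (forall i x, a <= x <= b -> Cmod (f i x) <= c i) -> bounded_sums c M ->
  (forall x, a <= x <= b -> has_sum (fun i => f i x) (F x)) ->
  has_sum (fun i => cint (f i) a b) (cint F a b).
Proof.
  intros Hf HF Hab Hc HM Hs eps He.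
  destruct (bounded_sums_tail c M HM (eps / (b - a + 1))) as (A & HA & Htail).
  { apply Rdiv_lt_0_compat; lra. }
  exists A; intros B HB Hincl.
  rewrite <- cint_csum by easy.
  rewrite <- (cint_minus (fun t => csum (fun i => f i t) B)) by (try apply cont_csum; easy).
  apply Rle_lt_trans with ((b - a) * (eps / (b - a + 1))).
  - apply cint_bound; [|easy|].
    + apply cont_minus; [now apply cont_csum|easy].
    + intros x Hx.
      rewrite Cmod_minus_sym.
      apply (has_sum_approx (fun i => f i x) (fun i => c i) (F x) B); auto.
      intros D HD HDB; apply Htail; [easy|]; intros i Hi HiA; apply (HDB i Hi), Hincl, HiA.
  - apply Rmult_lt_reg_r with (b - a + 1); [lra|].
    field_simplify; [|lra]; nra.
Qed.

(** * Characters, Dirichlet and Fejer kernels *)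

Definition e1 (x : R) : C := (cos (2 * PI * x), sin (2 * PI * x)).

Lemma e1_plus x y : e1 (x + y) = Cmult (e1 x) (e1 y).
Proof.
  unfold e1, Cmult; simpl; rewrite Rmult_plus_distr_l, cos_plus, sin_plus; f_equal; ring.
Qed.

Lemma Cmod_e1 x : Cmod (e1 x) = 1.
Proof.
  unfold e1, Cmod; simpl.
  rewrite !Rmult_1_r, Rplus_comm.
  fold (Rsqr (sin (2 * PI * x))) (Rsqr (cos (2 * PI * x))); rewrite sin2_cos2; apply sqrt_1.
Qed.

Lemma cos_sin_INR (n : nat) (x : R) : cos (x + 2 * PI * INR n) = cos x /\ sin (x + 2 * PI * INR n) = sin x.
Proof.
  replace (x + 2 * PI * INR n) with (x + 2 * INR n * PI) by ring.
  split; [apply cos_period|apply sin_period].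
Qed.

Lemma e1_period (n : Z) x : e1 (x + IZR n) = e1 x.
Proof.
  unfold e1; rewrite Rmult_plus_distr_l.
  destruct (Z.le_ge_cases 0 n) as [H|H].
  - rewrite <- (Z2Nat.id n H), <- INR_IZR_INZ.
    destruct (cos_sin_INR (Z.to_nat n) (2 * PI * x)) as [-> ->]; easy.
  - destruct (cos_sin_INR (Z.to_nat (- n)) (2 * PI * x + 2 * PI * IZR n)) as [E1 E2].
    rewrite INR_IZR_INZ, Z2Nat.id, opp_IZR in E1, E2 by lia.
    replace (2 * PI * x + 2 * PI * IZR n + 2 * PI * - IZR n) with (2 * PI * x) in E1, E2 by ring.
    now rewrite E1, E2.
Qed.

Lemma Rabs_sin_le x : Rabs (sin x) <= Rabs x.
Proof.
  assert (H : forall x, 0 <= x -> Rabs (sin x) <= x).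
  { intros y Hy; destruct (Req_dec y 0) as [->|Hn]; [rewrite sin_0, Rabs_R0; lra|].
    assert (K := sin_lt_x y ltac:(lra)).
    destruct (Rle_dec y 1).
    - rewrite Rabs_pos_eq; [lra|]; apply sin_ge_0; generalize PI2_3_2; lra.
    - generalize (SIN_bound y); intros; apply Rabs_le; lra. }
  unfold Rabs at 2; destruct Rcase_abs; [|apply H; lra].
  rewrite <- Rabs_Ropp, <- sin_neg; apply H; lra.
Qed.

Lemma Cmod_le_sum (z : C) : Cmod z <= Rabs (fst z) + Rabs (snd z).
Proof.
  replace z with (Cplus (RtoC (fst z)) (Cmult Ci (RtoC (snd z)))) at 1.
  - eapply Rle_trans; [apply Cmod_triangle|].
    rewrite Cmod_mult, Cmod_Ci, !Cmod_R; lra.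
  - destruct z; unfold Cplus, Cmult, Ci, RtoC; simpl; f_equal; ring.
Qed.

(** Bounding the modulus by the sum of both components doubles the sharp constant [2 * PI]. *)
Lemma e1_lip x y : Cmod (Cminus (e1 x) (e1 y)) <= 4 * PI * Rabs (x - y).
Proof.
  assert (HP : 0 < PI) by apply PI_RGT_0.
  assert (HS : forall a, Rabs (sin (PI * (x - y))) * Rabs a <= PI * Rabs (x - y) * Rabs a).
  { intros a; apply Rmult_le_compat_r; [apply Rabs_pos|].
    eapply Rle_trans; [apply Rabs_sin_le|]; rewrite Rabs_mult, (Rabs_pos_eq PI); lra. }
  eapply Rle_trans; [apply Cmod_le_sum|]; unfold e1; simpl.
  rewrite <- !Rminus_def, form2, form4.
  replace ((2 * PI * x - 2 * PI * y) / 2) with (PI * (x - y)) by field.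
  rewrite !Rabs_mult, ?Rabs_Ropp, (Rabs_left (-2)), ?(Rabs_pos_eq 2), ?Ropp_involutive by lra.
  assert (H1 := HS (sin ((2 * PI * x + 2 * PI * y) / 2))).
  assert (H2 := HS (cos ((2 * PI * x + 2 * PI * y) / 2))).
  assert (B1 : Rabs (sin ((2 * PI * x + 2 * PI * y) / 2)) <= 1) by (apply Rabs_le; apply SIN_bound).
  assert (B2 : Rabs (cos ((2 * PI * x + 2 * PI * y) / 2)) <= 1) by (apply Rabs_le; apply COS_bound).
  assert (0 <= PI * Rabs (x - y)) by (apply Rmult_le_pos; [lra|apply Rabs_pos]).
  set (u := Rabs (sin (_ / 2))) in *; set (v := Rabs (cos _)) in *; set (p := PI * Rabs (x - y)) in *.
  assert (p * u <= p) by nra; assert (p * v <= p) by nra.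
  unfold p in *; lra.
Qed.

Lemma cont_e1 : cont e1.
Proof.
  intros x; apply continuous_eps; intros eps He.
  assert (HP : 0 < PI) by apply PI_RGT_0.
  exists (eps / (4 * PI)); split; [apply Rdiv_lt_0_compat; lra|]; intros y Hy.
  eapply Rle_lt_trans; [apply e1_lip|].
  apply (Rmult_lt_compat_l (4 * PI)) in Hy; [|lra].
  replace (4 * PI * (eps / (4 * PI))) with eps in Hy by (field; lra); lra.
Qed.

Lemma cont_e1_lin u : cont (fun t => e1 (- (u * t))).
Proof.
  replace (fun t => e1 (- (u * t))) with (fun t => e1 (- u * t + 0)).
  - apply cont_lin, cont_e1.
  - apply functional_extensionality; intros; f_equal; ring.
Qed.

Fixpoint dirichlet (n : nat) (t : R) : R :=
  match n with
  | O => 1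
  | S m => dirichlet m t + 2 * cos (2 * PI * (INR n * t))
  end.

(* [N] times the Fejer kernel of order [N]. *)
Fixpoint fejer (N : nat) (t : R) : R :=
  match N with
  | O => 0
  | S M => fejer M t + dirichlet M t
  end.

Lemma dirichlet_sin n t : dirichlet n t * sin (PI * t) = sin ((2 * INR n + 1) * (PI * t)).
Proof.
  induction n as [|n IH].
  - simpl; rewrite Rmult_1_l; f_equal; ring.
  - cbn [dirichlet]; rewrite Rmult_plus_distr_r, IH, S_INR.
    set (x := PI * t).
    replace (2 * PI * ((INR n + 1) * t)) with (2 * (INR n + 1) * x) by (unfold x; ring).
    replace ((2 * (INR n + 1) + 1) * x) with (2 * (INR n + 1) * x + x) by ring.
    replace ((2 * INR n + 1) * x) with (2 * (INR n + 1) * x - x) by ring.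
    rewrite sin_plus, sin_minus; ring.
Qed.

Lemma fejer_sin N t : fejer N t * (sin (PI * t))² = (sin (INR N * (PI * t)))².
Proof.
  induction N as [|N IH].
  - simpl; rewrite !Rmult_0_l, sin_0, Rsqr_0; ring.
  - cbn [fejer]; rewrite Rmult_plus_distr_r, IH.
    replace (dirichlet N t * (sin (PI * t))²) with (dirichlet N t * sin (PI * t) * sin (PI * t))
      by (unfold Rsqr; ring).
    rewrite dirichlet_sin, S_INR.
    set (x := PI * t); set (b := INR N * x).
    replace ((INR N + 1) * x) with (b + x) by (unfold b; ring).
    replace ((2 * INR N + 1) * x) with (b + (b + x)) by (unfold b; ring).
    replace x with (b + x - b) at 2 by ring.
    (* What remains amounts to [sin a ^ 2 - sin b ^ 2 = sin (a + b) * sin (a - b)]. *)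
    set (a := b + x).
    rewrite sin_plus, sin_minus.
    generalize (sin2_cos2 a) (sin2_cos2 b); unfold Rsqr; intros Ha Hb.
    replace (cos a * cos a) with (1 - sin a * sin a) by lra.
    transitivity (sin b * sin b + sin a * sin a * (cos b * cos b) - sin b * sin b * (cos a * cos a)); [ring|].
    replace (cos a * cos a) with (1 - sin a * sin a) by lra.
    replace (cos b * cos b) with (1 - sin b * sin b) by lra.
    ring.
Qed.

(** Where [sin (PI * t)] is nonzero the closed form is a quotient of squares; at its zeros every
    cosine in the kernel equals 1. *)
Lemma fejer_pos N t : 0 <= fejer N t.
Proof.
  destruct (Req_dec (sin (PI * t)) 0) as [H0|H0].
  - assert (Hs : forall n, sin (INR n * (PI * t)) = 0).
    { induction n as [|n IH]; [simpl; rewrite Rmult_0_l; apply sin_0|].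
      rewrite S_INR, Rmult_plus_distr_r, Rmult_1_l, sin_plus, IH, H0; ring. }
    assert (Hd : forall n, 0 <= dirichlet n t).
    { induction n as [|n IH]; [simpl; lra|].
      cbn [dirichlet].
      replace (2 * PI * (INR (S n) * t)) with (2 * (INR (S n) * (PI * t))) by ring.
      rewrite cos_2a_sin, Hs; lra. }
    induction N as [|N IH]; cbn [fejer]; [lra|]; specialize (Hd N); lra.
  - assert (H := fejer_sin N t).
    assert (Hp := Rsqr_pos_lt _ H0).
    apply Rmult_le_reg_r with ((sin (PI * t))²); [easy|].
    rewrite H, Rmult_0_l; apply Rle_0_sqr.
Qed.

Lemma fejer_small d N t : 0 < d -> d <= Rabs t <= / 2 -> fejer N t <= / (sin (PI * d))².
Proof.
  intros Hd Ht; assert (HP : 0 < PI) by apply PI_RGT_0.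
  assert (Hs0 : 0 < sin (PI * d)) by (apply sin_gt_0; nra).
  assert (Hs1 : sin (PI * d) <= sin (PI * Rabs t)) by (apply sin_incr_1; nra).
  assert (Hs2 : (sin (PI * d))² <= (sin (PI * t))²).
  { replace ((sin (PI * t))²) with ((sin (PI * Rabs t))²).
    - apply Rsqr_incr_1; lra.
    - unfold Rabs; destruct Rcase_abs; [|easy].
      replace (PI * - t) with (- (PI * t)) by ring; rewrite sin_neg; symmetry; apply Rsqr_neg. }
  assert (Hp : 0 < (sin (PI * d))²) by (apply Rsqr_pos_lt; lra).
  assert (H := fejer_sin N t).
  apply Rmult_le_reg_r with ((sin (PI * d))²); [easy|].
  rewrite Rinv_l by lra.
  apply Rle_trans with (fejer N t * (sin (PI * t))²).
  - apply Rmult_le_compat_l; [apply fejer_pos|easy].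
  - rewrite H, <- Rsqr_1; apply neg_pos_Rsqr_le; apply SIN_bound.
Qed.

Lemma dirichlet_period n (q : Z) t : dirichlet n (t + IZR q) = dirichlet n t.
Proof.
  induction n as [|n IH]; [easy|]; cbn [dirichlet]; rewrite IH; do 2 f_equal.
  assert (H := f_equal fst (e1_period (Z.of_nat (S n) * q) (INR (S n) * t))).
  unfold e1 in H; cbn [fst] in H; rewrite <- H; f_equal.
  rewrite mult_IZR, <- INR_IZR_INZ; ring.
Qed.

Lemma fejer_period N (q : Z) t : fejer N (t + IZR q) = fejer N t.
Proof. induction N as [|N IH]; [easy|]; cbn [fejer]; now rewrite IH, dirichlet_period. Qed.

Lemma fejer_even N t : fejer N (- t) = fejer N t.
Proof.
  assert (H : forall n, dirichlet n (- t) = dirichlet n t).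
  { induction n as [|n IH]; [easy|]; cbn [dirichlet]; rewrite IH; do 2 f_equal.
    rewrite <- cos_neg; f_equal; ring. }
  induction N as [|N IH]; [easy|]; cbn [fejer]; now rewrite IH, H.
Qed.

Lemma dirichlet_continuous n x : continuous (dirichlet n) x.
Proof.
  induction n as [|n IH]; [apply continuous_const|].
  apply (continuous_plus (dirichlet n) (fun t => 2 * cos (2 * PI * (INR (S n) * t)))); [easy|].
  apply ex_derive_cont; auto_derive; easy.
Qed.

Lemma fejer_continuous N x : continuous (fejer N) x.
Proof.
  induction N as [|N IH]; [apply continuous_const|].
  apply (continuous_plus (fejer N) (dirichlet N)); [easy|apply dirichlet_continuous].
Qed.

Lemma dirichlet_RInt n x : is_RInt (dirichlet n) x (x + 1) 1.
Proof.
  induction n as [|n IH].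
  - apply (is_RInt_const_eq x (x + 1) 1 1); ring.
  - enough (H : is_RInt (fun t => 2 * cos (2 * PI * (INR (S n) * t))) x (x + 1) 0).
    { assert (K := is_RInt_plus (V := R_NormedModule) _ _ _ _ _ _ IH H).
      apply (is_RInt_eq _ _ _ _ _ K), Rplus_0_r. }
    assert (HP : 0 < PI) by apply PI_RGT_0.
    assert (Hn : 0 < INR (S n)) by (apply lt_0_INR; lia).
    set (m := INR (S n)) in *.
    set (G := fun t => sin (2 * PI * (m * t)) / (PI * m)).
    apply (is_RInt_eq _ _ _ (G (x + 1) - G x)).
    + apply (is_RInt_derive (V := R_CompleteNormedModule)).
      * intros t _; unfold G; auto_derive; [easy|field; lra].
      * intros t _; apply ex_derive_cont; auto_derive; easy.
    + unfold G.
      assert (E := f_equal snd (e1_period (Z.of_nat (S n)) (m * x))); unfold e1 in E; cbn [snd] in E.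
      rewrite <- INR_IZR_INZ in E; fold m in E.
      replace (m * (x + 1)) with (m * x + m) by ring; rewrite E; ring.
Qed.

Lemma fejer_RInt N x : is_RInt (fejer N) x (x + 1) (INR N).
Proof.
  induction N as [|N IH].
  - apply (is_RInt_const_eq x (x + 1) 0 (INR 0)); simpl; ring.
  - rewrite S_INR; apply (is_RInt_plus (V := R_NormedModule)); [exact IH|apply dirichlet_RInt].
Qed.

Lemma RInt_scal_eq (f : R -> R) c a b : (forall x, continuous f x) ->
  RInt (fun t => c * f t) a b = c * RInt f a b.
Proof.
  intros Hf; apply (RInt_scal (V := R_CompleteNormedModule) f).
  apply ex_RInt_cont, Hf.
Qed.

(** Normalised to integral 1 over a period; order [S N] rules out a division by zero. *)
Definition fejer_mean (N : nat) (t : R) : R := fejer (S N) t / INR (S N).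

Lemma fejer_mean_pos N t : 0 <= fejer_mean N t.
Proof.
  apply Rmult_le_pos; [apply fejer_pos|apply Rinv_nonneg, lt_0_INR; lia].
Qed.

Lemma fejer_mean_continuous N x : continuous (fejer_mean N) x.
Proof.
  apply (continuous_ext (fun t => / INR (S N) * fejer (S N) t)); [intros; apply Rmult_comm|].
  apply (continuous_scal_r (/ INR (S N)) (fejer (S N))), fejer_continuous.
Qed.

Lemma cont_fejer_mult N f : cont f -> cont (fun t => Cmult (RtoC (fejer_mean N t)) (f t)).
Proof. intros Hf; apply cont_mult; [apply cont_RtoC, fejer_mean_continuous|easy]. Qed.

Lemma fejer_mean_RInt N x : RInt (fejer_mean N) x (x + 1) = 1.
Proof.
  apply is_RInt_unique.
  assert (Hn : 0 < INR (S N)) by (apply lt_0_INR; lia).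
  assert (H := is_RInt_scal (V := R_NormedModule) _ _ _ (/ INR (S N)) _ (fejer_RInt (S N) x)).
  apply (is_RInt_eq _ _ _ (/ INR (S N) * INR (S N))); [|apply Rinv_l; lra].
  revert H; apply is_RInt_ext; intros; apply Rmult_comm.
Qed.

Lemma fejer_mean_RInt_le N a n : RInt (fejer_mean N) a (a + INR n) <= INR n.
Proof.
  assert (Hi : forall u v, ex_RInt (fejer_mean N) u v).
  { intros; apply ex_RInt_cont, fejer_mean_continuous. }
  induction n as [|n IH].
  - simpl INR; rewrite Rplus_0_r, RInt_point; apply Rle_refl.
  - rewrite S_INR, <- (RInt_Chasles _ a (a + INR n)) by easy.
    replace (a + (INR n + 1)) with (a + INR n + 1) by ring.
    rewrite fejer_mean_RInt; unfold plus; simpl; lra.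
Qed.

Lemma cvg_unique u l l' : cvg u l -> cvg u l' -> l = l'.
Proof.
  intros H H'; apply Cmod_minus_eq; intros eps He.
  destruct (H (eps / 2)) as [N HN]; [lra|]; destruct (H' (eps / 2)) as [N' HN']; [lra|].
  specialize (HN (N + N')%nat ltac:(lia)); specialize (HN' (N + N')%nat ltac:(lia)).
  assert (T := Cmod_minus_triangle l (u (N + N')%nat) l').
  rewrite (Cmod_minus_sym l (u _)) in T; lra.
Qed.

Lemma cvg_ext u v l : (forall n, u n = v n) -> cvg u l -> cvg v l.
Proof. intros H; now replace v with u by now apply functional_extensionality. Qed.

Lemma fejer_cvg_zero g : cont g ->
  cvg (fun N => cint (fun t => Cmult (RtoC (fejer_mean N t)) (g t)) (- / 2) (/ 2)) (g 0).
Proof.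
  intros Hg eps He.
  destruct (continuous_bounded g (- / 2) (/ 2) Hg) as (B & HB & HgB).
  destruct (continuous_unif g (- / 2) (/ 2) Hg (eps / 2)) as (d' & Hd' & Hu); [lra|].
  set (d := Rmin d' (/ 2) / 2).
  assert (Hd0 : 0 < Rmin d' (/ 2)) by (apply Rmin_glb_lt; lra).
  assert (Hd : 0 < d) by (unfold d; lra).
  assert (Hdd' : d < d') by (unfold d; generalize (Rmin_l d' (/ 2)); lra).
  assert (Hd2 : d < / 2) by (unfold d; generalize (Rmin_r d' (/ 2)); lra).
  assert (HP : 0 < PI) by apply PI_RGT_0.
  set (s := / (sin (PI * d))²).
  assert (Hs : 0 < s).
  { apply Rinv_0_lt_compat, Rsqr_pos_lt, Rgt_not_eq, sin_gt_0; nra. }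
  (* From [N0] on, the contribution [2 * B * s / S N] from outside [|t| < d] is below [eps / 2]. *)
  destruct (inv_INR_small (eps / 2 / (2 * B * s + 1))) as [N0 HN0].
  { apply Rdiv_lt_0_compat; [lra|]; assert (0 < B * s) by nra; lra. }
  exists N0; intros N HN; specialize (HN0 N HN).
  assert (HNp : 0 < INR (S N)) by (apply lt_0_INR; lia).
  assert (Hck : cont (fun t => RtoC (fejer_mean N t))) by (apply cont_RtoC; intros; apply fejer_mean_continuous).
  assert (Hone : RInt (fejer_mean N) (- / 2) (/ 2) = 1).
  { replace (/ 2) with (- / 2 + 1) at 2 by field; apply fejer_mean_RInt. }
  replace (Cminus _ _) with
    (cint (fun t => Cmult (RtoC (fejer_mean N t)) (Cminus (g t) (g 0))) (- / 2) (/ 2)).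
  2: { rewrite (cint_ext _ (fun t => Cminus (Cmult (RtoC (fejer_mean N t)) (g t))
                                     (Cmult (g 0) (RtoC (fejer_mean N t))))) by (intros; ring).
       rewrite cint_minus, cint_scal, cint_RtoC, Hone; auto.
       - ring.
       - apply fejer_mean_continuous.
       - now apply cont_mult.
       - now apply cont_mult; [apply cont_const|]. }
  (* Near 0 continuity of [g] gives the first term of the majorant; elsewhere the kernel is at most
     [s / S N] and [g] varies by at most [2 * B], which gives the second. Their sum is valid
     everywhere, so the integral need not be split. *)
  apply Rle_lt_trans with (RInt (fun t => eps / 2 * fejer_mean N t + 2 * B * (s * / INR (S N))) (- / 2) (/ 2)).
  - apply cint_le.
    + apply cont_mult; [easy|]; apply cont_minus; [easy|apply cont_const].
    + intros x; apply (continuous_plus (fun t => eps / 2 * fejer_mean N t) (fun _ => 2 * B * (s * / INR (S N)))).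
      2: apply continuous_const.
      apply (continuous_scal_r (eps / 2) (fejer_mean N)), fejer_mean_continuous.
    + lra.
    + intros x Hx; rewrite Cmod_mult, Cmod_R, Rabs_pos_eq by apply fejer_mean_pos.
      assert (Hfp := fejer_mean_pos N x).
      assert (Hss : 0 < s * / INR (S N)) by (apply Rmult_lt_0_compat; [easy|now apply Rinv_0_lt_compat]).
      destruct (Rlt_dec (Rabs x) d) as [Hxd|Hxd].
      * specialize (Hu x 0 Hx ltac:(lra)); rewrite Rminus_0_r in Hu; specialize (Hu ltac:(lra)).
        assert (fejer_mean N x * Cmod (Cminus (g x) (g 0)) <= fejer_mean N x * (eps / 2))
          by (apply Rmult_le_compat_l; lra).
        assert (0 < 2 * B * (s * / INR (S N))) by (apply Rmult_lt_0_compat; lra).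
        lra.
      * assert (Hx2 : Rabs x <= / 2) by (apply Rabs_le; lra).
        assert (Hfs := fejer_small d (S N) x Hd ltac:(lra)).
        assert (Hf1 : fejer_mean N x <= s * / INR (S N)).
        { apply Rmult_le_compat_r; [now apply Rinv_nonneg|exact Hfs]. }
        assert (Hg1 : Cmod (Cminus (g x) (g 0)) <= 2 * B).
        { eapply Rle_trans; [apply Cmod_triangle|]; rewrite Cmod_opp.
          generalize (HgB x Hx) (HgB 0 ltac:(lra)); lra. }
        assert (fejer_mean N x * Cmod (Cminus (g x) (g 0)) <= (s * / INR (S N)) * (2 * B)).
        { apply Rmult_le_compat; [easy|apply Cmod_ge_0|easy|easy]. }
        assert (0 <= eps / 2 * fejer_mean N x) by (apply Rmult_le_pos; lra).
        lra.
  - rewrite (is_RInt_unique _ _ _ (eps / 2 + 2 * B * (s * / INR (S N)))).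
    + apply (Rmult_lt_compat_l (2 * B * s + 1)) in HN0; [|assert (0 < B * s) by nra; lra].
      replace ((2 * B * s + 1) * (eps / 2 / (2 * B * s + 1))) with (eps / 2) in HN0
        by (field; assert (0 < B * s) by nra; lra).
      assert (0 < / INR (S N)) by now apply Rinv_0_lt_compat.
      assert (2 * B * (s * / INR (S N)) < eps / 2); [|lra].
      replace (2 * B * (s * / INR (S N))) with (2 * B * s * / INR (S N)) by ring; lra.
    + assert (H1 : is_RInt (fejer_mean N) (- / 2) (/ 2) 1).
      { rewrite <- Hone; apply (RInt_correct (V := R_CompleteNormedModule)).
        apply ex_RInt_cont, fejer_mean_continuous. }
      eapply is_RInt_eq; [apply (is_RInt_plus (V := R_NormedModule))|].
      * apply (is_RInt_scal (V := R_NormedModule) _ _ _ (eps / 2) _ H1).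
      * apply (is_RInt_const_eq _ _ _ (2 * B * (s * / INR (S N)))); field; lra.
      * unfold plus, scal; simpl; unfold mult; simpl; ring.
Qed.

(** Grows by [n] and [- n] together, like [dirichlet] and like the symmetric intervals of
    [fejer_cvg_zrange]. *)
Fixpoint zrange (n : nat) : list Z :=
  match n with
  | O => [0%Z]
  | S m => Z.of_nat n :: (- Z.of_nat n)%Z :: zrange m
  end.

Lemma zrange_In n z : In z (zrange n) <-> (Z.abs z <= Z.of_nat n)%Z.
Proof.
  induction n as [|n IH]; cbn [zrange In].
  - lia.
  - rewrite IH; lia.
Qed.

Lemma zrange_NoDup n : NoDup (zrange n).
Proof.
  induction n as [|n IH]; cbn [zrange].
  - constructor; [easy|constructor].
  - constructor; [|constructor; [|easy]].
    + cbn [In]; rewrite zrange_In; lia.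
    + rewrite zrange_In; lia.
Qed.

(** Frequency [n] occurs in the Dirichlet kernels of order [|n|] to [N], which are [S N - |n|] many;
    truncated subtraction gives 0 beyond that range. *)
Lemma fejer_csum N t :
  RtoC (fejer_mean N t) =
  csum (fun n => Cmult (RtoC (INR (S N - Z.abs_nat n) / INR (S N))) (e1 (IZR n * t))) (zrange N).
Proof.
  assert (Hd : forall n, RtoC (dirichlet n t) = csum (fun m => e1 (IZR m * t)) (zrange n)).
  { induction n as [|n IH].
    - simpl; unfold e1; rewrite !Rmult_0_l, Rmult_0_r, cos_0, sin_0.
      unfold RtoC, Cplus; simpl; f_equal; ring.
    - cbn [zrange csum fold_right dirichlet]; fold (csum (fun m => e1 (IZR m * t)) (zrange n)).
      rewrite RtoC_plus, IH, opp_IZR, <- INR_IZR_INZ; unfold e1 at 2 3.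
      replace (2 * PI * (- INR (S n) * t)) with (- (2 * PI * (INR (S n) * t))) by ring.
      rewrite cos_neg, sin_neg.
      set (w := csum _ _); destruct w as [w1 w2].
      unfold RtoC, Cplus; cbn [fst snd]; f_equal; ring. }
  (* Written as a sum over all of [Z], since the range of frequencies grows during the induction. *)
  assert (Hf : forall N, has_sum (fun n => Cmult (RtoC (INR (N - Z.abs_nat n))) (e1 (IZR n * t))) (RtoC (fejer N t))).
  { clear N; induction N as [|N IH].
    - simpl fejer; eapply has_sum_ext; [|apply has_sum_zero]; intros i; simpl; ring.
    - cbn [fejer]; rewrite RtoC_plus, Hd.
      assert (K : has_sum (fun n => Cmult (RtoC (indic (Z.abs n <= Z.of_nat N)%Z)) (e1 (IZR n * t)))
                     (csum (fun m => e1 (IZR m * t)) (zrange N))).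
      { erewrite (csum_ext (fun m => e1 (IZR m * t))).
        - apply has_sum_finite; [apply zrange_NoDup|].
          intros i Hi; rewrite zrange_In in Hi; rewrite indic_false by easy; ring.
        - intros i Hi; rewrite zrange_In in Hi; rewrite indic_true by easy; ring. }
      eapply has_sum_ext; [|apply (has_sum_plus _ _ _ _ IH K)].
      intros i; cbv beta; rewrite <- Cmult_plus_distr_r, <- RtoC_plus; do 2 f_equal.
      unfold indic; destruct excluded_middle_informative as [H|H].
      + replace (S N - Z.abs_nat i)%nat with (S (N - Z.abs_nat i)) by lia; now rewrite S_INR.
      + replace (S N - Z.abs_nat i)%nat with (N - Z.abs_nat i)%nat by lia; ring. }
  apply (has_sum_unique (fun n => Cmult (RtoC (INR (S N - Z.abs_nat n) / INR (S N))) (e1 (IZR n * t)))).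
  - assert (K := has_sum_scal (RtoC (/ INR (S N))) _ _ (Hf (S N))).
    unfold fejer_mean, Rdiv; rewrite RtoC_mult, Cmult_comm.
    revert K; apply has_sum_ext; intros i; rewrite RtoC_mult; ring.
  - apply has_sum_finite; [apply zrange_NoDup|]; intros i Hi; rewrite zrange_In in Hi.
    replace (S N - Z.abs_nat i)%nat with 0%nat by lia.
    unfold Rdiv; simpl INR at 1; rewrite Rmult_0_l; ring.
Qed.

Lemma fejer_weight_bounds N n : 0 <= INR (S N - Z.abs_nat n) / INR (S N) <= 1.
Proof.
  assert (HN : 0 < INR (S N)) by (apply lt_0_INR; lia).
  split.
  - apply Rmult_le_pos; [apply pos_INR|now apply Rinv_nonneg].
  - apply Rmult_le_reg_r with (INR (S N)); [easy|].
    unfold Rdiv; rewrite Rmult_assoc, Rinv_l, Rmult_1_l, Rmult_1_r by lra.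
    apply le_INR; lia.
Qed.

Lemma fejer_weight_cvg n (z : C) :
  cvg (fun N => Cmult (RtoC (INR (S N - Z.abs_nat n) / INR (S N))) z) z.
Proof.
  set (a := INR (Z.abs_nat n)).
  assert (Ha : 0 <= a) by apply pos_INR.
  assert (H : cvg (fun N => RtoC (INR (S N - Z.abs_nat n) / INR (S N))) (RtoC 1)).
  { intros eps He.
    destruct (inv_INR_small (eps / (a + 1))) as [N0 HN0]; [apply Rdiv_lt_0_compat; lra|].
    exists (N0 + Z.abs_nat n)%nat; intros N HN; specialize (HN0 N ltac:(lia)).
    assert (HNp : 0 < INR (S N)) by (apply lt_0_INR; lia).
    assert (Hi := Rinv_0_lt_compat _ HNp).
    rewrite minus_INR by lia; fold a; rewrite <- RtoC_minus, Cmod_R.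
    replace ((INR (S N) - a) / INR (S N) - 1) with (- (a * / INR (S N))) by (field; lra).
    rewrite Rabs_Ropp, Rabs_pos_eq by (apply Rmult_le_pos; lra).
    apply (Rmult_lt_compat_l (a + 1)) in HN0; [|lra].
    replace ((a + 1) * (eps / (a + 1))) with eps in HN0 by (field; lra); lra. }
  apply (cvg_scal z) in H; rewrite Cmult_1_r in H.
  revert H; apply cvg_ext; intros; apply Cmult_comm.
Qed.

Lemma cvg_plus u v l m : cvg u l -> cvg v m -> cvg (fun n => Cplus (u n) (v n)) (Cplus l m).
Proof.
  intros Hu Hv eps He.
  destruct (Hu (eps / 2)) as [N HN]; [lra|]; destruct (Hv (eps / 2)) as [N' HN']; [lra|].
  exists (N + N')%nat; intros n Hn; specialize (HN n ltac:(lia)); specialize (HN' n ltac:(lia)).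
  replace (Cminus _ _) with (Cplus (Cminus (u n) l) (Cminus (v n) m)) by ring.
  eapply Rle_lt_trans; [apply Cmod_triangle|lra].
Qed.

Lemma fejer_cvg_unit g (q : Z) : cont g ->
  cvg (fun N => cint (fun t => Cmult (RtoC (fejer_mean N t)) (g t)) (IZR q - / 2) (IZR q + / 2)) (g (IZR q)).
Proof.
  intros Hg.
  assert (H := fejer_cvg_zero (fun t => g (1 * t + IZR q)) (cont_lin g 1 (IZR q) Hg)).
  cbv beta in H; replace (1 * 0 + IZR q) with (IZR q) in H by ring.
  revert H; apply cvg_ext; intros N.
  assert (E := cint_comp_lin (fun t => Cmult (RtoC (fejer_mean N t)) (g t)) 1 (IZR q) (- / 2) (/ 2)).
  replace (1 * - / 2 + IZR q) with (IZR q - / 2) in E by ring.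
  replace (1 * / 2 + IZR q) with (IZR q + / 2) in E by ring.
  rewrite <- E.
  - rewrite Cmult_1_l; apply cint_ext; intros t; do 2 f_equal.
    unfold fejer_mean; rewrite Rmult_1_l, fejer_period; easy.
  - now apply cont_fejer_mult.
Qed.

(** The interval is cut into unit intervals centred at the integers; on each the kernel, by
    periodicity, acts as it does at 0. *)
Lemma fejer_cvg_zrange g (M : nat) : cont g ->
  cvg (fun N => cint (fun t => Cmult (RtoC (fejer_mean N t)) (g t)) (- (INR M + / 2)) (INR M + / 2))
      (csum (fun q => g (IZR q)) (zrange M)).
Proof.
  intros Hg.
  assert (Hc : forall N, cont (fun t => Cmult (RtoC (fejer_mean N t)) (g t))).
  { intros N; now apply cont_fejer_mult. }
  induction M as [|M IH].
  - simpl; replace (Cplus (g 0) (RtoC 0)) with (g 0) by ring.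
    assert (H := fejer_cvg_zero g Hg); revert H; apply cvg_ext; intros N; f_equal; ring.
  - cbn [zrange csum fold_right]; fold (csum (fun q => g (IZR q)) (zrange M)).
    assert (H := cvg_plus _ _ _ _ (fejer_cvg_unit g (Z.of_nat (S M)) Hg)
             (cvg_plus _ _ _ _ (fejer_cvg_unit g (- Z.of_nat (S M)) Hg) IH)).
    revert H; apply cvg_ext; intros N; cbv beta.
    rewrite opp_IZR, <- INR_IZR_INZ, S_INR.
    rewrite <- (cint_Chasles _ (- (INR M + 1 + / 2)) (INR M + / 2)) by easy.
    rewrite <- (cint_Chasles _ (- (INR M + 1 + / 2)) (- (INR M + / 2)) (INR M + / 2)) by easy.
    replace (INR M + 1 - / 2) with (INR M + / 2) by field.
    replace (- (INR M + 1) - / 2) with (- (INR M + 1 + / 2)) by field.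
    replace (- (INR M + 1) + / 2) with (- (INR M + / 2)) by field.
    ring.
Qed.

(** The kernel in [c * k - d] concentrates at the points [(q + d) / c], and the substitution
    [t = c * k - d] contributes the factor [/ c]. *)
Lemma fejer_cvg psi A c d v : Cc psi -> (forall x, A < Rabs x -> psi x = RtoC 0) -> 0 <= A -> 0 < c ->
  has_sum (fun q => psi ((IZR q + d) / c)) v ->
  cvg (fun N => cint (fun k => Cmult (RtoC (fejer_mean N (c * k - d))) (psi k)) (- A) A)
      (Cmult (RtoC (/ c)) v).
Proof.
  intros [Hpsi _] Hsup HA Hc Hv.
  set (g := fun t => psi (/ c * t + d / c)).
  assert (Hg : cont g) by (apply cont_lin; exact Hpsi).
  destruct (INR_unbounded (c * A + Rabs d)) as [M HM].
  assert (Hgz : forall t, INR M < Rabs t -> g t = RtoC 0).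
  { intros t Ht; apply Hsup.
    replace (/ c * t + d / c) with ((t + d) * / c) by (field; lra).
    rewrite Rabs_mult, (Rabs_pos_eq (/ c)) by now apply Rinv_nonneg.
    apply Rmult_lt_reg_r with c; [easy|]; rewrite Rmult_assoc, Rinv_l, Rmult_1_r by lra.
    assert (T := Rabs_triang_inv t (- d)); rewrite Rabs_Ropp in T.
    replace (t - - d) with (t + d) in T by ring; lra. }
  assert (Ev : csum (fun q => g (IZR q)) (zrange M) = v).
  { apply (has_sum_unique (fun q => g (IZR q))).
    - apply has_sum_finite; [apply zrange_NoDup|]; intros q Hq; rewrite zrange_In in Hq.
      apply Hgz; rewrite <- abs_IZR, INR_IZR_INZ; apply IZR_lt; lia.
    - revert Hv; apply has_sum_ext; intros q; unfold g; f_equal; field; lra. }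
  assert (H := fejer_cvg_zrange g M Hg); rewrite Ev in H.
  assert (K := cvg_scal (RtoC (/ c)) _ _ H).
  revert K; apply cvg_ext; intros N.
  set (F := fun t => Cmult (RtoC (fejer_mean N t)) (g t)).
  assert (HF : cont F).
  { now apply cont_fejer_mult. }
  set (a := (- (INR M + / 2) + d) / c); set (b := (INR M + / 2 + d) / c).
  assert (E := cint_comp_lin F c (- d) a b HF).
  replace (c * a + - d) with (- (INR M + / 2)) in E by (unfold a; field; lra).
  replace (c * b + - d) with (INR M + / 2) in E by (unfold b; field; lra).
  rewrite <- E, Cmult_assoc, <- RtoC_mult, Rinv_l, Cmult_1_l by lra.
  rewrite (cint_ext _ (fun k => Cmult (RtoC (fejer_mean N (c * k - d))) (psi k))).
  2: { intros t; unfold F, g; do 2 f_equal; field; lra. }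
  assert (Hdb := Rabs_le_between d (Rabs d)); destruct Hdb as [Hdb _]; specialize (Hdb (Rle_refl _)).
  assert (HcA : c * A = A * c) by ring.
  (* The substituted interval contains [[-A, A]], by the choice of [M], and [psi] vanishes outside
     the latter. *)
  apply cint_support.
  - apply cont_mult; [|exact Hpsi].
    apply (cont_lin (fun t => RtoC (fejer_mean N t)) c (- d)), cont_RtoC; intros; apply fejer_mean_continuous.
  - apply Rmult_le_reg_r with c; [easy|]; unfold a, Rdiv; rewrite Rmult_assoc, Rinv_l by lra; lra.
  - apply Rmult_le_reg_r with c; [easy|]; unfold b, Rdiv; rewrite Rmult_assoc, Rinv_l by lra; lra.
  - intros x Hx; rewrite Hsup; [ring|].
    unfold Rabs; destruct Rcase_abs; lra.
Qed.

(** The argument of the kernel runs through an interval covered by [n] periods of mass 1 each. As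
    [M] depends on neither [N] nor [d], this supplies the majorant for the limit in [poisson]. *)
Lemma fejer_uniform_bound c A : 0 < c -> 0 <= A -> exists M, 0 <= M /\ forall N d psi B, cont psi -> 0 <= B ->
  (forall k, - A <= k <= A -> Cmod (psi k) <= B) ->
  Cmod (cint (fun k => Cmult (RtoC (fejer_mean N (c * k - d))) (psi k)) (- A) A) <= M * B.
Proof.
  intros Hc HA; destruct (INR_unbounded (2 * c * A)) as [n Hn].
  exists (/ c * INR n); split.
  { apply Rmult_le_pos; [now apply Rinv_nonneg|apply pos_INR]. }
  intros N d psi B Hpsi HB0 HB.
  assert (Hcf : forall x, continuous (fun k => fejer_mean N (c * k - d)) x).
  { intros x; apply (continuous_comp (fun k => c * k - d) (fejer_mean N)).
    - apply (continuous_lin c (- d)).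
    - apply fejer_mean_continuous. }
  assert (Hi : forall u v, ex_RInt (fejer_mean N) u v).
  { intros; apply ex_RInt_cont, fejer_mean_continuous. }
  eapply Rle_trans; [apply (cint_le _ (fun k => B * fejer_mean N (c * k - d)))|].
  - apply cont_mult; [apply cont_RtoC, Hcf|easy].
  - intros x; now apply (continuous_scal_r B (fun k => fejer_mean N (c * k - d))).
  - lra.
  - intros k Hk; rewrite Cmod_mult, Cmod_R, Rabs_pos_eq, Rmult_comm by apply fejer_mean_pos.
    apply Rmult_le_compat_r; [apply fejer_mean_pos|auto].
  - rewrite RInt_scal_eq by easy.
    assert (E : c * RInt (fun k => fejer_mean N (c * k - d)) (- A) A = RInt (fejer_mean N) (c * - A + - d) (c * A + - d)).
    { rewrite <- (RInt_comp_lin (fejer_mean N) c (- d) (- A) A) by apply Hi.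
      symmetry; apply (RInt_scal_eq (fun k => fejer_mean N (c * k - d))), Hcf. }
    assert (K := fejer_mean_RInt_le N (c * - A + - d) n).
    rewrite <- (RInt_Chasles _ _ (c * A + - d)) in K by apply Hi.
    assert (0 <= RInt (fejer_mean N) (c * A + - d) (c * - A + - d + INR n)).
    { apply RInt_ge_0; [lra|apply Hi|intros; apply fejer_mean_pos]. }
    unfold plus in K; simpl in K.
    set (I := RInt (fun k => fejer_mean N (c * k - d)) (- A) A) in *.
    assert (HI : I <= / c * INR n).
    { apply Rmult_le_reg_l with c; [easy|]; rewrite <- Rmult_assoc, Rinv_r, Rmult_1_l by lra; lra. }
    rewrite (Rmult_comm (/ c * INR n)); apply Rmult_le_compat_l; lra.
Qed.

(** * Poisson summation and the Fourier transform *)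

Lemma cint_fst f a b : cont f -> fst (cint f a b) = RInt (fun t => fst (f t)) a b.
Proof.
  intros Hf; symmetry; apply is_RInt_unique.
  apply (is_RInt_fct_extend_fst (U := R_NormedModule) (V := R_NormedModule)), cint_is, Hf.
Qed.

Lemma cint_snd f a b : cont f -> snd (cint f a b) = RInt (fun t => snd (f t)) a b.
Proof.
  intros Hf; symmetry; apply is_RInt_unique.
  apply (is_RInt_fct_extend_snd (U := R_NormedModule) (V := R_NormedModule)), cint_is, Hf.
Qed.

Lemma continuous_cos_lin w x : continuous (fun t => cos (w * t)) x.
Proof. apply ex_derive_cont; auto_derive; easy. Qed.

(** The Fourier transform of [u] if its support lies in [[-A, A]]; the bounded interval keeps the
    integrals proper. *)
Definition osc (u : R -> C) (A y : R) : C := cint (fun t => Cmult (u t) (e1 (- (y * t)))) (- A) A.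

Lemma cont_osc_kernel u y : cont u -> cont (fun t => Cmult (u t) (e1 (- (y * t)))).
Proof. intros Hu; apply cont_mult; [easy|apply cont_e1_lin]. Qed.

Lemma osc_continuous u A : cont u -> 0 <= A -> cont (osc u A).
Proof.
  intros Hu HA x; apply continuous_eps; intros eps He.
  destruct (continuous_bounded u (- A) A Hu) as (B & HB & HuB).
  assert (HP : 0 < PI) by apply PI_RGT_0.
  set (L := 2 * A * (B * (4 * PI * A)) + 1).
  assert (HL : 0 < L).
  { unfold L; assert (0 <= A * (B * (PI * A))); [|lra].
    apply Rmult_le_pos; [lra|apply Rmult_le_pos; [lra|apply Rmult_le_pos; lra]]. }
  exists (eps / L); split; [now apply Rdiv_lt_0_compat|]; intros y Hy.
  unfold osc; rewrite <- cint_minus by now apply cont_osc_kernel.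
  apply Rle_lt_trans with ((A - - A) * (B * (4 * PI * (Rabs (y - x) * A)))).
  - apply cint_bound; [|lra|].
    + apply cont_minus; now apply cont_osc_kernel.
    + intros t Ht.
      replace (Cminus _ _) with (Cmult (u t) (Cminus (e1 (- (y * t))) (e1 (- (x * t))))) by ring.
      rewrite Cmod_mult; apply Rmult_le_compat; try apply Cmod_ge_0; [auto|].
      eapply Rle_trans; [apply e1_lip|]; apply Rmult_le_compat_l; [lra|].
      replace (- (y * t) - - (x * t)) with (- ((y - x) * t)) by ring.
      rewrite Rabs_Ropp, Rabs_mult; apply Rmult_le_compat_l; [apply Rabs_pos|].
      now apply Rabs_le.
  - apply (Rmult_lt_compat_l L) in Hy; [|easy].
    replace (L * (eps / L)) with eps in Hy by (field; lra).
    assert (Hp := Rabs_pos (y - x)).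
    replace ((A - - A) * (B * (4 * PI * (Rabs (y - x) * A))))
      with ((2 * A * (B * (4 * PI * A))) * Rabs (y - x)) by ring.
    unfold L in Hy; lra.
Qed.

Lemma osc_real_bound (u : R -> R) A y (w := 2 * PI * y) : (forall x, continuous u x) ->
  Cmod (osc (fun t => RtoC (u t)) A y) <=
    Rabs (RInt (fun t => u t * cos (w * t)) (- A) A) + Rabs (RInt (fun t => u t * - sin (w * t)) (- A) A).
Proof.
  intros Hu; eapply Rle_trans; [apply Cmod_le_sum|].
  assert (Hk := cont_osc_kernel _ y (cont_RtoC u Hu)).
  unfold osc; rewrite cint_fst, cint_snd by easy.
  right; do 4 f_equal; apply functional_extensionality; intros t; unfold e1, w; simpl;
    replace (2 * PI * - (y * t)) with (- (2 * PI * y * t)) by ring;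
    rewrite ?cos_neg, ?sin_neg; ring.
Qed.

Lemma osc_bound u A : cont u -> 0 <= A -> exists M, 0 <= M /\ forall y, Cmod (osc u A y) <= M.
Proof.
  intros Hu HA; destruct (continuous_bounded u (- A) A Hu) as (B & HB & HuB).
  exists ((A - - A) * B); split; [nra|]; intros y.
  apply cint_bound; [now apply cont_osc_kernel|lra|].
  intros t Ht; rewrite Cmod_mult, Cmod_e1, Rmult_1_r; auto.
Qed.

(** * Quadratic decay of Fourier integrals *)

Definition decays (F : R -> C) : Prop :=
  exists K, 0 <= K /\ forall x, Cmod (F x) <= K * / (1 + x * x).

Lemma decays_intro F M K : 0 <= M -> 0 <= K -> (forall x, Cmod (F x) <= M) ->
  (forall x, x <> 0 -> Cmod (F x) <= K / (x * x)) -> decays F.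
Proof.
  intros HM HK H1 H2; exists (M + K); split; [lra|]; intros x.
  assert (Hp : 0 < 1 + x * x) by nra.
  apply Rmult_le_reg_r with (1 + x * x); [easy|].
  rewrite Rmult_assoc, Rinv_l, Rmult_1_r by lra.
  specialize (H1 x); assert (H0 := Cmod_ge_0 (F x)).
  destruct (Req_dec x 0) as [->|Hx]; [lra|].
  specialize (H2 x Hx).
  assert (Hxx : 0 < x * x) by nra.
  apply (Rmult_le_compat_r (x * x)) in H2; [|lra].
  unfold Rdiv in H2; rewrite Rmult_assoc, Rinv_l, Rmult_1_r in H2 by lra; lra.
Qed.

(** Integration by parts on either side of the kink. In the result only [2 * k2 e] depends on [e]
    other than affinely. *)
Lemma is_RInt_abs (k k1 k2 : R -> R) (e : R) : (forall t, continuous k t) ->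
  (forall t, is_derive k1 t (k t)) -> (forall t, is_derive k2 t (k1 t)) -> -2 <= e <= 2 ->
  is_RInt (fun t => Rabs (t - e) * k t) (-2) 2
    ((2 - e) * k1 2 - k2 2 - (2 + e) * k1 (-2) - k2 (-2) + 2 * k2 e).
Proof.
  intros Hk H1 H2 He.
  set (G := fun t => (t - e) * k1 t - k2 t).
  assert (HG : forall t, is_derive G t ((t - e) * k t)).
  { intros t; unfold G; evar_last.
    - apply (is_derive_minus (K := R_AbsRing) (V := R_NormedModule)); [|apply H2].
      apply (is_derive_mult (fun t => t - e) k1 t 1 (k t)); [auto_derive; [easy|ring]|apply H1|].
      intros; apply Rmult_comm.
    - unfold minus, plus, opp, mult; simpl; ring. }
  assert (Hc : forall t, continuous (fun t => (t - e) * k t) t).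
  { intros t; apply (continuous_mult (K := R_AbsRing) (fun t => t - e) k); [|apply Hk].
    apply (continuous_minus (fun t => t) (fun _ => e)); [apply continuous_id|apply continuous_const]. }
  assert (H : forall a b, is_RInt (fun t => (t - e) * k t) a b (G b - G a)).
  { intros a b; apply (is_RInt_derive (V := R_CompleteNormedModule)); auto. }
  assert (L : is_RInt (fun t => Rabs (t - e) * k t) (-2) e (- (G e - G (-2)))).
  { apply (is_RInt_ext (fun t => opp ((t - e) * k t))).
    - intros t Ht; rewrite Rmin_left, Rmax_right in Ht by lra.
      rewrite Rabs_left by lra; unfold opp; simpl; ring.
    - apply (is_RInt_opp (V := R_NormedModule)), H. }
  assert (U : is_RInt (fun t => Rabs (t - e) * k t) e 2 (G 2 - G e)).
  { apply (is_RInt_ext (fun t => (t - e) * k t)); [|apply H].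
    intros t Ht; rewrite Rmin_left, Rmax_right in Ht by lra.
    rewrite Rabs_pos_eq by lra; reflexivity. }
  apply (is_RInt_eq _ _ _ _ _ (is_RInt_Chasles (V := R_NormedModule) _ _ _ _ _ _ L U)).
  unfold plus, G; simpl; ring.
Qed.

Lemma window_continuous h : window h -> forall x, continuous h x.
Proof.
  intros [_ Hl] x P [eps HP].
  exists (mkposreal (eps / 2) ltac:(generalize (cond_pos eps); lra)); intros y Hy; apply HP.
  change (Rabs (h y - h x) < eps); change (Rabs (y - x) < eps / 2) in Hy.
  specialize (Hl y x); lra.
Qed.

Lemma window_Cc h : window h -> Cc (fun t => RtoC (h t)).
Proof.
  intros Hw; split; [apply cont_RtoC, window_continuous, Hw|].
  exists tau; intros x Hx; now rewrite (proj1 Hw).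
Qed.

(* The affine terms in the integrals of [|t - e|] against the kernel cancel in the
   second difference that defines [overlap]. *)
Lemma RInt_overlap_bound a b (k k1 k2 : R -> R) (B : R) : (forall t, continuous k t) ->
  (forall t, is_derive k1 t (k t)) -> (forall t, is_derive k2 t (k1 t)) ->
  (forall t, Rabs (k2 t) <= B) -> Rabs (RInt (fun t => overlap a b t * k t) (-2) 2) <= 4 * B.
Proof.
  intros Hk D1 D2 HB; generalize tau_bounds; intros Ht.
  assert (Hb : -2 <= wlo b - whi a <= 2 /\ -2 <= wlo b - wlo a <= 2 /\
    -2 <= whi b - whi a <= 2 /\ -2 <= whi b - wlo a <= 2) by (destruct a, b; simpl; lra).
  destruct Hb as (H1 & H2 & H3 & H4).
  apply (is_RInt_abs k k1 k2 _ Hk D1 D2) in H1, H2, H3, H4.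
  assert (K := is_RInt_scal (V := R_NormedModule) _ _ _ (/ (2 * tau)) _
    (is_RInt_plus (V := R_NormedModule) _ _ _ _ _ _
      (is_RInt_minus (V := R_NormedModule) _ _ _ _ _ _
        (is_RInt_minus (V := R_NormedModule) _ _ _ _ _ _ H1 H2) H3) H4)).
  match type of K with is_RInt ?f _ _ ?l => rewrite (is_RInt_unique _ _ _ l) end.
  2: { revert K; apply is_RInt_ext; intros t _.
       unfold scal, plus, minus, plus, opp; simpl; unfold mult, overlap; simpl; ring. }
  generalize (HB (wlo b - whi a)) (HB (wlo b - wlo a)) (HB (whi b - whi a)) (HB (whi b - wlo a)).
  unfold scal, plus, minus, plus, opp; simpl; unfold mult; simpl.
  set (p := k2 (wlo b - whi a)); set (q := k2 (wlo b - wlo a));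
  set (r := k2 (whi b - whi a)); set (s := k2 (whi b - wlo a)); intros K1 K2 K3 K4.
  match goal with |- Rabs ?x <= _ => replace x with (/ tau * (p - q - r + s)) by (field; lra) end.
  rewrite Rabs_mult, (Rabs_pos_eq (/ tau)) by (apply Rinv_nonneg; lra).
  assert (HS : Rabs (p - q - r + s) <= 4 * B).
  { apply Rabs_le_between in K1, K2, K3, K4; apply Rabs_le; lra. }
  generalize (Rabs_pos (p - q - r + s)) inv_tau; intros; nra.
Qed.

Lemma sqr_le_angular y : 3 < PI -> y * y <= 2 * PI * y * (2 * PI * y).
Proof.
  intros HP; assert (0 <= y * y) by nra.
  replace (2 * PI * y * (2 * PI * y)) with (4 * (PI * PI) * (y * y)) by ring.
  assert (1 <= 4 * (PI * PI)) by nra; nra.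
Qed.

(** The second antiderivatives of [cos (w * t)] and [sin (w * t)] have size [1 / (w * w)], which
    [RInt_overlap_bound] turns into decay of both components. *)
Lemma overlap_decays a b : decays (osc (fun t => RtoC (overlap a b t)) 2).
Proof.
  assert (Hc := proj1 (window_Cc _ (overlap_window a b))).
  destruct (osc_bound _ 2 Hc) as (M & HM0 & HM); [lra|].
  apply (decays_intro _ M 16); [easy|lra|easy|]; intros y Hy.
  assert (HP : 3 < PI) by (generalize PI2_3_2; lra).
  set (w := 2 * PI * y).
  assert (Hw : w <> 0) by (unfold w; apply Rmult_integral_contrapositive_currified; lra).
  assert (Hww : y * y <= w * w) by apply sqr_le_angular, HP.
  assert (Hyy : 0 < y * y) by nra.
  assert (Htb := tau_bounds).
  eapply Rle_trans; [apply osc_real_bound; now intros; apply window_continuous, overlap_window|].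
  replace (- (2)) with (-2) by ring; fold w.
  assert (Hww0 : w * w <> 0) by lra.
  assert (Hsmall : forall z, Rabs z <= 1 -> Rabs (- z / (w * w)) <= / (y * y)).
  { intros z Hz; unfold Rdiv; rewrite Rabs_mult, Rabs_Ropp, (Rabs_pos_eq (/ (w * w)))
      by (apply Rinv_nonneg; lra).
    rewrite <- (Rmult_1_l (/ (y * y))); apply Rmult_le_compat; try apply Rabs_pos; [|easy|].
    - apply Rinv_nonneg; lra.
    - apply Rinv_le_contravar; lra. }
  assert (B1 : Rabs (RInt (fun t => overlap a b t * cos (w * t)) (-2) 2) <= 4 * / (y * y)).
  { apply RInt_overlap_bound with (fun t => sin (w * t) / w) (fun t => - cos (w * t) / (w * w)).
    - apply continuous_cos_lin.
    - intros t; auto_derive; [easy|field; easy].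
    - intros t; auto_derive; [easy|field; easy].
    - intros t; apply Hsmall, Rabs_le, COS_bound. }
  assert (B2 : Rabs (RInt (fun t => overlap a b t * - sin (w * t)) (-2) 2) <= 4 * / (y * y)).
  { apply RInt_overlap_bound with (fun t => cos (w * t) / w) (fun t => - - sin (w * t) / (w * w)).
    - intros t; apply ex_derive_cont; auto_derive; easy.
    - intros t; auto_derive; [easy|field; easy].
    - intros t; auto_derive; [easy|field; easy].
    - intros t; apply Hsmall; rewrite Rabs_Ropp; apply Rabs_le, SIN_bound. }
  assert (0 < / (y * y)) by now apply Rinv_0_lt_compat.
  unfold Rdiv; lra.
Qed.

Lemma decays_shift F A : decays F -> exists K, 0 <= K /\
  forall k (p : Z), Rabs k <= A -> Cmod (F (k + IZR p)) <= K * / (1 + IZR p * IZR p).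
Proof.
  intros (K & HK & H); exists (K * (2 * (1 + A * A))); split; [nra|]; intros k p Hk.
  eapply Rle_trans; [apply H|]; rewrite Rmult_assoc; apply Rmult_le_compat_l; [easy|].
  set (x := IZR p); clearbody x; assert (HA : k * k <= A * A).
  { replace (k * k) with (Rabs k * Rabs k) by (unfold Rabs; destruct Rcase_abs; ring).
    generalize (Rabs_pos k); nra. }
  (* With [k^2 <= A^2], the square [(2 * k + x)^2 = 2 * k^2 + 2 * (k + x)^2 - x^2] yields [1 + x^2
     <= 2 * (1 + A^2) * (1 + (k + x)^2)]. *)
  assert (Hq := Rle_0_sqr (2 * k + x)); unfold Rsqr in Hq.
  assert (Hkx : 0 <= (k + x) * (k + x)) by apply Rle_0_sqr.
  assert (Hxx : 0 <= x * x) by apply Rle_0_sqr.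
  apply Rmult_le_reg_r with ((1 + (k + x) * (k + x)) * (1 + x * x)); [apply Rmult_lt_0_compat; lra|].
  replace (/ (1 + (k + x) * (k + x)) * ((1 + (k + x) * (k + x)) * (1 + x * x))) with (1 + x * x) by (field; lra).
  replace (2 * (1 + A * A) * / (1 + x * x) * ((1 + (k + x) * (k + x)) * (1 + x * x)))
    with (2 * (1 + A * A) * (1 + (k + x) * (k + x))) by (field; lra).
  assert (0 <= A * A * ((k + x) * (k + x))) by (apply Rmult_le_pos; [apply Rle_0_sqr|easy]).
  lra.
Qed.

Lemma fejer_mean_even N t : fejer_mean N (- t) = fejer_mean N t.
Proof. unfold fejer_mean; now rewrite fejer_even. Qed.

(** Evenness allows the kernel to be expanded at [d - c * k], which gives the characters the sign
    they have in [osc]. *)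
Lemma cint_fejer N c d psi a b : cont psi ->
  cint (fun k => Cmult (RtoC (fejer_mean N (c * k - d))) (psi k)) a b =
  csum (fun n => Cmult (RtoC (INR (S N - Z.abs_nat n) / INR (S N)))
     (Cmult (e1 (IZR n * d)) (cint (fun k => Cmult (psi k) (e1 (- (IZR n * c * k)))) a b))) (zrange N).
Proof.
  intros Hpsi.
  rewrite (cint_ext _ (fun k => csum (fun n =>
     Cmult (Cmult (RtoC (INR (S N - Z.abs_nat n) / INR (S N))) (e1 (IZR n * d)))
           (Cmult (psi k) (e1 (- (IZR n * c * k))))) (zrange N))).
  - rewrite cint_csum.
    + apply csum_ext; intros n _; rewrite cint_scal by (now apply cont_osc_kernel); ring.
    + intros n; apply cont_mult; [apply cont_const|now apply cont_osc_kernel].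
  - intros k; replace (c * k - d) with (- (d - c * k)) by ring.
    rewrite fejer_mean_even, fejer_csum, Cmult_comm, <- csum_scal.
    apply csum_ext; intros n _.
    replace (IZR n * (d - c * k)) with (IZR n * d + - (IZR n * c * k)) by ring.
    rewrite e1_plus; ring.
Qed.

(** Cesaro summation of an absolutely convergent series: the weights lie in [[0, 1]] and tend to 1,
    so Tannery applies. *)
Lemma fejer_csum_cvg a S (c : Z -> R) M : has_sum a S -> (forall n, Cmod (a n) <= c n) ->
  bounded_sums c M ->
  cvg (fun N => csum (fun n => Cmult (RtoC (INR (Datatypes.S N - Z.abs_nat n) / INR (Datatypes.S N))) (a n)) (zrange N)) S.
Proof.
  intros HS Hc HM.
  apply (has_sum_tannery (fun N n => Cmult (RtoC (INR (Datatypes.S N - Z.abs_nat n) / INR (Datatypes.S N))) (a n)) a c M).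
  - intros N n; rewrite Cmod_mult, Cmod_R.
    destruct (fejer_weight_bounds N n) as [H1 H2]; rewrite Rabs_pos_eq by easy.
    specialize (Hc n); generalize (Cmod_ge_0 (a n)); nra.
  - easy.
  - intros n; apply fejer_weight_cvg.
  - intros N; apply has_sum_finite; [apply zrange_NoDup|]; intros n Hn; rewrite zrange_In in Hn.
    replace (Datatypes.S N - Z.abs_nat n)%nat with 0%nat by lia.
    unfold Rdiv; change (INR 0) with 0; rewrite Rmult_0_l; ring.
  - easy.
Qed.

(** The interval [[-2, 2]] contains the support [[-tau, tau]] of every window function. *)
Definition hhat (h : R -> R) : R -> C := osc (fun t => RtoC (h t)) 2.

(** Poisson summation over the coset [Z + s]. The Fourier coefficient of [psi] at [p] is
    [hhat h (k + p)], so the Fejer integrals of [psi] tend to the sum over [p] and, by concentration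
    at the coset, to the sum over [q]. *)
Lemma periodization h k s v : window h -> decays (hhat h) ->
  has_sum (fun q => Cmult (RtoC (h (IZR q + s))) (e1 (- (k * (IZR q + s))))) v ->
  has_sum (fun p => Cmult (e1 (IZR p * s)) (hhat h (k + IZR p))) v.
Proof.
  intros Hw Hd Hv.
  assert (Hc := window_Cc h Hw).
  set (psi := fun t => Cmult (RtoC (h t)) (e1 (- (k * t)))).
  destruct (decays_shift _ (Rabs k) Hd) as (K & HK & Hb).
  assert (HB : bounded_sums (fun p => K * / (1 + IZR p * IZR p)) (K * 6)).
  { apply bounded_sums_scal; [easy|apply bounded_sums_inv_sqr]. }
  assert (Hbp : forall p, Cmod (Cmult (e1 (IZR p * s)) (hhat h (k + IZR p))) <= K * / (1 + IZR p * IZR p)).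
  { intros p; rewrite Cmod_mult, Cmod_e1, Rmult_1_l; apply Hb, Rle_refl. }
  destruct (has_sum_dominated _ _ _ Hbp HB) as [V HV].
  replace v with V; [easy|].
  assert (H1 := fejer_csum_cvg _ _ _ _ HV Hbp HB).
  assert (Hpsi : Cc psi).
  { replace psi with (fun t => Cmult (e1 (- (k * t))) (RtoC (h t))).
    - apply Cc_mult; [apply cont_e1_lin|easy].
    - apply functional_extensionality; intros; unfold psi; ring. }
  assert (H2 := fejer_cvg psi 2 1 s v Hpsi).
  apply (cvg_unique _ _ _ H1).
  replace v with (Cmult (RtoC (/ 1)) v) by (rewrite Rinv_1; ring).
  apply (cvg_ext (fun N => cint (fun t => Cmult (RtoC (fejer_mean N (1 * t - s))) (psi t)) (- 2) 2)).
  - intros N; rewrite cint_fejer by exact (proj1 Hpsi).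
    apply csum_ext; intros n _; do 2 f_equal.
    unfold hhat, osc; apply cint_ext; intros t; unfold psi.
    rewrite <- Cmult_assoc, <- e1_plus; do 2 f_equal; ring.
  - apply H2; [|lra|lra|].
    + intros x Hx; unfold psi; rewrite (proj1 Hw) by (generalize tau_bounds; lra); ring.
    + revert Hv; apply has_sum_ext; intros q; unfold psi.
      now replace ((IZR q + s) / 1) with (IZR q + s) by field.
Qed.

(** The pairs [(- dual_point i, dual_point i + fst i)] form the dual of the lattice of pairs
    [(val i, star i)], whose covolume is [sqrt 5]; [dual_weight] evaluates [hhat h] at the internal
    coordinate of the dual pair. *)
Definition dual_point (i : Z * Z) : R := star i / sqrt 5.
Definition dual_weight (h : R -> R) (i : Z * Z) : C :=
  Cmult (RtoC (/ sqrt 5)) (hhat h (dual_point i + IZR (fst i))).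

Lemma sqrt5_pos : 2 < sqrt 5.
Proof. rewrite sqrt5_tau; generalize tau_bounds; lra. Qed.

Lemma dual_point_inj i j : dual_point i = dual_point j -> i = j.
Proof.
  unfold dual_point; intros H; assert (H5 := sqrt5_pos).
  apply (f_equal (fun x => x * sqrt 5)) in H; unfold Rdiv in H.
  rewrite !Rmult_assoc, Rinv_l, !Rmult_1_r in H by lra.
  destruct i as [n m], j as [n' m']; unfold star in H; simpl in H.
  destruct (tau_irrational (m - m' + (n - n')) (n' - n)).
  - rewrite plus_IZR, !minus_IZR; lra.
  - f_equal; lia.
Qed.

Lemma dual_local_sums h : decays (hhat h) -> forall K, exists M,
  bounded_sums (fun i => indic (Rabs (dual_point i) <= K) * Cmod (dual_weight h i)) M.
Proof.
  intros Hd K0; set (K := Rmax 0 K0).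
  destruct (decays_shift _ K Hd) as (C0 & HC & Hb).
  assert (H5 := sqrt5_pos).
  assert (HK : 0 <= K) by apply Rmax_l.
  exists ((2 * (K * sqrt 5) + 2) * (C0 * 6)).
  (* Row [p] has at most [2 * K * sqrt 5 + 2] points in [[-K, K]], and their weights are bounded by
     a multiple of [1 / (1 + p^2)]. *)
  apply (bounded_sums_prod _ (fun p => (2 * (K * sqrt 5) + 2) * (C0 * / (1 + IZR p * IZR p)))).
  - intros p.
    apply bounded_sums_le with (fun q => (C0 * / (1 + IZR p * IZR p)) * indic (Rabs (IZR q + IZR p * (1 - tau)) <= K * sqrt 5)).
    + intros q; split; [apply Rmult_le_pos; [apply indic_bounds|apply Cmod_ge_0]|].
      assert (Hp : 0 <= C0 * / (1 + IZR p * IZR p)).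
      { apply Rmult_le_pos; [easy|apply Rinv_nonneg; nra]. }
      destruct (Rle_dec (Rabs (dual_point (p, q))) K0) as [H|H].
      2: { rewrite (indic_false (Rabs (dual_point _) <= _)) by easy; rewrite Rmult_0_l.
           apply Rmult_le_pos; [easy|apply indic_bounds]. }
      assert (H' : Rabs (dual_point (p, q)) <= K) by (generalize (Rmax_r 0 K0); fold K; lra).
      rewrite !indic_true, Rmult_1_l, Rmult_1_r; [|  |easy].
      * unfold dual_weight; rewrite Cmod_mult, Cmod_R, Rabs_pos_eq by (apply Rinv_nonneg; lra).
        simpl fst; specialize (Hb _ p H').
        assert (0 < / sqrt 5 <= 1).
        { split; [apply Rinv_0_lt_compat; lra|rewrite <- Rinv_1; apply Rinv_le_contravar; lra]. }
        generalize (Cmod_ge_0 (hhat h (dual_point (p, q) + IZR p))); nra.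
      * change (IZR q + IZR p * (1 - tau)) with (star (p, q)).
        replace (star (p, q)) with (dual_point (p, q) * sqrt 5) by (unfold dual_point; field; lra).
        rewrite Rabs_mult, (Rabs_pos_eq (sqrt 5)) by lra; apply Rmult_le_compat_r; lra.
    + rewrite (Rmult_comm (2 * (K * sqrt 5) + 2)); apply bounded_sums_scal.
      * apply Rmult_le_pos; [easy|apply Rinv_nonneg; nra].
      * apply bounded_sums_interval; apply Rmult_le_pos; lra.
  - apply bounded_sums_scal; [assert (0 <= K * sqrt 5) by (apply Rmult_le_pos; lra); lra|].
    apply bounded_sums_scal; [easy|apply bounded_sums_inv_sqr].
Qed.

Lemma comb_decay_sums h Phi : window h -> decays Phi -> exists (b : Z * Z -> R) (c : Z -> R) M M',
  (forall i, Cmod (Cmult (RtoC (h (star i))) (Phi (val i))) <= b i) /\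
  bounded_sums b M /\ (forall n, bounded_sums (fun m => b (n, m)) (c n)) /\ bounded_sums c M'.
Proof.
  intros Hw (K & HK & HPhi).
  (* [72 = 8 * 9]: 8 bounds [h], and [1 + n^2 <= 9 * (1 + val^2)] holds in row [n] where
     [|star| <= 2]. *)
  set (k := fun n => 72 * K * / (1 + IZR n * IZR n)).
  assert (Hk : forall n, 0 <= k n).
  { intros n; apply Rmult_le_pos; [lra|apply Rinv_nonneg; nra]. }
  set (b := fun i : Z * Z => k (fst i) * indic (Rabs (IZR (snd i) + IZR (fst i) * (1 - tau)) <= 2)).
  assert (Hin : forall n, bounded_sums (fun m => b (n, m)) (k n * (2 * 2 + 2))).
  { intros n; apply (bounded_sums_scal _ _ (k n) (Hk n) (bounded_sums_interval (IZR n * (1 - tau)) 2 ltac:(lra))). }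
  assert (Hout : bounded_sums (fun n => k n * (2 * 2 + 2)) (6 * (72 * K * 6))).
  { assert (H : bounded_sums (fun n => 6 * k n) (6 * (72 * K * 6))).
    { apply bounded_sums_scal; [lra|]; apply bounded_sums_scal; [lra|apply bounded_sums_inv_sqr]. }
    revert H; apply bounded_sums_le; intros n; specialize (Hk n); lra. }
  exists b, (fun n => k n * (2 * 2 + 2)), (6 * (72 * K * 6)), (6 * (72 * K * 6)).
  split; [|split; [|split]]; auto.
  - intros i; rewrite Cmod_mult; unfold b.
    assert (Hws := window_weight_bound h (star i) Hw).
    change (IZR (snd i) + IZR (fst i) * (1 - tau)) with (star i).
    destruct (Rle_dec (Rabs (star i)) 2) as [Hs|Hs].
    2: { rewrite indic_false in * by easy.
         replace (Cmod (RtoC (h (star i)))) with 0; [lra|].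
         generalize (Cmod_ge_0 (RtoC (h (star i)))); lra. }
    rewrite indic_true in * by easy.
    specialize (HPhi (val i)).
    apply Rle_trans with (8 * (K * / (1 + val i * val i))).
    { apply Rmult_le_compat; try apply Cmod_ge_0; lra. }
    unfold k; rewrite Rmult_1_r.
    replace (72 * K * / (1 + IZR (fst i) * IZR (fst i))) with (8 * (K * (9 * / (1 + IZR (fst i) * IZR (fst i))))) by ring.
    apply Rmult_le_compat_l; [lra|]; apply Rmult_le_compat_l; [easy|].
    assert (E := val_star i); set (n := IZR (fst i)) in *; set (x := val i) in *.
    assert (H5 := sqrt5_pos).
    assert (Hx : 0 < 1 + x * x) by nra; assert (Hn : 0 < 1 + n * n) by nra.
    apply Rmult_le_reg_r with ((1 + x * x) * (1 + n * n)); [nra|].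
    replace (/ (1 + x * x) * ((1 + x * x) * (1 + n * n))) with (1 + n * n) by (field; lra).
    replace (9 * / (1 + n * n) * ((1 + x * x) * (1 + n * n))) with (9 * (1 + x * x)) by (field; lra).
    apply Rabs_le_between in Hs; set (s := star i) in *.
    assert (Hn2 : 4 * (n * n) <= (n * sqrt 5) * (n * sqrt 5)).
    { replace ((n * sqrt 5) * (n * sqrt 5)) with ((n * n) * (sqrt 5 * sqrt 5)) by ring.
      rewrite sqrt_sqrt by lra; generalize (Rle_0_sqr n); unfold Rsqr; lra. }
    assert (Hy : n * sqrt 5 = x - s) by lra.
    rewrite Hy in Hn2.
    assert (Hs2 : s * s <= 4) by nra.
    assert (H1 := Rle_0_sqr (x + s)); assert (H2 := Rle_0_sqr x); unfold Rsqr in H1, H2; lra.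
  - apply (bounded_sums_prod b _ _ Hin Hout).
Qed.

(* Poisson summation for the lattice of pairs [(val i, star i)]: first in the fibre
   direction, by [periodization], then along the fibres, as a Fejer limit. *)
Lemma poisson h phi A S T : window h -> decays (hhat h) ->
  Cc phi -> 0 <= A -> (forall x, A < Rabs x -> phi x = RtoC 0) -> decays (osc phi A) ->
  has_sum (fun i => Cmult (RtoC (h (star i))) (osc phi A (val i))) S ->
  has_sum (fun i => Cmult (dual_weight h i) (phi (dual_point i))) T -> S = T.
Proof.
  intros Hw Hd Hphi HA Hsup HdPhi HS HT.
  destruct Hphi as [Hphic Hphis].
  assert (H5 := sqrt5_pos).
  assert (Hh := proj1 (window_Cc h Hw)).
  assert (Hhat : cont (hhat h)) by (apply osc_continuous; [exact Hh|lra]).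
  destruct (comb_decay_sums h _ Hw HdPhi) as (b & c & M & M' & Hb & HbM & Hbc & HcM).
  assert (Ha : exists a, forall n, has_sum (fun m => Cmult (RtoC (h (star (n, m)))) (osc phi A (val (n, m)))) (a n)).
  { apply (choice (fun n s => has_sum (fun m => Cmult (RtoC (h (star (n, m)))) (osc phi A (val (n, m)))) s)).
    intros n; apply (has_sum_dominated _ (fun m => b (n, m)) (c n)); auto. }
  destruct Ha as [a Ha].
  assert (Hac : forall n, Cmod (a n) <= c n).
  { intros n; apply (has_sum_norm _ (fun m => b (n, m)) _ _ (fun m => Hb (n, m)) (Hbc n) (Ha n)). }
  assert (HaS : has_sum a S) by apply (has_sum_fubini _ _ _ HS Ha).
  assert (L1 := fejer_csum_cvg a S c M' HaS Hac HcM).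
  apply (cvg_unique _ _ _ L1).
  destruct (continuous_bounded phi (- A) A Hphic) as (Bp & HBp & HphiB).
  destruct (decays_shift _ A Hd) as (K & HK & HhatK).
  set (psi := fun (p : Z) k => Cmult (phi k) (hhat h (k + IZR p))).
  assert (Hpsi : forall p, cont (psi p)).
  { intros p; apply cont_mult; [exact Hphic|].
    replace (fun t => hhat h (t + IZR p)) with (fun t => hhat h (1 * t + IZR p)).
    - now apply cont_lin.
    - apply functional_extensionality; intros; f_equal; ring. }
  assert (HpsiB : forall p k, - A <= k <= A -> Cmod (psi p k) <= Bp * K * / (1 + IZR p * IZR p)).
  { intros p k Hk; unfold psi; rewrite Cmod_mult, Rmult_assoc.
    apply Rmult_le_compat; try apply Cmod_ge_0; [auto|].
    apply HhatK; now apply Rabs_le. }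
  assert (Hpos : forall p : Z, 0 <= Bp * K * / (1 + IZR p * IZR p)).
  { intros p; apply Rmult_le_pos; [nra|apply Rinv_nonneg; nra]. }
  assert (HKM : bounded_sums (fun p => Bp * K * / (1 + IZR p * IZR p)) (Bp * K * 6)).
  { apply bounded_sums_scal; [nra|apply bounded_sums_inv_sqr]. }
  (* The row sum [a n] is the integral over [[-A, A]] of a finite sum over [m], which
     [periodization] with [s = n * (1 - tau)] replaces by a sum over [p]. *)
  assert (Hap : forall n, has_sum (fun p => Cmult (e1 (IZR n * (IZR p * (1 - tau))))
      (cint (fun k => Cmult (psi p k) (e1 (- (IZR n * sqrt 5 * k)))) (- A) A)) (a n)).
  { intros n.
    destruct (bounded_sums_finite _ _ (bounded_sums_interval (IZR n * (1 - tau)) 2 ltac:(lra))) as (L & HL & HLin).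
    assert (Hout : forall m, ~ In m L -> h (star (n, m)) = 0).
    { intros m Hm; apply (proj1 Hw); apply Rnot_le_lt; intros Hs; apply Hm, HLin.
      change (Rabs (star (n, m)) <= 2); generalize tau_bounds; lra. }
    set (F := fun k => Cmult (Cmult (phi k) (e1 (- (IZR n * sqrt 5 * k))))
       (csum (fun m => Cmult (RtoC (h (star (n, m)))) (e1 (- (star (n, m) * k)))) L)).
    assert (HFc : cont F).
    { apply cont_mult; [now apply cont_osc_kernel|].
      apply cont_csum; intros m; apply cont_mult; [apply cont_const|apply cont_e1_lin]. }
    assert (Ean : a n = cint F (- A) A).
    { apply (has_sum_unique _ _ _ (Ha n)).
      replace (cint F (- A) A) with (csum (fun m => Cmult (RtoC (h (star (n, m)))) (osc phi A (val (n, m)))) L).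
      - apply has_sum_finite; [easy|]; intros m Hm; rewrite Hout by easy; ring.
      - rewrite (cint_ext F (fun k => csum (fun m => Cmult (RtoC (h (star (n, m))))
             (Cmult (phi k) (e1 (- (val (n, m) * k))))) L)).
        + rewrite cint_csum.
          * apply csum_ext; intros m _; rewrite cint_scal; [easy|now apply cont_osc_kernel].
          * intros m; apply cont_mult; [apply cont_const|now apply cont_osc_kernel].
        + intros k; unfold F; rewrite <- csum_scal; apply csum_ext; intros m _.
          replace (- (val (n, m) * k)) with (- (IZR n * sqrt 5 * k) + - (star (n, m) * k))
            by (rewrite val_star; simpl fst; ring).
          rewrite e1_plus; ring. }
    rewrite Ean.
    apply (has_sum_ext (fun p => cint (fun k => Cmult (e1 (IZR n * (IZR p * (1 - tau)))) (Cmult (psi p k) (e1 (- (IZR n * sqrt 5 * k))))) (- A) A)).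
    { intros p; apply cint_scal; now apply cont_osc_kernel. }
    apply (has_sum_cint _ F (fun p => Bp * K * / (1 + IZR p * IZR p)) (Bp * K * 6)); auto.
    - intros p; apply cont_mult; [apply cont_const|now apply cont_osc_kernel].
    - lra.
    - intros p k Hk; rewrite !Cmod_mult, !Cmod_e1, Rmult_1_l, Rmult_1_r; auto.
    - intros k Hk.
      assert (Hper : has_sum (fun p => Cmult (e1 (IZR p * (IZR n * (1 - tau)))) (hhat h (k + IZR p)))
         (csum (fun m => Cmult (RtoC (h (star (n, m)))) (e1 (- (star (n, m) * k)))) L)).
      { apply periodization; auto.
        apply (has_sum_ext (fun m => Cmult (RtoC (h (star (n, m)))) (e1 (- (star (n, m) * k))))).
        - intros m; unfold star; simpl; do 3 f_equal; ring.
        - apply has_sum_finite; [easy|]; intros m Hm; rewrite Hout by easy; ring. }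
      assert (Hs := has_sum_scal (Cmult (phi k) (e1 (- (IZR n * sqrt 5 * k)))) _ _ Hper).
      revert Hs; apply has_sum_ext; intros p; unfold psi.
      replace (IZR p * (IZR n * (1 - tau))) with (IZR n * (IZR p * (1 - tau))) by ring; ring. }
  (* For each [p] only finitely many dual points meet the support of [phi], so the samples of
     [psi p] at them can be summed. *)
  assert (Hv : exists v, forall p, has_sum (fun q => psi p ((IZR q + IZR p * (1 - tau)) / sqrt 5)) (v p)).
  { apply (choice (fun p s => has_sum (fun q => psi p ((IZR q + IZR p * (1 - tau)) / sqrt 5)) s)).
    intros p.
    destruct (bounded_sums_finite _ _ (bounded_sums_interval (IZR p * (1 - tau)) (A * sqrt 5) ltac:(nra))) as (L & HL & HLin).
    exists (csum (fun q => psi p ((IZR q + IZR p * (1 - tau)) / sqrt 5)) L).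
    apply has_sum_finite; [easy|]; intros q Hq; unfold psi; rewrite Hsup; [ring|].
    apply Rnot_le_lt; intros Hle; apply Hq, HLin.
    unfold Rdiv in Hle; rewrite Rabs_mult, (Rabs_pos_eq (/ sqrt 5)) in Hle by (apply Rinv_nonneg; lra).
    apply (Rmult_le_compat_r (sqrt 5)) in Hle; [|lra].
    rewrite Rmult_assoc, Rinv_l, Rmult_1_r in Hle by lra; exact Hle. }
  destruct Hv as [v Hv].
  destruct (fejer_uniform_bound (sqrt 5) A) as (Mf & HMf & Hf); [lra|easy|].
  (* At each [N] the finite sum over [n] is exchanged with the sum over [p]; for fixed [p] it
     collects into a Fejer integral of [psi p], whose limit is [/ sqrt 5] times the sum over [q]. *)
  apply (has_sum_tannery
    (fun N p => cint (fun k => Cmult (RtoC (fejer_mean N (sqrt 5 * k - IZR p * (1 - tau)))) (psi p k)) (- A) A)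
    (fun p => Cmult (RtoC (/ sqrt 5)) (v p))
    (fun p => Mf * (Bp * K * / (1 + IZR p * IZR p))) (Mf * (Bp * K * 6))).
  - intros N p; apply Hf; auto.
  - now apply bounded_sums_scal.
  - intros p; apply fejer_cvg; [|intros x Hx|easy|lra|apply Hv].
    + replace (psi p) with (fun k => Cmult (hhat h (1 * k + IZR p)) (phi k)).
      * apply Cc_mult; [now apply (cont_lin (hhat h))|now split].
      * apply functional_extensionality; intros k; unfold psi; rewrite Rmult_1_l; ring.
    + unfold psi; rewrite Hsup by easy; ring.
  - intros N.
    eapply has_sum_ext; [|apply has_sum_csum; intros n; apply has_sum_scal, Hap].
    intros p; cbv beta; rewrite cint_fejer by auto; apply csum_ext; intros n _; easy.
  - apply (has_sum_fubini _ _ _ HT); intros p.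
    apply (has_sum_ext (fun q => Cmult (RtoC (/ sqrt 5)) (psi p ((IZR q + IZR p * (1 - tau)) / sqrt 5)))).
    + intros q; unfold psi, dual_weight, dual_point, star; simpl; ring.
    + apply has_sum_scal, Hv.
Qed.

(** * Fourier integrals of smooth test functions *)

Lemma derive_outside (f : R -> R) A x : (forall y, A < Rabs y -> f y = 0) -> A < Rabs x ->
  Derive f x = 0.
Proof.
  intros Hf Hx; apply is_derive_unique.
  apply (is_derive_ext_loc (fun _ => 0)); [|apply (is_derive_const (K := R_AbsRing) (V := R_NormedModule))].
  exists (mkposreal (Rabs x - A) ltac:(lra)); intros y Hy; symmetry; apply Hf.
  change (Rabs (y - x) < Rabs x - A) in Hy.
  assert (K := Rabs_triang_inv x y); rewrite Rabs_minus_sym in Hy; lra.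
Qed.

(* Two integrations by parts at once: the derivative of [G] is [w^2 f k + f'' k], and [G]
   vanishes at both ends. *)
Lemma smooth_osc_decay (f : R -> R) A : (forall n x, ex_derive_n f n x) -> 0 <= A ->
  (forall x, A < Rabs x -> f x = 0) -> exists K, 0 <= K /\ forall w (k k1 : R -> R), w <> 0 ->
    (forall x, is_derive k x (w * k1 x)) -> (forall x, is_derive k1 x (- (w * k x))) ->
    (forall x, Rabs (k x) <= 1) ->
    Rabs (RInt (fun t => f t * k t) (- (A + 1)) (A + 1)) <= K / (w * w).
Proof.
  intros Hs HA Hsup.
  set (f1 := Derive f); set (f2 := Derive f1).
  assert (D0 : forall x, is_derive f x (f1 x)) by (intros x; apply Derive_correct, (Hs 1%nat)).
  assert (D1 : forall x, is_derive f1 x (f2 x)) by (intros x; apply Derive_correct, (Hs 2%nat)).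
  assert (C2 : forall x, continuous f2 x).
  { intros x; apply ex_derive_cont, (Hs 3%nat). }
  assert (C0 : forall x, continuous f x).
  { intros x; apply ex_derive_cont; eexists; apply D0. }
  (* Strictly beyond the support, where [f] and [f1] both vanish. *)
  set (a := A + 1).
  assert (Z0 : forall x, A < Rabs x -> f1 x = 0) by (intros x; now apply derive_outside).
  assert (Ho : A < Rabs a /\ A < Rabs (- a)) by (rewrite Rabs_Ropp, Rabs_pos_eq; unfold a; lra).
  destruct Ho as [Ho1 Ho2].
  destruct (continuous_bounded (fun t => RtoC (f2 t)) (- a) a (cont_RtoC _ C2)) as (B & HB & HfB).
  exists (2 * a * B); split; [unfold a; nra|]; intros w k k1 Hw Dk Dk1 Hk1.
  assert (Hk : forall x, continuous k x).
  { intros x; apply ex_derive_cont; eexists; apply Dk. }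
  assert (Hc0 : forall x, continuous (fun t => f t * k t) x).
  { intros x; now apply (continuous_mult (K := R_AbsRing)). }
  assert (Hc2 : forall x, continuous (fun t => f2 t * k t) x).
  { intros x; now apply (continuous_mult (K := R_AbsRing)). }
  assert (Hc1 : forall x, continuous (fun t => w * w * (f t * k t)) x).
  { intros x; apply (continuous_scal_r (w * w) (fun t => f t * k t)), Hc0. }
  set (G := fun t => f t * - (w * k1 t) + f1 t * k t).
  assert (HG : forall x, is_derive G x (w * w * (f x * k x) + f2 x * k x)).
  { intros x; unfold G; evar_last.
    - apply (is_derive_plus (K := R_AbsRing) (V := R_NormedModule)).
      + apply (is_derive_mult f (fun t => - (w * k1 t)) x (f1 x) (- (w * - (w * k x)))); [apply D0| |intros; apply Rmult_comm].
        apply (is_derive_opp (K := R_AbsRing) (V := R_NormedModule)).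
        apply (is_derive_scal k1 x w), Dk1.
      + apply (is_derive_mult f1 k x (f2 x) (w * k1 x)); [apply D1|apply Dk|intros; apply Rmult_comm].
    - unfold plus, mult; simpl; ring. }
  assert (HI : RInt (fun t => w * w * (f t * k t) + f2 t * k t) (- a) a = 0).
  { apply is_RInt_unique, (is_RInt_eq _ _ _ (G a - G (- a))).
    - apply (is_RInt_derive (V := R_CompleteNormedModule)); [intros; apply HG|].
      intros; now apply (continuous_plus (fun t => w * w * (f t * k t)) (fun t => f2 t * k t)).
    - unfold G; rewrite !Hsup, !Z0 by easy; ring. }
  assert (E : RInt (fun t => w * w * (f t * k t) + f2 t * k t) (- a) a
     = w * w * RInt (fun t => f t * k t) (- a) a + RInt (fun t => f2 t * k t) (- a) a).
  { rewrite <- RInt_scal_eq by easy.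
    apply (RInt_plus (V := R_CompleteNormedModule) (fun t => w * w * (f t * k t)) (fun t => f2 t * k t));
      now apply ex_RInt_cont. }
  assert (HJ : Rabs (RInt (fun t => f2 t * k t) (- a) a) <= 2 * a * B).
  { rewrite <- Cmod_R, <- cint_RtoC by easy.
    replace (2 * a * B) with ((a - - a) * B) by ring.
    apply cint_bound; [now apply cont_RtoC|unfold a; lra|].
    intros x Hx; rewrite Cmod_R, Rabs_mult; specialize (HfB x Hx); rewrite Cmod_R in HfB.
    specialize (Hk1 x); generalize (Rabs_pos (f2 x)) (Rabs_pos (k x)); nra. }
  set (I := RInt (fun t => f t * k t) (- a) a) in *; set (J := RInt (fun t => f2 t * k t) (- a) a) in *.
  assert (Hww : 0 < w * w) by nra.
  apply Rmult_le_reg_r with (w * w); [easy|].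
  unfold Rdiv; rewrite Rmult_assoc, Rinv_l, Rmult_1_r by lra.
  rewrite <- (Rabs_pos_eq (w * w)), <- Rabs_mult by lra.
  replace (I * (w * w)) with (- J) by lra; now rewrite Rabs_Ropp.
Qed.

Lemma smooth_real_decays (f : R -> R) A : (forall n x, ex_derive_n f n x) -> 0 <= A ->
  (forall x, A < Rabs x -> f x = 0) -> decays (osc (fun t => RtoC (f t)) (A + 1)).
Proof.
  intros Hs HA Hsup.
  assert (Hf : forall x, continuous f x).
  { intros x; apply ex_derive_cont, (Hs 1%nat). }
  destruct (osc_bound _ (A + 1) (cont_RtoC f Hf)) as (M & HM & HMb); [lra|].
  destruct (smooth_osc_decay f A Hs HA Hsup) as (K & HK & H).
  apply (decays_intro _ M (2 * K)); auto; [lra|]; intros y Hy.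
  assert (HP : 3 < PI) by (generalize PI2_3_2; lra).
  assert (Hyw := sqr_le_angular y HP).
  assert (Hyy : 0 < y * y) by nra.
  eapply Rle_trans; [now apply osc_real_bound|].
  set (w := 2 * PI * y) in *.
  assert (Hw : w <> 0) by (unfold w; apply Rmult_integral_contrapositive_currified; lra).
  assert (C1 : Rabs (RInt (fun t => f t * cos (w * t)) (- (A + 1)) (A + 1)) <= K / (w * w)).
  { apply (H w (fun t => cos (w * t)) (fun t => - sin (w * t)) Hw).
    - intros x; auto_derive; [easy|ring].
    - intros x; auto_derive; [easy|ring].
    - intros x; apply Rabs_le, COS_bound. }
  assert (C2 : Rabs (RInt (fun t => f t * - sin (w * t)) (- (A + 1)) (A + 1)) <= K / (w * w)).
  { apply (H w (fun t => - sin (w * t)) (fun t => - cos (w * t)) Hw).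
    - intros x; auto_derive; [easy|ring].
    - intros x; auto_derive; [easy|ring].
    - intros x; rewrite Rabs_Ropp; apply Rabs_le, SIN_bound. }
  assert (K / (w * w) <= K / (y * y)).
  { apply Rmult_le_compat_l; [easy|apply Rinv_le_contravar; lra]. }
  replace (2 * K / (y * y)) with (K / (y * y) + K / (y * y)) by (field; lra); lra.
Qed.

Lemma smooth_decays phi A : smooth phi -> 0 <= A ->
  (forall x, A < Rabs x -> phi x = RtoC 0) -> decays (osc phi (A + 1)).
Proof.
  intros Hs HA Hsup.
  destruct (smooth_real_decays (fun t => Re (phi t)) A) as (K1 & HK1 & H1); [intros; apply Hs|easy| |].
  { intros x Hx; rewrite Hsup by easy; reflexivity. }
  destruct (smooth_real_decays (fun t => Im (phi t)) A) as (K2 & HK2 & H2); [intros; apply Hs|easy| |].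
  { intros x Hx; rewrite Hsup by easy; reflexivity. }
  exists (K1 + K2); split; [lra|]; intros y; specialize (H1 y); specialize (H2 y).
  assert (Hr : forall r : R -> R, (forall x, ex_derive_n r 1 x) -> cont (fun t => Cmult (RtoC (r t)) (e1 (- (y * t))))).
  { intros r Hr; apply cont_osc_kernel, cont_RtoC; intros x.
    apply ex_derive_cont, (Hr x). }
  replace (osc phi (A + 1) y) with
    (Cplus (osc (fun t => RtoC (Re (phi t))) (A + 1) y) (Cmult Ci (osc (fun t => RtoC (Im (phi t))) (A + 1) y))).
  - eapply Rle_trans; [apply Cmod_triangle|]; rewrite Cmod_mult, Cmod_Ci; lra.
  - unfold osc; rewrite <- cint_scal, <- cint_plus.
    + apply cint_ext; intros t; rewrite Cmult_assoc, <- Cmult_plus_distr_r; f_equal.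
      destruct (phi t); unfold Cplus, Cmult, Ci, RtoC, Re, Im; simpl; f_equal; ring.
    + apply Hr; intros; apply Hs.
    + apply cont_mult; [apply cont_const|]; apply Hr; intros; apply Hs.
    + apply Hr; intros; apply Hs.
Qed.

Lemma fourier_osc phi A : cont phi -> (forall x, A < Rabs x -> phi x = RtoC 0) -> 0 <= A ->
  forall x, fourier phi x = osc phi A x.
Proof.
  intros Hc Hsup HA x; unfold fourier.
  apply (is_RInt_gen_unique (V := C_R_CompleteNormedModule)).
  replace (fun k => Cmult (phi k) (cos (2 * PI * k * x), - sin (2 * PI * k * x)))
    with (fun k => Cmult (phi k) (e1 (- (x * k)))).
  2: { apply functional_extensionality; intros k; unfold e1.
       replace (2 * PI * - (x * k)) with (- (2 * PI * k * x)) by ring; now rewrite cos_neg, sin_neg. }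
  intros P HP.
  (* The integrals are constant once the interval contains the support, so the improper limit is
     attained. *)
  apply (Filter_prod _ _ _ (fun a => a < - A) (fun b => A < b)).
  - now exists (- A).
  - now exists A.
  - intros a b Ha Hb; exists (osc phi A x); split; [|now apply locally_singleton].
    unfold osc; rewrite <- (cint_support _ (- A) A a b); try lra.
    + apply cint_is; now apply cont_osc_kernel.
    + now apply cont_osc_kernel.
    + intros t Ht; rewrite Hsup; [ring|]; unfold Rabs; destruct Rcase_abs; lra.
Qed.

(** * The Fourier transform of a comb *)

Lemma Cc_cutoff n : Cc (cutoff n).
Proof.
  split.
  - intros x; unfold cutoff; apply continuous_RtoC.
    apply (continuous_ext (fun t => Rmax 0 (- Rmax (-1) (Rabs t - (INR n + 1))))).
    + intros t; f_equal; unfold Rmax, Rmin; destruct Rle_dec, Rle_dec; lra.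
    + apply continuous_Rmax; [apply continuous_const|].
      apply (continuous_opp (fun t => Rmax (-1) (Rabs t - (INR n + 1)))).
      apply continuous_Rmax; [apply continuous_const|].
      apply (continuous_minus Rabs (fun _ => INR n + 1)); [apply continuous_Rabs|apply continuous_const].
  - exists (INR n + 1); intros x Hx; unfold cutoff; f_equal.
    apply Rmax_left; eapply Rle_trans; [apply Rmin_r|lra].
Qed.

Lemma Cmod_cutoff n x : Cmod (cutoff n x) <= 1.
Proof.
  unfold cutoff; rewrite Cmod_R, Rabs_pos_eq by apply Rmax_l.
  apply Rmax_lub; [lra|apply Rmin_l].
Qed.

Lemma cutoff_one n x : Rabs x <= INR n -> cutoff n x = RtoC 1.
Proof. intros H; unfold cutoff; f_equal; rewrite Rmin_left, Rmax_right; lra. Qed.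

(** One summable majorant [b] gives both the integrability with respect to the total variation and
    the dominated convergence along the cutoffs. *)
Lemma comb_integral h mu F S : window h -> comb h mu -> cont F -> decays F ->
  has_sum (fun i => Cmult (RtoC (h (star i))) (F (val i))) S -> is_integral mu F S.
Proof.
  intros Hw [_ H] HF Hd HS.
  destruct (comb_decay_sums h F Hw Hd) as (b & c & M & M' & Hb & HbM & _ & _).
  split.
  - exists M; intros g Hg HgF.
    apply (has_sum_norm _ b _ _) with (3 := H g Hg); [|easy].
    intros i; eapply Rle_trans; [|apply Hb]; rewrite !Cmod_mult.
    apply Rmult_le_compat_l; [apply Cmod_ge_0|apply HgF].
  - apply cvg_filterlim.
    apply (has_sum_tannery (fun n i => Cmult (RtoC (h (star i))) (Cmult (F (val i)) (cutoff n (val i))))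
      (fun i => Cmult (RtoC (h (star i))) (F (val i))) b M); auto.
    + intros n i; rewrite Cmult_assoc, Cmod_mult.
      specialize (Hb i); assert (H1 := Cmod_cutoff n (val i)).
      assert (H0 := Cmod_ge_0 (Cmult (RtoC (h (star i))) (F (val i)))); nra.
    + intros i eps He; destruct (INR_unbounded (Rabs (val i))) as [N HN].
      exists N; intros n Hn; rewrite cutoff_one.
      * rewrite Cmult_1_r, Cmod_minus_diag; lra.
      * apply le_INR in Hn; lra.
    + intros n; apply (H (fun x => Cmult (F x) (cutoff n x))), Cc_mult; [exact HF|apply Cc_cutoff].
Qed.

Lemma comb_fourier h mu : window h -> decays (hhat h) -> comb h mu ->
  exists rho, is_fourier_transform mu rho /\ pure_point rho.
Proof.
  intros Hw Hd H.
  assert (Hrho := atomic_total_sum dual_point (dual_weight h) (dual_local_sums h Hd)).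
  set (rho := fun g => total_sum _) in Hrho.
  exists rho; split; [|exact (atomic_pure_point _ _ _ dual_point_inj Hrho)].
  split; [exact (atomic_measure _ _ _ Hrho)|].
  intros phi Hphi Hs.
  destruct (Cc_support phi Hphi) as (A & HA & Hsup).
  assert (Hsup' : forall x, A + 1 < Rabs x -> phi x = RtoC 0) by (intros x Hx; apply Hsup; lra).
  assert (HdPhi : decays (osc phi (A + 1))) by (apply smooth_decays; auto; lra).
  replace (fourier phi) with (osc phi (A + 1)).
  2: { apply functional_extensionality; intros x; symmetry; apply fourier_osc; [exact (proj1 Hphi)|easy|lra]. }
  apply (comb_integral h); auto.
  - apply osc_continuous; [exact (proj1 Hphi)|lra].
  - destruct (comb_decay_sums h _ Hw HdPhi) as (b & c & M & M' & Hb & HbM & _ & _).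
    destruct (has_sum_dominated _ _ _ Hb HbM) as [S HS].
    replace (rho phi) with S; [easy|].
    apply (poisson h phi (A + 1) S (rho phi)); auto; [lra|].
    apply (proj2 Hrho), Hphi.
Qed.

Theorem theorem10 :
  (exists nu : letter -> letter -> functional, is_solution nu) /\
  forall nu : letter -> letter -> functional, is_solution nu ->
    (forall nu' : letter -> letter -> functional, is_solution nu' ->
       forall i j : letter, meas_eq (nu' i j) (nu i j)) /\
    (forall i j : letter,
       exists mu_s mu_0 : functional, eberlein_decomposition (nu i j) mu_s mu_0) /\
    (forall nu_s nu_0 : letter -> letter -> functional,
       (forall i j : letter, eberlein_decomposition (nu i j) (nu_s i j) (nu_0 i j)) ->
       forall i j : letter, meas_eq (nu_0 i j) mzero) /\
    (forall i j : letter,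
       exists nu_hat : functional,
         is_fourier_transform (nu i j) nu_hat /\ pure_point nu_hat).
Proof.
  split.
  - destruct solution_exists as [nu H]; exists nu; now apply comb_solution.
  - intros nu H; assert (Hc := solution_comb nu H); repeat split.
    + intros nu' H' i j; now apply solution_unique.
    + intros i j; exists (nu i j), mzero.
      apply (comb_eberlein (overlap i j)); [apply overlap_window|apply Hc].
    + intros nu_s nu_0 HE i j.
      apply (comb_null_part (overlap i j) (nu i j) (nu_s i j)); [apply overlap_window|apply Hc|apply HE].
    + intros i j; apply (comb_fourier (overlap i j)); [apply overlap_window|apply overlap_decays|apply Hc].
Qed.
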